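(* Let $\Bbbk$ be an algebraically closed field of characteristic $0$, let $m=4t$ with $t\ge3$, and let $\mathbb D_m$ be the dihedral group of order $2m$. Let $A$ be a finite-dimensional pointed Hopf algebra over $\Bbbk$ with $G(A)=\mathbb D_m$. Then $A$ is generated (as an algebra) by group-like and skew-primitive elements.
   Context: $G(A)$ denotes the group of group-like elements of $A$; $A$ is pointed if its coradical equals $\Bbbk G(A)$. An element $a\in A$ is skew-primitive if $\Delta(a)=a\otimes s+s'\otimes a$ for some $s,s'\in G(A)$. *)

(* Defs.v *)
From HB Require Import structures.
From mathcomp Require Import all_boot all_order all_algebra.
From mathcomp Require Import all_fingroup all_solvable all_field.

Set Implicit Arguments.
Unset Strict Implicit.
Unset Printing Implicit Defensive.

Import GRing.Theory.
Local Open Scope ring_scope.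

(* Tensor product of finite-dimensional spaces: coordinates in the basis      *)
(* (e_i (x) f_j), where (e_i) and (f_j) are the bases of U and V chosen by    *)
(* the library. The universal property is given by tlift_tens (existence) and *)
(* tens_eq_lin (uniqueness) below; nothing depends on the choice of bases.    *)
Definition tensor (K : fieldType) (U V : vectType K) :=
  'M[K]_(\dim {:U}, \dim {:V}).

Reserved Notation "u ⊗ v" (at level 40, left associativity).

Section Tensor.
Variable K : fieldType.
Implicit Types U V W : vectType K.

Definition tens U V (u : U) (v : V) : tensor U V :=
  \matrix_(i, j) (coord (vbasis {:U}) i u * coord (vbasis {:V}) j v).

Local Notation "u ⊗ v" := (tens u v).

(* The linear map U (x) V -> W sending u (x) v to f u v, for f bilinear. *)
Definition tlift U V W (f : U -> V -> W) (x : tensor U V) : W :=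
  \sum_i \sum_j x i j *: f (vbasis {:U})`_i (vbasis {:V})`_j.

Fact tlift_is_linear U V W (f : U -> V -> W) : linear (tlift f).
Proof.
move=> a x y; rewrite /tlift scaler_sumr -big_split; apply: eq_bigr => i _ /=.
rewrite scaler_sumr -big_split; apply: eq_bigr => j _ /=.
by rewrite !mxE scalerDl scalerA.
Qed.
HB.instance Definition _ U V W (f : U -> V -> W) :=
  GRing.isLinear.Build K (tensor U V) W *:%R (tlift f) (tlift_is_linear f).

Definition bilin U V W (f : U -> V -> W) : Prop :=
  (forall v, linear (f^~ v)) /\ (forall u, linear (f u)).

Lemma tens_bilin U V : bilin (@tens U V).
Proof.
by split=> [v a x y | u a x y]; apply/matrixP=> i j; rewrite !mxE linearP /=;
   rewrite ?mulrDl ?mulrDr ?mulrA // [a * _]mulrC.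
Qed.

Lemma tlift_tens U V W (f : U -> V -> W) u v :
  bilin f -> tlift f (u ⊗ v) = f u v.
Proof.
case=> fl fr.
pose fL (y : V) := GRing.isLinear.Build K U W *:%R (f^~ y) (fl y).
pose lL (y : V) : {linear U -> W} := HB.pack (f^~ y) (fL y).
pose fR (x : U) := GRing.isLinear.Build K V W *:%R (f x) (fr x).
pose lR (x : U) : {linear V -> W} := HB.pack (f x) (fR x).
have -> : f u v = \sum_i coord (vbasis {:U}) i u *: f (vbasis {:U})`_i v.
  rewrite -[f u v]/(lL v u) {1}(coord_vbasis (memvf u)) linear_sum.
  by apply: eq_bigr => i _; rewrite linearZ.
apply: eq_bigr => i _.
rewrite -[f _ v]/(lR (vbasis {:U})`_i v) {2}(coord_vbasis (memvf v)).
rewrite linear_sum scaler_sumr; apply: eq_bigr => j _.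
by rewrite linearZ /= scalerA mxE.
Qed.

Lemma tens_basis U V (x : tensor U V) :
  x = \sum_i \sum_j x i j *: ((vbasis {:U})`_i ⊗ (vbasis {:V})`_j).
Proof.
have c T i k : coord (vbasis {:T}) i (vbasis {:T})`_(k : 'I__) = (i == k)%:R :> K.
  by rewrite coord_free ?(basis_free (vbasisP _)) // eq_sym.
apply/matrixP=> p q; rewrite summxE (bigD1 p) //= summxE (bigD1 q) //=.
rewrite !mxE !c !eqxx !mulr1 !big1 ?addr0 // => [i ip | j jq].
  by rewrite summxE big1 // => j _; rewrite !mxE !c eq_sym (negPf ip) mul0r mulr0.
by rewrite !mxE !c eqxx mul1r eq_sym (negPf jq) mulr0.
Qed.

Lemma tens_eq_lin U V W (f g : {linear tensor U V -> W}) :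
  (forall u v, f (u ⊗ v) = g (u ⊗ v)) -> f =1 g.
Proof.
move=> fg x; rewrite (tens_basis x) !linear_sum; apply: eq_bigr => i _.
by rewrite !linear_sum; apply: eq_bigr => j _; rewrite !linearZ fg.
Qed.

Definition tmap U V U' V' (f : U -> U') (g : V -> V') :
    tensor U V -> tensor U' V' :=
  tlift (fun u v => f u ⊗ g v).

(* The associator (U (x) V) (x) W -> U (x) (V (x) W). *)
Definition tassoc U V W : tensor (tensor U V) W -> tensor U (tensor V W) :=
  tlift (fun p w => tlift (fun u v => u ⊗ (v ⊗ w)) p).

(* C (x) D as a subspace of U (x) V. *)
Definition tensv U V (C : {vspace U}) (D : {vspace V}) : {vspace tensor U V} :=
  <<[seq u ⊗ v | u <- vbasis C, v <- vbasis D]>>%VS.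

Lemma tmap_tens U V U' V' (f : {linear U -> U'}) (g : {linear V -> V'}) u v :
  tmap f g (u ⊗ v) = f u ⊗ g v.
Proof.
have [tl tr] := tens_bilin U' V'; apply: tlift_tens.
by split=> [z a x y | z a x y]; rewrite linearP ?tl ?tr.
Qed.

Lemma tassoc_tens U V W (u : U) (v : V) (w : W) :
  tassoc ((u ⊗ v) ⊗ w) = u ⊗ (v ⊗ w).
Proof.
have b1 (z : W) : bilin (fun (x : U) (y : V) => x ⊗ (y ⊗ z)).
  split=> [y a x x' | x a y y']; first exact: (tens_bilin U _).1.
  by rewrite (tens_bilin V W).1 (tens_bilin U _).2.
rewrite /tassoc tlift_tens; first by rewrite tlift_tens.
split=> [z a x y | p a z z']; first exact: linearP.
rewrite /tlift scaler_sumr -big_split; apply: eq_bigr => i _ /=.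
rewrite scaler_sumr -big_split; apply: eq_bigr => j _ /=.
by rewrite (tens_bilin V W).2 (tens_bilin U _).2 scalerDr !scalerA [a * _]mulrC.
Qed.

Lemma mem_tensv U V (C : {vspace U}) (D : {vspace V}) u v :
  u \in C -> v \in D -> u ⊗ v \in tensv C D.
Proof.
move=> uC vD; have [tl tr] := tens_bilin U V.
have linL z : linear (fun x : U => x ⊗ (z : V)) := tl z.
have linR z : linear (fun x : V => (z : U) ⊗ x) := tr z.
pose lL (y : V) : {linear U -> tensor U V} :=
  HB.pack (fun x : U => x ⊗ y) (GRing.isLinear.Build K U _ *:%R _ (linL y)).
pose lR (x : U) : {linear V -> tensor U V} :=
  HB.pack (fun y : V => x ⊗ y) (GRing.isLinear.Build K V _ *:%R _ (linR x)).
rewrite -[u ⊗ v]/(lL v u) (coord_vbasis uC) linear_sum memv_suml // => i _.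
rewrite linearZ memvZ // -[lL v _]/(lR (vbasis C)`_i v) (coord_vbasis vD).
rewrite linear_sum memv_suml // => j _; rewrite linearZ memvZ // memv_span //.
by apply/allpairsP; exists ((vbasis C)`_i, (vbasis D)`_j);
   rewrite !mem_nth ?size_tuple.
Qed.

End Tensor.

Notation "u ⊗ v" := (tens u v) : ring_scope.

(* (a (x) b) (c (x) d) = ac (x) bd *)
Definition tmul (K : fieldType) (A B : falgType K) (x y : tensor A B) :
    tensor A B :=
  tlift (fun a b => tlift (fun c d => (a * c) ⊗ (b * d)) y) x.

Lemma tmul_tens (K : fieldType) (A B : falgType K) (a c : A) (b d : B) :
  tmul (a ⊗ b) (c ⊗ d) = (a * c) ⊗ (b * d).
Proof.
have [tl tr] := tens_bilin A B.
have b1 (x : A) (y : B) : bilin (fun (c : A) (d : B) => (x * c) ⊗ (y * d)).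
  split=> [d' k z z' | c' k z z'].
    by rewrite mulrDr -scalerAr tl.
  by rewrite mulrDr -scalerAr tr.
rewrite /tmul tlift_tens; first by rewrite tlift_tens.
split=> [y k x x' | x k y y']; rewrite !tlift_tens //.
  by rewrite mulrDl -scalerAl tl.
by rewrite mulrDl -scalerAl tr.
Qed.

HB.mixin Record Vector_isCoalgebra (K : fieldType) V of Vector K V := {
  comul : {linear V -> tensor V V};
  counit : {scalar V};
  comulA : forall x : V,
    tassoc (tmap comul idfun (comul x)) = tmap idfun comul (comul x);
  counitl : forall x : V, tlift (fun u v => counit u *: v) (comul x) = x;
  counitr : forall x : V, tlift (fun u v => counit v *: u) (comul x) = x
}.

#[short(type="fcoalgType")]
HB.structure Definition FCoalgebra (K : fieldType) :=
  { V of Vector K V & Vector_isCoalgebra K V }.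

HB.mixin Record Falgebra_isHopf (K : fieldType) A
    of Falgebra K A & FCoalgebra K A := {
  comul1 : comul (1 : A) = 1 ⊗ 1;
  comulM : forall x y : A, comul (x * y) = tmul (comul x) (comul y);
  counit1 : counit (1 : A) = 1;
  counitM : forall x y : A, counit (x * y) = counit x * counit y;
  antipode : {linear A -> A};
  antipodel : forall x : A,
    tlift (fun u v => antipode u * v) (comul x) = counit x *: 1;
  antipoder : forall x : A,
    tlift (fun u v => u * antipode v) (comul x) = counit x *: 1
}.

#[short(type="fhopfType")]
HB.structure Definition FHopf (K : fieldType) :=
  { A of Falgebra K A & FCoalgebra K A & Falgebra_isHopf K A }.

Section Coalgebra.
Variables (K : fieldType) (V : fcoalgType K).
Implicit Types (C D : {vspace V}) (g x : V).

Definition grouplike g : bool := (comul g == g ⊗ g) && (counit g == 1).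

Definition skew_primitive x : Prop :=
  exists s s', [/\ grouplike s, grouplike s' & comul x = x ⊗ s + s' ⊗ x].

Definition subcoalgebra C : Prop := forall x, x \in C -> comul x \in tensv C C.

Definition simple_subcoalgebra C : Prop :=
  [/\ subcoalgebra C, C <> 0%VS
    & forall D, subcoalgebra D -> (D <= C)%VS -> D = 0%VS \/ D = C].

(* Membership in the (possibly infinite) sum of all simple subcoalgebras. *)
Definition in_coradical x : Prop :=
  exists Cs : seq {vspace V},
    (forall C, C \in Cs -> simple_subcoalgebra C) /\
    x \in (\sum_(C <- Cs) C)%VS.

Definition in_grouplike_span x : Prop :=
  exists2 gs : seq V, all grouplike gs & x \in <<gs>>%VS.

Definition pointed : Prop := forall x, in_coradical x <-> in_grouplike_span x.

End Coalgebra.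

Arguments pointed {K} V.

(* G(A) is isomorphic, as a group, to gT. For gT := 'D_n, beware that the     *)
(* library indexes dihedral groups by their order n.                          *)
Definition grouplikes_isog (K : fieldType) (A : fhopfType K)
    (gT : finGroupType) : Prop :=
  exists phi : gT -> A,
    [/\ injective phi,
        phi 1%g = 1,
        forall x y, phi (x * y)%g = phi x * phi y
      & forall a, grouplike a <-> exists x, a = phi x].

(* Every element lies in the unital subalgebra generated by finitely many     *)
(* elements satisfying P.                                                     *)
Definition generated_by (K : fieldType) (A : falgType K) (P : A -> Prop) :
    Prop :=
  forall a : A, exists s : seq A,
    (forall x, x \in s -> P x) /\ a \in agenv <<s>>%VS.

(* Main.v *)
Require Import Defs.
From HB Require Import structures.
From mathcomp Require Import all_boot all_order all_algebra.
From mathcomp Require Import zify.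
From mathcomp Require Import all_fingroup all_solvable all_field.
Import Order.TTheory GRing.Theory Num.Theory.
Local Open Scope ring_scope.

Set Implicit Arguments.
Unset Strict Implicit.
Unset Printing Implicit Defensive.

(** The coradical filtration is described by the action [hit f a = a_1 f(a_2)]
of the dual algebra, and it exhausts A because A is pointed. On the symbols of
filtered operators, multiplication by a skew-primitive x of type v raises the
degree, each functional l vanishing on G(A) gives a lowering skew-derivation,
and their commutator is l(x) times the multiplication by v. Raising operators
are nilpotent, so in characteristic 0 no suitable pair of operators can satisfy
a Heisenberg relation with non-zero constant. This excludes, in turn:
skew-primitives of type a reflection; eigenvectors x of type a rotation v with
v x v^-1 <> - x; pairs of such eigenvectors x, y with q_xy q_yx <> 1; and
functionals f_k f_l - q f_l f_k that do not vanish in degree two, where the f_k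
are dual to a basis x_k of the skew-primitives. Thus the derivations f_k
q-commute up to lower terms, and an element r of a given degree is reduced to
lower degree by subtracting the products x_k (v_k^-1 (hit f_k r)). *)

(** * Duals of coalgebras *)

(** If D z = z D + c T with T invertible and commuting with z, and D v = 0, then D (z^(n+1) v) =
    (n+1) c T (z^n v), so no power of z kills v, although z raises degrees in a finite-dimensional
    space. A single skew-primitive z suffices only when its type commutes with it. Otherwise
    conjugation by s supplies a partner of inverse type, and the q-commutator of the two (or of two
    quadratic expressions of inverse types) has trivial type, like an imaginary root vector of an
    affine Lie algebra. With q_xy the scalar by which the type of x acts on y, this leaves q_xx = -1
    and q_xy q_yx = 1 or -1 for rotation vectors; the value -1 is excluded by 2-adic arithmetic of
    exponents, which uses that 4 divides m. The obstacle to generation is an element of degree two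
    that is not a sum of products. A functional f_k f_l - q f_l f_k vanishes on products of two
    elements of degree one, so it can only detect such an element; v_k v_l acts on it by q_kk q_kl
    q_lk q_ll = 1, which again yields a z as above. Once these functionals vanish, higher degrees
    need no new exclusion. *)

Lemma tens_sum (K : fieldType) (U V : vectType K) (t : tensor U V) :
  exists s : seq (U * V), t = \sum_(p <- s) p.1 ⊗ p.2.
Proof.
exists [seq (t p.1 p.2 *: (vbasis {:U})`_p.1, (vbasis {:V})`_p.2)
       | p : 'I_(\dim {:U}) * 'I_(\dim {:V})].
rewrite big_map big_enum /= [LHS]tens_basis pair_bigA; apply: eq_bigr => p _ /=.
by apply/matrixP=> i j; rewrite !mxE linearZ /= mulrA.
Qed.

Lemma tlift_sum (K : fieldType) (U V W : vectType K) (f : U -> V -> W)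
    (s : seq (U * V)) :
  bilin f -> tlift f (\sum_(p <- s) p.1 ⊗ p.2) = \sum_(p <- s) f p.1 p.2.
Proof. by move=> bf; rewrite linear_sum; apply: eq_bigr => p _; apply: tlift_tens. Qed.

HB.instance Definition _ (K : fieldType) (U V U' V' : vectType K)
    (f : U -> U') (g : V -> V') :=
  GRing.Linear.copy (@tmap K U V U' V' f g) (tlift (fun u v => f u ⊗ g v)).

HB.instance Definition _ (K : fieldType) (U V W : vectType K) :=
  GRing.Linear.copy (@tassoc K U V W)
    (tlift (fun p w => tlift (fun u v => u ⊗ (v ⊗ w)) p)).

Notation dual K A := 'Hom(A, K^o) (only parsing).

Lemma dual_sep (K : fieldType) (A : vectType K) (a b : A) :
  (forall l : dual K A, l a = l b) -> a = b.
Proof.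
move=> h; rewrite (coord_vbasis (memvf a)) (coord_vbasis (memvf b)).
apply: eq_bigr => i _; congr (_ *: _).
by have := h (linfun (coord (vbasis {:A}) i : A -> K^o)); rewrite !lfunE.
Qed.

Definition crdA (K : fieldType) (A : vectType K) (i : 'I_(\dim {:A})) : dual K A :=
  linfun (coord (vbasis {:A}) i : A -> K^o).

Lemma crdAE (K : fieldType) (A : vectType K) (i : 'I_(\dim {:A})) (a : A) :
  crdA i a = coord (vbasis {:A}) i a.
Proof. by rewrite lfunE. Qed.

Section Convolution.
Variables (K : fieldType) (A : fcoalgType K).
Implicit Types (f g l : dual K A) (a x y : A) (s : seq (A * A)).

Definition conv l f : dual K A :=
  linfun (tlift (fun u v => l u * f v : K^o) \o comul).
Definition hit f : 'End(A) := linfun (tlift (fun u v => (f v : K) *: u) \o comul).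
Definition hitl f : 'End(A) := linfun (tlift (fun u v => (f u : K) *: v) \o comul).
Definition eps : dual K A := linfun (@counit K A : A -> K^o).

Lemma bilin_mul (U V : vectType K) (l : dual K U) (f : dual K V) :
  bilin (fun u v => l u * f v : K^o).
Proof.
by split=> [v c x y|u c x y]; rewrite linearP ?mulrDl ?mulrDr -?scalerAl -?scalerAr.
Qed.

Lemma convE l f a s : comul a = \sum_(p <- s) p.1 ⊗ p.2 ->
  conv l f a = \sum_(p <- s) l p.1 * f p.2.
Proof.
by move=> h; rewrite lfunE /= h tlift_sum //; apply: bilin_mul.
Qed.

Lemma hitE f a s : comul a = \sum_(p <- s) p.1 ⊗ p.2 ->
  hit f a = \sum_(p <- s) (f p.2 : K) *: p.1.
Proof.
move=> h; rewrite lfunE /= h tlift_sum //.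
by split=> [v c x y|u c x y]; rewrite ?linearP //= ?scalerDr ?scalerDl !scalerA // mulrC.
Qed.

Lemma hitlE f a s : comul a = \sum_(p <- s) p.1 ⊗ p.2 ->
  hitl f a = \sum_(p <- s) (f p.1 : K) *: p.2.
Proof.
move=> h; rewrite lfunE /= h tlift_sum //.
by split=> [v c x y|u c x y]; rewrite ?linearP //= ?scalerDr ?scalerDl !scalerA // mulrC.
Qed.

Lemma dual_hit l f a : l (hit f a) = conv l f a.
Proof.
have [s h] := tens_sum (comul a); rewrite (hitE f h) (convE l f h) linear_sum.
by apply: eq_bigr => p _; rewrite linearZ /= mulrC.
Qed.

Lemma dual_hitl l f a : f (hitl l a) = conv l f a.
Proof.
have [s h] := tens_sum (comul a); rewrite (hitlE l h) (convE l f h) linear_sum.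
by apply: eq_bigr => p _; rewrite linearZ.
Qed.

Lemma convA l f g a : conv (conv l f) g a = conv l (conv f g) a.
Proof.
have [s h] := tens_sum (comul a); rewrite (convE _ _ h) (convE _ _ h).
(* [T] below is the functional [l ⊗ f ⊗ g] on the right-bracketed tensor product; coassociativity is
   evaluated on it. *)
have [T2 T2E] : exists T2 : {linear tensor A A -> K^o},
    forall v w, T2 (v ⊗ w) = f v * g w.
  exists (tlift (fun v w => f v * g w : K^o)) => v w.
  by rewrite /= tlift_tens //; apply: bilin_mul.
have [T TE] : exists T : {linear tensor A (tensor A A) -> K^o},
    forall u t, T (u ⊗ t) = l u * T2 t.
  exists (tlift (fun u w => l u * T2 w : K^o)) => u w; rewrite /= tlift_tens //.
  by split=> [v c x y|v c x y]; rewrite linearP ?mulrDl ?mulrDr -?scalerAl -?scalerAr.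
have T2c b : T2 (comul b) = conv f g b.
  have [r hr] := tens_sum (comul b); rewrite hr (convE _ _ hr) linear_sum.
  by apply: eq_bigr.
have e : \sum_(p <- s) T (tassoc (tmap comul idfun (p.1 ⊗ p.2))) =
    \sum_(p <- s) T (tmap idfun comul (p.1 ⊗ p.2)).
  rewrite -!(linear_sum T) -(linear_sum (tmap idfun comul)) -h.
  apply: etrans (congr1 T (comulA a)).
  by rewrite h (linear_sum (tmap comul idfun)) (linear_sum (@tassoc _ _ _ _)).
transitivity (\sum_(p <- s) T (tassoc (comul p.1 ⊗ p.2))); last first.
  transitivity (\sum_(p <- s) T (tmap idfun comul (p.1 ⊗ p.2))).
    by rewrite -e; apply: eq_bigr => p _; rewrite tmap_tens.
  by apply: eq_bigr => p _; rewrite tmap_tens TE T2c.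
apply: eq_bigr => p _; have [q hq] := tens_sum (comul p.1).
rewrite (convE _ _ hq) hq mulr_suml.
have lt : linear (fun x : tensor A A => T (tassoc (x ⊗ p.2))).
  by move=> c x y; rewrite (tens_bilin _ _).1 !linearP.
pose LT : {linear tensor A A -> K^o} :=
  HB.pack (fun x : tensor A A => T (tassoc (x ⊗ p.2)))
    (GRing.isLinear.Build K _ _ _ _ lt).
rewrite -[RHS]/(LT _) linear_sum; apply: eq_bigr => r _ /=.
by rewrite tassoc_tens TE T2E mulrA.
Qed.
End Convolution.

Section HitActions.
Variables (K : fieldType) (A : fcoalgType K).
Implicit Types (f g l : dual K A) (a x y : A) (s : seq (A * A)).

Lemma conv_epsr l a : conv l (eps A) a = l a.
Proof.
have [s h] := tens_sum (comul a); rewrite (convE _ _ h).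
have := counitr a; rewrite h tlift_sum => [e|]; last first.
  by split=> [v c x y|v c x y]; rewrite ?linearP //= ?scalerDr ?scalerDl !scalerA // mulrC.
rewrite -[in RHS]e linear_sum; apply: eq_bigr => p _.
by rewrite linearZ lfunE mulrC.
Qed.

Lemma conv_epsl l a : conv (eps A) l a = l a.
Proof.
have [s h] := tens_sum (comul a); rewrite (convE _ _ h).
have := counitl a; rewrite h tlift_sum => [e|]; last first.
  by split=> [v c x y|v c x y]; rewrite ?linearP //= ?scalerDr ?scalerDl !scalerA // mulrC.
rewrite -[in RHS]e linear_sum; apply: eq_bigr => p _.
by rewrite linearZ lfunE.
Qed.

Lemma hit_eps a : hit (eps A) a = a.
Proof. by apply: dual_sep => l; rewrite dual_hit conv_epsr. Qed.

Lemma eps_hit f a : eps A (hit f a) = f a.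
Proof. by rewrite dual_hit conv_epsl. Qed.

Lemma hit_conv f g a : hit (conv f g) a = hit f (hit g a).
Proof. by apply: dual_sep => l; rewrite !dual_hit convA. Qed.

Lemma hit_hitl f g a : hit f (hitl g a) = hitl g (hit f a).
Proof. by apply: dual_sep => l; rewrite dual_hit !dual_hitl dual_hit convA. Qed.

Lemma hit_sum I (r : seq I) (c : I -> K) (F : I -> dual K A) a :
  hit (\sum_(i <- r) c i *: F i) a = \sum_(i <- r) c i *: hit (F i) a.
Proof.
have [s h] := tens_sum (comul a); rewrite (hitE _ h).
under [RHS]eq_bigr do rewrite (hitE _ h) scaler_sumr.
rewrite exchange_big; apply: eq_bigr => p _ /=.
rewrite sum_lfunE scaler_suml; apply: eq_bigr => i _.
by rewrite lfunE /= scalerA.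
Qed.

Lemma hitD f g a : hit (f + g) a = hit f a + hit g a.
Proof.
have [s h] := tens_sum (comul a); rewrite !(hitE _ h) -big_split.
by apply: eq_bigr => p _; rewrite lfunE /= scalerDl.
Qed.

Lemma hitZ c f a : hit (c *: f) a = c *: hit f a.
Proof.
have [s h] := tens_sum (comul a); rewrite !(hitE _ h) scaler_sumr.
by apply: eq_bigr => p _; rewrite lfunE /= scalerA.
Qed.

Lemma hitB f g a : hit (f - g) a = hit f a - hit g a.
Proof. by rewrite hitD -scaleN1r hitZ scaleN1r. Qed.

Lemma hit_grouplike f x : grouplike x -> hit f x = (f x : K) *: x.
Proof.
case/andP=> /eqP h _.
by have := @hitE _ _ f x [:: (x, x)]; rewrite !big_seq1 => ->.
Qed.

Lemma hitl_grouplike f x : grouplike x -> hitl f x = (f x : K) *: x.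
Proof.
case/andP=> /eqP h _.
by have := @hitlE _ _ f x [:: (x, x)]; rewrite !big_seq1 => ->.
Qed.

Lemma eps_grouplike x : grouplike x -> eps A x = 1.
Proof. by case/andP=> _ /eqP h; rewrite lfunE. Qed.

(* Artin's argument: [hit f] acts on a linear relation between group-likes. *)
Lemma grouplike_free (s : seq A) : uniq s -> all (@grouplike K A) s -> free s.
Proof.
elim: s => [|x s IH] /=; first by rewrite nil_free.
case/andP=> xs us /andP[gx gs]; rewrite free_cons IH // andbT.
apply/negP=> xin; have fs := IH us gs.
have ex : x = \sum_i coord (in_tuple s) i x *: (in_tuple s)`_i.
  exact: coord_span.
have gi (i : 'I_(size s)) : grouplike s`_i by apply: (allP gs); apply: mem_nth.
have c0 f i : coord (in_tuple s) i x * (f x - f s`_i) = 0.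
  have : \sum_i (coord (in_tuple s) i x * (f x - f s`_i)) *: (in_tuple s)`_i = 0.
    under eq_bigr do rewrite mulrBr scalerBl.
    rewrite sumrB; apply/eqP; rewrite subr_eq0; apply/eqP.
    transitivity (hit f x).
      rewrite hit_grouplike // [X in _ = _ *: X]ex scaler_sumr; apply: eq_bigr => j _.
      by rewrite mulrC scalerA.
    rewrite {1}ex linear_sum; apply: eq_bigr => j _.
    by rewrite linearZ /= hit_grouplike // scalerA.
  by move/freeP: (fs : free (in_tuple s)) => fr /fr ->.
have [i ci] : exists i, coord (in_tuple s) i x != 0.
  apply/existsP; apply: contraT; rewrite negb_exists => /forallP h.
  have x0 : x = 0.
    by rewrite ex big1 // => i _; move: (h i); rewrite negbK => /eqP->; rewrite scale0r.
  by move: (eps_grouplike gx); rewrite x0 linear0 => /eqP; rewrite eq_sym oner_eq0.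
have : x = s`_i.
  apply: dual_sep => l; have := c0 l i => /eqP.
  by rewrite mulf_eq0 (negPf ci) /= subr_eq0 => /eqP.
by move=> e; case/negP: xs; rewrite e; apply: mem_nth.
Qed.
End HitActions.

Section HopfDual.
Variables (K : fieldType) (A : fhopfType K).
Implicit Types (f g l : dual K A) (a b x y : A) (s : seq (A * A)).

Definition lmulf f x : dual K A := linfun (fun y => f (x * y) : K^o).
Definition rmulf f x : dual K A := linfun (fun y => f (y * x) : K^o).

Lemma lmulfE f x y : lmulf f x y = f (x * y).
Proof.
have l : linear (fun y => f (x * y) : K^o) by move=> c u v; rewrite mulrDr -scalerAr linearP.
pose F : {linear A -> K^o} := HB.pack (fun y => f (x * y) : K^o) (GRing.isLinear.Build K _ _ _ _ l).
exact: (lfunE F y).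
Qed.

Lemma rmulfE f x y : rmulf f x y = f (y * x).
Proof.
have l : linear (fun y => f (y * x) : K^o) by move=> c u v; rewrite mulrDl -scalerAl linearP.
pose F : {linear A -> K^o} := HB.pack (fun y => f (y * x) : K^o) (GRing.isLinear.Build K _ _ _ _ l).
exact: (lfunE F y).
Qed.

Lemma comulM_sum x y s r : comul x = \sum_(p <- s) p.1 ⊗ p.2 ->
    comul y = \sum_(q <- r) q.1 ⊗ q.2 ->
  comul (x * y) = \sum_(p <- [seq (p.1 * q.1, p.2 * q.2) | p <- s, q <- r]) p.1 ⊗ p.2.
Proof.
move=> hx hy; rewrite comulM hx hy big_allpairs_dep /= /tmul.
have [tl tr] := tens_bilin A A.
have b1 (a b : A) : bilin (fun (c : A) (d : A) => (a * c) ⊗ (b * d)).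
  split=> [d' k z z' | c' k z z']; first by rewrite mulrDr -scalerAr tl.
  by rewrite mulrDr -scalerAr tr.
rewrite tlift_sum.
  by apply: eq_bigr => p _; rewrite tlift_sum.
split=> [b c u v|b c u v]; rewrite !tlift_sum // scaler_sumr -big_split;
  apply: eq_bigr => q _ /=.
  by rewrite mulrDl -scalerAl tl.
by rewrite mulrDl -scalerAl tr.
Qed.

Lemma hitM f x y s : comul x = \sum_(p <- s) p.1 ⊗ p.2 ->
  hit f (x * y) = \sum_(p <- s) p.1 * hit (lmulf f p.2) y.
Proof.
move=> hx; have [r hy] := tens_sum (comul y).
rewrite (hitE _ (comulM_sum hx hy)) big_allpairs_dep; apply: eq_bigr => p _ /=.
rewrite (hitE _ hy) mulr_sumr; apply: eq_bigr => q _ /=.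
by rewrite lmulfE scalerAr.
Qed.

(** The hypothesis is a comultiplication of [f] in the dual Hopf algebra. The index set is left free
    so that the decomposition can be adapted to the filtration. *)
Lemma hitM2 f x y I (r : seq I) (u v : I -> dual K A) :
    (forall x y, f (x * y) = \sum_(i <- r) u i x * v i y) ->
  hit f (x * y) = \sum_(i <- r) hit (u i) x * hit (v i) y.
Proof.
move=> h; have [s hx] := tens_sum (comul x); rewrite (hitM _ _ hx).
under [RHS]eq_bigr do rewrite (hitE _ hx) mulr_suml.
rewrite [RHS]exchange_big; apply: eq_bigr => p _ /=.
rewrite -[lmulf f p.2](_ : \sum_(i <- r) (u i p.2 : K) *: v i = _).
  by rewrite hit_sum mulr_sumr; apply: eq_bigr => i _; rewrite -scalerAl -scalerAr.
apply/lfunP => z; rewrite lmulfE h sum_lfunE; apply: eq_bigr => i _.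
by rewrite lfunE.
Qed.

Lemma hit_grouplikeM f x y : grouplike x -> hit f (x * y) = x * hit (lmulf f x) y.
Proof.
case/andP=> /eqP h _; have := @hitM f x y [:: (x, x)].
by rewrite !big_seq1 => ->.
Qed.

Lemma hit_Mgrouplike f x y : grouplike x -> hit f (y * x) = hit (rmulf f x) y * x.
Proof.
move=> gx; have [s hy] := tens_sum (comul y).
rewrite (@hitM f y x s) // (hitE _ hy) mulr_suml; apply: eq_bigr => p _.
by rewrite hit_grouplike // lmulfE rmulfE -scalerAr -scalerAl.
Qed.

Lemma hit_skewM f x h y : comul x = x ⊗ 1 + h ⊗ x ->
  hit f (x * y) = x * hit f y + h * hit (lmulf f x) y.
Proof.
move=> hx; have := @hitM f x y [:: (x, 1); (h, x)].
rewrite !big_cons !big_nil /= !addr0 => -> //; congr (_ * hit _ _ + _).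
by apply/lfunP=> z; rewrite lmulfE mul1r.
Qed.
End HopfDual.

(** * The coradical filtration *)

Record grouplike_map (K : fieldType) (A : fhopfType K) (gT : finGroupType) :=
  GrouplikeMap {
    glfun :> gT -> A;
    phi_inj : injective glfun;
    phi1 : glfun 1%g = 1;
    phiM : forall u v, glfun (u * v)%g = glfun u * glfun v;
    phi_grouplikeP : forall a, grouplike a <-> exists u, a = glfun u
  }.

Section Filtration.
Variables (K : fieldType) (A : fhopfType K) (gT : finGroupType).
Variable phi : grouplike_map A gT.
Implicit Types (f g l : dual K A) (a b x y : A) (u v w : gT) (n d i j : nat).

Lemma phi_grouplike u : grouplike (phi u).
Proof. by apply/phi_grouplikeP; exists u. Qed.

Definition phis : seq A := [seq phi u | u <- enum gT].
Definition kG : {vspace A} := <<phis>>%VS.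

Lemma size_phis : size phis == #|gT|.
Proof. by rewrite size_map -cardE. Qed.

Lemma phis_free : free phis.
Proof.
apply: grouplike_free; first by rewrite map_inj_uniq ?enum_uniq //; apply: phi_inj.
by apply/allP=> _ /mapP[u _ ->]; apply: phi_grouplike.
Qed.

(** Dual to the group-likes, and extended from [kG] to [A] in an unspecified way. *)
Definition crd_phi u : dual K A :=
  linfun (coord (Tuple size_phis) (enum_rank u) : A -> K^o).

Lemma phis_nth u : phis`_(enum_rank u) = phi u.
Proof.
rewrite (nth_map u) ?nth_enum_rank // -cardE; exact: ltn_ord.
Qed.

Lemma crd_phiE u v : crd_phi u (phi v) = (u == v)%:R.
Proof.
rewrite lfunE /= -(phis_nth v) (coord_free _ _ (phis_free : free (Tuple size_phis))).
by rewrite (inj_eq enum_rank_inj) eq_sym.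
Qed.

Lemma mem_kG u : phi u \in kG.
Proof. by apply/memv_span/map_f; rewrite mem_enum. Qed.

Lemma kG_sum a : a \in kG -> a = \sum_u (crd_phi u a : K) *: phi u.
Proof.
move=> /(coord_span (X := Tuple size_phis)) {1}->.
rewrite (reindex (@enum_rank gT)) /=; last first.
  by apply: onW_bij; apply: enum_rank_bij.
by apply: eq_bigr => u _; rewrite phis_nth lfunE.
Qed.

Lemma kG_dual f a : (forall u, f (phi u) = 0) -> a \in kG -> f a = 0.
Proof.
move=> h /kG_sum->; rewrite linear_sum big1 // => u _.
by rewrite linearZ /= h scaler0.
Qed.

(** The annihilator of [kG]. For pointed [A] it is the Jacobson radical of the dual algebra, and
    [fil n] below is the annihilator of its n-th power. *)
Definition inJ f : Prop := forall u, f (phi u) = 0.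

(** A projection with kernel [kG]. Composition with [tau] sends every functional into [inJ] and
    fixes those already there, so the functionals [crdA i \o tau] span [inJ]; this is why finitely
    many conditions define [fil]. *)
Definition tau : 'End(A) := \1%VF - linfun (fun a => \sum_u (crd_phi u a : K) *: phi u).

Lemma tauE a : tau a = a - \sum_u (crd_phi u a : K) *: phi u.
Proof.
have l : linear (fun a => \sum_u (crd_phi u a : K) *: phi u).
  move=> c x y; rewrite scaler_sumr -big_split; apply: eq_bigr => u _.
  by rewrite /= linearP scalerA -scalerDl.
pose F : {linear A -> A} := HB.pack (fun a => \sum_u (crd_phi u a : K) *: phi u)
  (GRing.isLinear.Build K _ _ _ _ l).
by rewrite /tau add_lfunE opp_lfunE id_lfunE; congr (_ - _); exact: (lfunE F).
Qed.

Lemma tau_kG a : a \in kG -> tau a = 0.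
Proof. by move=> /kG_sum h; rewrite tauE -h subrr. Qed.

Lemma tau_inJ f : inJ (f \o tau)%VF.
Proof. by move=> u; rewrite lfunE /= tau_kG ?linear0 ?mem_kG. Qed.

Lemma inJ_tau f a : inJ f -> f (tau a) = f a.
Proof.
move=> fJ; rewrite tauE linearB linear_sum big1 ?subr0 // => u _.
by rewrite linearZ /= fJ scaler0.
Qed.

(* Shifted by one: [fil n.+1] is the n-th term A_n of the coradical filtration,  *)
(* and [fil 0] = 0.                                                              *)
Fixpoint fil n : {vspace A} :=
  if n is n'.+1 then
    (\bigcap_(i < \dim {:A}) (hit (crdA i \o tau)%VF @^-1: fil n'))%VS
  else 0%VS.

Lemma filP n a : a \in fil n.+1 <-> (forall f, inJ f -> hit f a \in fil n).
Proof.
split=> [|h]; last first.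
  rewrite memvE; apply/subv_bigcapP => i _; rewrite -memvE.
  by rewrite -memv_preim; apply: h; apply: tau_inJ.
rewrite memvE => /subv_bigcapP h f fJ.
have -> : f = \sum_(i < \dim {:A}) (f (vbasis {:A})`_i : K) *: (crdA i \o tau)%VF.
  apply/lfunP => x; rewrite sum_lfunE -(inJ_tau _ fJ).
  rewrite [X in f X](coord_vbasis (memvf (tau x))) linear_sum.
  apply: eq_bigr => i _.
  by rewrite linearZ scale_lfunE comp_lfunE crdAE; exact: mulrC.
rewrite hit_sum; apply: memv_suml => i _; rewrite memvZ //.
by have := h i isT; rewrite -memvE -memv_preim.
Qed.
End Filtration.

Section FiltrationTheory.
Variables (K : fieldType) (A : fhopfType K) (gT : finGroupType).
Variable phi : grouplike_map A gT.
Implicit Types (f g l : dual K A) (a b x y : A) (u v w : gT) (n d i j : nat).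
Local Notation F := (fil phi).
Local Notation J := (inJ phi).

Lemma inJ_convl f g : J f -> J (conv f g).
Proof.
by move=> fJ u; rewrite -dual_hit hit_grouplike ?phi_grouplike // linearZ /= fJ scaler0.
Qed.

Lemma inJ_convr f g : J g -> J (conv f g).
Proof.
by move=> gJ u; rewrite -dual_hitl hitl_grouplike ?phi_grouplike // linearZ /= gJ scaler0.
Qed.

Lemma fil_hit n f a : a \in F n -> hit f a \in F n.
Proof.
case: n => [|n]; first by rewrite /= memv0 => /eqP->; rewrite linear0 mem0v.
move=> /filP h; apply/filP => g gJ; rewrite -hit_conv; apply: h; exact: inJ_convl.
Qed.

Lemma fil_hitl n f a : a \in F n -> hitl f a \in F n.
Proof.
elim: n a => [|n IH] a; first by rewrite /= memv0 => /eqP->; rewrite linear0 mem0v.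
by move=> /filP h; apply/filP => g gJ; rewrite hit_hitl; apply/IH/h.
Qed.

Lemma filS n : (F n <= F n.+1)%VS.
Proof. by apply/subvP => a aF; apply/filP => f _; apply: fil_hit. Qed.

Lemma fil_le n d : (n <= d)%N -> (F n <= F d)%VS.
Proof.
move=> /subnK <-; elim: (d - n)%N => [|k IH]; first exact: subvv.
by rewrite addSn; apply: subv_trans IH (filS _).
Qed.

Lemma fil_leP n d a : (n <= d)%N -> a \in F n -> a \in F d.
Proof. by move=> /fil_le/subvP; apply. Qed.

Lemma fil1 : F 1 = kG phi.
Proof.
apply/vspaceP => a; apply/idP/idP => [/filP h|aG].
  have t0 : tau phi a = 0.
    apply: dual_sep => l; rewrite linear0.
    have := h _ (tau_inJ phi l); rewrite /= memv0 => /eqP e.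
    by have := eps_hit (l \o tau phi)%VF a; rewrite e linear0 comp_lfunE.
  move/eqP: t0; rewrite tauE subr_eq0 => /eqP->.
  by apply: memv_suml => u _; rewrite memvZ ?mem_kG.
apply/filP => f fJ; rewrite /= memv0; apply/eqP.
rewrite (kG_sum aG) linear_sum big1 // => u _.
by rewrite linearZ /= hit_grouplike ?phi_grouplike // fJ scale0r scaler0.
Qed.

Lemma fil_hitlJ n l a : J l -> a \in F n.+1 -> hitl l a \in F n.
Proof.
move=> lJ; elim: n a => [|n IH] a.
  rewrite fil1 => aG; rewrite /= memv0; apply/eqP.
  rewrite (kG_sum aG) linear_sum big1 // => u _.
  by rewrite linearZ /= hitl_grouplike ?phi_grouplike // lJ scale0r scaler0.
by move=> /filP h; apply/filP => g gJ; rewrite hit_hitl; apply/IH/h.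
Qed.

Lemma fil_hitJ n f a : J f -> a \in F n.+1 -> hit f a \in F n.
Proof. by move=> fJ /filP; apply. Qed.

(** For [g] in J the product [conv g f] kills [F d.+1]. Induction on [n - d] thus trades one
    application of J for one more step of the filtration killed by the functional. *)
Lemma fil_lower f d n a : (forall b, b \in F d -> f b = 0) ->
  a \in F n -> hit f a \in F (n - d).
Proof.
have [k] := ubnP (n - d)%N; elim: k => // k IH in f d n a *; rewrite ltnS => nk fd aF.
case e : (n - d)%N => [|m].
  rewrite /= memv0; apply/eqP; apply: dual_sep => l; rewrite dual_hit -dual_hitl linear0.
  by apply: fd; apply: fil_hitl; apply: fil_leP aF; rewrite -subn_eq0 e.
apply/filP => g gJ; rewrite -hit_conv.
have -> : m = (n - d.+1)%N by rewrite subnS e.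
apply: IH => // [|b bF]; first by rewrite subnS e; rewrite e in nk.
by rewrite -dual_hitl; apply: fd; apply: fil_hitlJ.
Qed.

Lemma filM i j a b : a \in F i.+1 -> b \in F j.+1 -> a * b \in F (i + j).+1.
Proof.
have [k] := ubnP (i + j); elim: k => // k IH in i j a b *; rewrite ltnS => ijk aF bF.
apply/filP => f fJ.
(* The comultiplication of [f] is split along the identity as projection to [kG] plus [tau]. The
   terms indexed by [u] lower the second factor, because [lmulf f (phi u)] is again in J; the
   remaining terms lower the first. *)
pose I := (gT + 'I_(\dim {:A}))%type.
pose lf (s : I) : dual K A := match s with
  | inl u => crd_phi phi u | inr p => (crdA p \o tau phi)%VF end.
pose rf (s : I) : dual K A := match s with
  | inl u => lmulf f (phi u) | inr p => lmulf f (vbasis {:A})`_p end.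
rewrite (@hitM2 _ _ f a b I (index_enum _) lf rf); last first.
  move=> x y; rewrite big_sumType /=.
  have {1}-> : x = (\sum_u (crd_phi phi u x : K) *: phi u) + tau phi x.
    by rewrite tauE addrCA subrr addr0.
  rewrite mulrDl linearD; congr (_ + _).
    rewrite mulr_suml linear_sum; apply: eq_bigr => u _.
    by rewrite lmulfE -scalerAl linearZ.
  rewrite {1}(coord_vbasis (memvf (tau phi x))) mulr_suml linear_sum.
  by apply: eq_bigr => p _; rewrite lmulfE -scalerAl linearZ comp_lfunE crdAE.
apply: memv_suml => [] [u|p] _ /=.
  have : hit (lmulf f (phi u)) b \in F j.
    by apply: fil_hitJ => // v; rewrite lmulfE -phiM fJ.
  case: j bF ijk => [|j] bF ijk; first by rewrite /= memv0 => /eqP->; rewrite mulr0 mem0v.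
  move=> h; rewrite addnS; apply: IH => //; last exact: fil_hit.
  by rewrite -addnS.
have : hit (crdA p \o tau phi)%VF a \in F i by apply: fil_hitJ => //; exact: tau_inJ.
case: i aF ijk => [|i] aF ijk; first by rewrite /= memv0 => /eqP->; rewrite mul0r mem0v.
by move=> h; rewrite addSn; apply: IH => //; apply: fil_hit.
Qed.
End FiltrationTheory.

(** * Exhaustion of a pointed Hopf algebra by its coradical filtration *)

Section Subcoalgebra.
Variables (K : fieldType) (A : fcoalgType K).
Implicit Types (f g l : dual K A) (a b x y : A) (C E : {vspace A}).

Lemma tensvP C E (t : tensor A A) : t \in tensv C E ->
  exists2 s : seq (A * A), t = \sum_(p <- s) p.1 ⊗ p.2
    & forall p, p \in s -> p.1 \in C /\ p.2 \in E.
Proof.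
move=> /(coord_span (X := in_tuple _)) ->.
set X := [seq _ | _ <- _, _ <- _]; set cc := coord _.
have : forall x : tensor A A, x \in X ->
    exists p : A * A, [/\ x = p.1 ⊗ p.2, p.1 \in C & p.2 \in E].
  move=> _ /allpairsP[p [pC pE ->]]; exists p; split=> //; exact: vbasis_mem.
move: (cc) => {}cc; rewrite /= => h.
elim/big_ind: _ => [|x y [s -> hs] [r -> hr]|i _].
- by exists [::]; rewrite ?big_nil.
- exists (s ++ r); rewrite ?big_cat // => p; rewrite mem_cat => /orP[/hs|/hr] //.
have [p [e pC pE]] := h X`_i (mem_nth 0 (ltn_ord i)).
exists [:: (cc i t *: p.1, p.2)].
  by rewrite big_seq1 e /=; apply/matrixP=> j k; rewrite !mxE linearZ /= mulrA.
by move=> q; rewrite inE => /eqP-> /=; rewrite memvZ.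
Qed.

Lemma hitl_sum I (r : seq I) (c : I -> K) (G : I -> dual K A) a :
  hitl (\sum_(i <- r) c i *: G i) a = \sum_(i <- r) c i *: hitl (G i) a.
Proof.
have [s h] := tens_sum (comul a); rewrite (hitlE _ h).
under [RHS]eq_bigr do rewrite (hitlE _ h) scaler_sumr.
rewrite exchange_big; apply: eq_bigr => p _ /=.
rewrite sum_lfunE scaler_suml; apply: eq_bigr => i _.
by rewrite lfunE /= scalerA.
Qed.

Lemma dual_crd (l : dual K A) : l = \sum_(i < \dim {:A}) (l (vbasis {:A})`_i : K) *: crdA i.
Proof.
apply/lfunP => x; rewrite {1}(coord_vbasis (memvf x)) linear_sum sum_lfunE.
by apply: eq_bigr => i _; rewrite linearZ scale_lfunE crdAE; apply: mulrC.
Qed.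

Lemma hit_crd f a : hit f a = \sum_(i < \dim {:A}) (f (vbasis {:A})`_i : K) *: hit (crdA i) a.
Proof. by rewrite {1}[f]dual_crd hit_sum. Qed.

Lemma comul_hit x :
  comul x = \sum_(i < \dim {:A}) hit (crdA i) x ⊗ (vbasis {:A})`_i.
Proof.
have [s h] := tens_sum (comul x).
transitivity (\sum_(i < \dim {:A}) \sum_(p <- s)
    ((coord (vbasis {:A}) i p.2) *: p.1) ⊗ (vbasis {:A})`_i).
  rewrite exchange_big h; apply: eq_bigr => p _ /=.
  rewrite {1}(coord_vbasis (memvf p.2)).
  apply/matrixP=> j k; rewrite summxE !mxE linear_sum mulr_sumr.
  by apply: eq_bigr => i _; rewrite !mxE !linearZ /= mulrCA mulrA.
apply: eq_bigr => i _; rewrite (hitE _ h).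
apply/matrixP=> j k; rewrite summxE !mxE linear_sum mulr_suml.
by apply: eq_bigr => p _; rewrite !mxE crdAE.
Qed.

(** Stability under [hit] places the left tensor factors in [C]; in coordinates on [C] the right
    factors become values of [hitl]. *)
Lemma subcoalgebraP C :
  (forall f x, x \in C -> hit f x \in C /\ hitl f x \in C) -> subcoalgebra C.
Proof.
move=> h x xC.
pose mu j : dual K A := linfun (coord (vbasis C) j : A -> K^o).
have muE j a : mu j a = coord (vbasis C) j a by rewrite lfunE.
have -> : comul x = \sum_(j < \dim C) (vbasis C)`_j ⊗ hitl (mu j) x.
  have e i : hit (crdA i) x =
      \sum_(j < \dim C) coord (vbasis C) j (hit (crdA i) x) *: (vbasis C)`_j.
    by apply: coord_vbasis; have [] := h (crdA i) x xC.
  rewrite comul_hit; under eq_bigr do rewrite e.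
  have hl j : hitl (mu j) x =
      \sum_(i < \dim {:A}) coord (vbasis C) j (hit (crdA i) x) *: (vbasis {:A})`_i.
    apply: dual_sep => l; rewrite dual_hitl -dual_hit hit_crd linear_sum linear_sum.
    by apply: eq_bigr => i _; rewrite !linearZ /= muE; apply: mulrC.
  under [RHS]eq_bigr do rewrite hl.
  apply/matrixP=> p q; rewrite !summxE.
  transitivity (\sum_i \sum_(j < \dim C) coord (vbasis C) j (hit (crdA i) x) *
     (coord (vbasis {:A}) p (vbasis C)`_j * coord (vbasis {:A}) q (vbasis {:A})`_i)).
    apply: eq_bigr => i _; rewrite mxE linear_sum mulr_suml; apply: eq_bigr => j _.
    by rewrite linearZ /= mulrA.
  rewrite exchange_big; apply: eq_bigr => j _; rewrite mxE linear_sum mulr_sumr.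
  by apply: eq_bigr => i _; rewrite linearZ /= mulrCA.
apply: memv_suml => j _; apply: mem_tensv; first by rewrite vbasis_mem ?mem_nth ?size_tuple.
by have [] := h (mu j) x xC.
Qed.

Lemma subcoalgebra_hit C f x : subcoalgebra C -> x \in C -> hit f x \in C.
Proof.
move=> sC /sC/tensvP[s h hs]; rewrite (hitE _ h) big_seq memv_suml // => p /hs[pC _].
by rewrite memvZ.
Qed.

Lemma subcoalgebra_hitl C f x : subcoalgebra C -> x \in C -> hitl f x \in C.
Proof.
move=> sC /sC/tensvP[s h hs]; rewrite (hitlE _ h) big_seq memv_suml // => p /hs[_ pC].
by rewrite memvZ.
Qed.
End Subcoalgebra.

Section Jacobson.
Variables (K : fieldType) (A : fcoalgType K).
Implicit Types (f g l : dual K A) (a b x y : A) (C E T : {vspace A}).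

(** Submodules of [A] over the dual algebra; under [minS] below, [S/U] is zero or a simple
    module. *)
Definition hstable (S : {vspace A}) : Prop := forall f a, a \in S -> hit f a \in S.
Variables (U S : {vspace A}).
Hypothesis stU : hstable U.
Hypothesis stS : hstable S.
Hypothesis leUS : (U <= S)%VS.
Hypothesis minS : forall T, hstable T -> (U <= T)%VS -> (T <= S)%VS -> T = U \/ T = S.

Lemma hit_cyclic y s : y \in S -> y \notin U -> s \in S -> exists f, s - hit f y \in U.
Proof.
move=> yS yU sS.
pose T := (U + <<[seq hit (crdA i) y | i <- enum 'I_(\dim {:A})]>>)%VS.
have hT f : hit f y \in T.
  rewrite hit_crd; apply: memv_suml => i _; rewrite memvZ //.
  apply: (subvP (addvSr _ _)); apply: memv_span; apply: map_f; exact: mem_enum.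
have Tspan a : a \in T -> exists2 f, True & a - hit f y \in U.
  case/memv_addP=> u uU [z zT ->].
  suff [f ->] : exists f, z = hit f y by exists f => //; rewrite addrK.
  move: zT => /(coord_span (X := in_tuple _)) ->.
  elim/big_ind: _ => [|p q [f ->] [g ->]|i _].
  - by exists 0; rewrite -(scale0r (0 : dual K A)) hitZ scale0r.
  - by exists (f + g); rewrite hitD.
  set ss := [seq _ | _ <- _].
  have /mapP[j _ /= e] : ss`_i \in ss by apply: mem_nth.
  by exists (coord (in_tuple ss) i z *: crdA j); rewrite hitZ e.
have stT : hstable T.
  move=> f a /Tspan[g _ h]; rewrite -(subrK (hit g y) a) linearD memvD //.
    by apply: (subvP (addvSl _ _)); apply: stU.
  by rewrite /= -hit_conv hT.
have [] := minS stT (addvSl _ _).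
- apply/subvP => a /Tspan[f _ h]; rewrite -(subrK (hit f y) a) memvD ?stS //.
  exact: (subvP leUS).
- move=> e; case/negP: yU; rewrite -e.
  by have := hT (eps A); rewrite hit_eps.
by move=> e; rewrite -e in sS; have [f _] := Tspan _ sS; exists f.
Qed.

Variable Q : dual K A -> Prop.
Hypothesis QD : forall f g, Q f -> Q g -> Q (f + g).
Hypothesis Ql : forall f g, Q g -> Q (conv f g).
Hypothesis Qr : forall f g, Q f -> Q (conv f g).

(** The induction of Jacobson's density theorem, for a two-sided ideal [Q] not annihilating [S/U].
    The correction f d (1 - q) carries q to the new vector and, modulo [U], vanishes on the vectors
    that q already fixes. *)
Lemma ideal_local_unit q0 s0 : Q q0 -> s0 \in S -> hit q0 s0 \notin U ->
  forall ms : seq A, {subset ms <= S} ->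
  exists2 q, Q q & forall x, x \in ms -> hit q x - x \in U.
Proof.
move=> Qq0 s0S hq0; elim=> [|m ms IH] msS.
  exists q0 => //.
have [x xms|q Qq hq] := IH; first by apply: msS; rewrite inE xms orbT.
have mS : m \in S by apply: msS; rewrite inE eqxx.
have [mU|mU] := boolP (m - hit q m \in U).
  exists q => // x; rewrite inE => /predU1P[->|/hq//].
  by rewrite -opprB memvN.
have m'S : m - hit q m \in S by rewrite memvB ?stS.
have [f0 hf0] := hit_cyclic m'S mU s0S.
(* [f0] moves the defect [m - hit q m] to [s0] modulo [U], so [d] lies in [Q] and does not send the
   defect into [U]. *)
set d := conv q0 f0.
have Qd : Q d by apply: Qr.
have dS : hit d (m - hit q m) \in S by apply: stS.
have dU : hit d (m - hit q m) \notin U.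
  apply: contra hq0 => h; rewrite -(subrK (hit f0 (m - hit q m)) s0) linearD memvD //.
    exact: stU.
  by rewrite /= -hit_conv.
clearbody d; have [f hf] := hit_cyclic dS dU m'S.
exists (q + conv f (conv d (eps A - q))).
  by apply: QD => //; apply: Ql; apply: Qr.
have e x : hit (eps A - q) x = x - hit q x by rewrite hitB hit_eps.
move=> x; rewrite inE hitD !hit_conv e => /predU1P[->|xms].
  set y := hit f _ in hf *; rewrite (_ : _ - m = - (m - hit q m - y)) ?memvN //.
  by rewrite !opprB addrCA addrA.
rewrite addrAC memvD ?hq //; do 2!apply: stU.
by rewrite -opprB memvN hq.
Qed.
End Jacobson.

Section Exhaustion.
Variables (K : fieldType) (A : fhopfType K) (gT : finGroupType).
Variable phi : grouplike_map A gT.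
Hypothesis ptA : pointed A.
Implicit Types (f g l : dual K A) (a b x y : A) (C E T U S : {vspace A}).

Definition cproj U : 'End(A) := \1%VF - projv U.

Lemma cprojE U a : cproj U a = a - projv U a.
Proof. by rewrite add_lfunE opp_lfunE id_lfunE. Qed.

(* The coefficient coalgebra of the quotient S/U. *)
Definition coef_space U S : {vspace A} :=
  (\sum_(i < \dim {:A}) hitl (crdA i \o cproj U)%VF @: S)%VS.

Lemma coef_proj U a : (forall i, (crdA i \o cproj U)%VF a = 0) -> a \in U.
Proof.
move=> h; have : cproj U a = 0.
  rewrite (coord_vbasis (memvf (cproj U a))) big1 // => i _.
  by have := h i; rewrite comp_lfunE crdAE => ->; rewrite scale0r.
rewrite cprojE => /eqP; rewrite subr_eq0 => /eqP->.
exact: memv_proj.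
Qed.

Lemma mem_coef U S l s : (forall u, u \in U -> l u = 0) -> s \in S ->
  hitl l s \in coef_space U S.
Proof.
move=> lU sS.
have -> : l = \sum_(i < \dim {:A}) (l (vbasis {:A})`_i : K) *: (crdA i \o cproj U)%VF.
  apply/lfunP => x; rewrite sum_lfunE.
  have {1}-> : x = cproj U x + projv U x.
    by rewrite cprojE subrK.
  rewrite linearD /= (lU (projv U x)) ?memv_proj // addr0.
  set y := cproj U x; rewrite {1}(coord_vbasis (memvf y)) linear_sum.
  apply: eq_bigr => i _; rewrite linearZ scale_lfunE comp_lfunE -/y crdAE.
  by apply: mulrC.
rewrite hitl_sum; apply: memv_sumr => i _; rewrite memvZ //; exact: memv_img.
Qed.

Lemma coef_ind U S (P : A -> Prop) : P 0 ->
    (forall x y, P x -> P y -> P (x + y)) ->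
    (forall l s, (forall u, u \in U -> l u = 0) -> s \in S -> P (hitl l s)) ->
  forall x, x \in coef_space U S -> P x.
Proof.
move=> P0 PD Pl x /memv_sumP[z hz ->].
elim/big_ind: _ => // i _; have /memv_imgP[s sS ->] := hz i isT.
apply: Pl => // u uU.
by rewrite comp_lfunE cprojE projv_id // subrr linear0.
Qed.

Lemma coef_kill U S f : (forall x, x \in coef_space U S -> f x = 0) ->
  forall s, s \in S -> hit f s \in U.
Proof.
move=> h s sS; apply: coef_proj => i; rewrite dual_hit -dual_hitl; apply: h.
apply: mem_coef => // u uU.
by rewrite comp_lfunE cprojE projv_id // subrr linear0.
Qed.

(** The annihilator [Q] of a subcoalgebra E is a two-sided ideal. If E is proper in the coefficient
    coalgebra, [Q] acts non-trivially on [S/U] and contains some q acting there as the identity;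
    then q agrees with the counit on the coefficient coalgebra and vanishes on E, so the counit
    vanishes on E and E = 0. *)
Lemma coef_simple U S : hstable U -> hstable S -> (U <= S)%VS -> U <> S ->
    (forall T, hstable T -> (U <= T)%VS -> (T <= S)%VS -> T = U \/ T = S) ->
  simple_subcoalgebra (coef_space U S).
Proof.
move=> stU stS leUS neUS minS.
have coefP f x : x \in coef_space U S ->
    hit f x \in coef_space U S /\ hitl f x \in coef_space U S.
  move: x; apply: coef_ind => [|x y [h1 h2] [h3 h4]|l s lU sS].
  - by rewrite !linear0 mem0v.
  - by rewrite !linearD !memvD.
  split; first by rewrite hit_hitl; apply: mem_coef => //; apply: stS.
  have -> : hitl f (hitl l s) = hitl (conv l f) s.
    by apply: dual_sep => g; rewrite !dual_hitl convA.
  apply: mem_coef => // u uU; rewrite -dual_hit; apply: lU; exact: stU.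
split; first exact: subcoalgebraP.
- move=> C0; apply: neUS; apply/eqP; rewrite eqEsubv leUS; apply/subvP => s sS.
  rewrite -[s]hit_eps; apply: (coef_kill _ sS) => x.
  by rewrite C0 memv0 => /eqP->; rewrite linear0.
move=> E sE leEC; have [->|neE] := eqVneq E (coef_space U S); [by right|left].
pose Q f := forall x, x \in E -> f x = 0.
have [x xC xE] : exists2 x, x \in coef_space U S & x \notin E.
  have /subvPn[x xC xE] : ~~ (coef_space U S <= E)%VS.
    by apply: contra neE => h; rewrite eqEsubv leEC.
  by exists x.
have [i hi] : exists i, (crdA i \o cproj E)%VF x != 0.
  apply/existsP; apply: contraR xE; rewrite negb_exists => /forallP h.
  by apply: coef_proj => i; move: (h i); rewrite negbK => /eqP.
set q0 := (crdA i \o cproj E)%VF in hi.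
have Qq0 : Q q0.
  by move=> y yE; rewrite comp_lfunE cprojE projv_id // subrr linear0.
have [s0 s0S hs0] : exists2 s0, s0 \in S & hit q0 s0 \notin U.
  have [/hasP[s sv hs]|/hasPn h] := boolP (has (fun s => hit q0 s \notin U) (vbasis S)).
    by exists s => //; apply: vbasis_mem.
  have h2 s : s \in S -> hit q0 s \in U.
    move=> /coord_vbasis->; rewrite linear_sum memv_suml // => j _.
    rewrite linearZ memvZ //=.
    by have := h (vbasis S)`_j; rewrite negbK; apply; rewrite mem_nth ?size_tuple.
  case/eqP: hi; move: x xC {xE}; apply: coef_ind => [|x y hx hy|l s lU sS].
  - by rewrite linear0.
  - by rewrite linearD /= hx hy addr0.
  by rewrite dual_hitl -dual_hit lU // h2.
have [q Qq hq] : exists2 q, Q q & forall x, x \in (vbasis S : seq A) -> hit q x - x \in U.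
  apply: (ideal_local_unit stU stS leUS minS _ _ _ Qq0 s0S hs0).
  - by move=> f g Qf Qg y yE; rewrite add_lfunE Qf ?Qg ?addr0.
  - by move=> f g Qg y yE; rewrite -dual_hitl Qg // subcoalgebra_hitl.
  - by move=> f g Qf y yE; rewrite -dual_hit Qf // subcoalgebra_hit.
  - by move=> z; apply: vbasis_mem.
have qeps y : y \in coef_space U S -> (q - eps A) y = 0.
  move: y; apply: coef_ind => [|y z hy hz|l s lU sS].
  - by rewrite linear0.
  - by rewrite linearD /= hy hz addr0.
  rewrite dual_hitl -dual_hit lU // hitB hit_eps.
  rewrite (coord_vbasis sS) linear_sum -sumrB memv_suml // => j _.
  by rewrite linearZ -scalerBr memvZ // hq // mem_nth ?size_tuple.
apply/eqP; rewrite -subv0; apply/subvP => y yE; rewrite memv0; apply/eqP.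
apply: dual_sep => l; rewrite linear0 -[y]hit_eps dual_hit -dual_hitl.
have hE : hitl l y \in E by apply: subcoalgebra_hitl.
have := qeps _ (subvP leEC _ hE); rewrite add_lfunE opp_lfunE (Qq _ hE) sub0r.
by move/eqP; rewrite oppr_eq0 => /eqP.
Qed.

Lemma simple_sub_kG C : simple_subcoalgebra C -> (C <= kG phi)%VS.
Proof.
move=> sC; apply/subvP => x xC.
have [|gs ggs xg] := (ptA x).1.
  exists [:: C]; split=> [D|]; first by rewrite inE => /eqP->.
  by rewrite big_seq1.
suff /subvP : (<<gs>> <= kG phi)%VS by apply.
apply/span_subvP => y yg.
by move: (allP ggs _ yg) => /(phi_grouplikeP phi)[u ->]; apply: mem_kG.
Qed.

(** A minimal stable [S] above [U] has a simple coefficient coalgebra. By pointedness it lies in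
    [kG], so J maps [S] into [U], against the assumption that no vector outside [U] has this
    property. *)
Lemma hstable_jump U : hstable U -> U != fullv ->
  ~ (forall a, (forall f, inJ phi f -> hit f a \in U) -> a \in U).
Proof.
move=> stU neU jump.
suff h S : hstable S -> (U <= S)%VS -> U != S -> False.
  by apply: (h fullv) neU => [f a _|]; [exact: memvf|exact: subvf].
have [n] := ubnP (\dim S); elim: n => // n IH in S *.
rewrite ltnS => dS stS leUS neUS.
have minS T : hstable T -> (U <= T)%VS -> (T <= S)%VS -> T = U \/ T = S.
  move=> stT leUT leTS; have [->|neT] := eqVneq T U; [by left|right].
  apply/eqP; apply/negPn/negP => neTS; apply: (IH T) => //; last by rewrite eq_sym.
  apply: leq_trans dS; rewrite ltn_neqAle dimvS // andbT; apply: contra neTS => e.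
  by rewrite -(geq_leqif (dimv_leqif_eq leTS)) (eqP e).
have sC := coef_simple stU stS leUS (elimN eqP neUS) minS.
case/negP: neUS; rewrite eqEsubv leUS; apply/subvP => s sS; apply: jump => f fJ.
apply: (coef_kill _ sS) => x xC; apply: (kG_dual (phi := phi)) => //.
exact: subvP (simple_sub_kG sC) _ xC.
Qed.

Lemma fil_full : exists N, fil phi N = fullv.
Proof.
have h n : fil phi n = fullv \/ (n <= \dim (fil phi n))%N.
  elim: n => [|n [e|IH]]; first by right.
    by left; apply/eqP; rewrite eqEsubv subvf -e filS.
  have [e|ne] := eqVneq (fil phi n) fullv.
    by left; apply/eqP; rewrite eqEsubv subvf -e filS.
  right; apply: leq_ltn_trans IH _; rewrite ltn_neqAle dimvS ?filS // andbT.
  apply/negP => e; have eF : fil phi n = fil phi n.+1.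
    by apply/eqP; rewrite -(geq_leqif (dimv_leqif_eq (filS phi n))) (eqP e).
  apply: (hstable_jump _ ne) => [f a|a ha]; first exact: fil_hit.
  by rewrite eF; apply/filP.
exists (\dim {:A}).+1; have [//|] := h (\dim {:A}).+1.
by rewrite ltnNge dimvS ?subvf.
Qed.
End Exhaustion.

(** * Skew-primitive elements *)

Section SkewPrimitive.
Variables (K : fieldType) (A : fhopfType K) (gT : finGroupType).
Variable phi : grouplike_map A gT.
Implicit Types (f g l : dual K A) (a b x y : A) (u v w : gT).
Local Notation F := (fil phi).
Local Notation J := (inJ phi).

(** Normalised to have 1 as right group-like; multiplication by a group-like brings every
    skew-primitive to this form. *)
Definition skewp v x : Prop := comul x = x ⊗ 1 + phi v ⊗ x.

Lemma skewp_skew_primitive v x : skewp v x -> skew_primitive x.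
Proof.
move=> h; exists 1, (phi v); split=> //; last exact: phi_grouplike.
by rewrite -(phi1 phi); apply: phi_grouplike.
Qed.

Lemma phi_inv u : phi u * phi u^-1%g = 1.
Proof. by rewrite -phiM mulgV phi1. Qed.

Lemma phi_invl u : phi u^-1%g * phi u = 1.
Proof. by rewrite -phiM mulVg phi1. Qed.

Lemma skewp_hit v x :
  skewp v x <-> forall f, hit f x = (f 1 : K) *: x + (f x : K) *: phi v.
Proof.
split=> [h f|h].
  have := @hitE _ _ f x [:: (x, 1); (phi v, x)].
  by rewrite !big_cons !big_nil !addr0 => ->.
rewrite /skewp comul_hit; under eq_bigr do rewrite h.
have [tl tr] := tens_bilin A A.
apply/matrixP=> j k; rewrite summxE !mxE.
transitivity (\sum_(i < \dim {:A})
    (crdA i 1 * (coord (vbasis {:A}) j x * coord (vbasis {:A}) k (vbasis {:A})`_i) +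
    crdA i x * (coord (vbasis {:A}) j (phi v) * coord (vbasis {:A}) k (vbasis {:A})`_i))).
  by apply: eq_bigr => i _; rewrite mxE linearD !linearZ mulrDl -!mulrA.
rewrite big_split; congr (_ + _).
  rewrite {2}(coord_vbasis (memvf 1)) linear_sum mulr_sumr; apply: eq_bigr => i _.
  by rewrite linearZ crdAE /= mulrCA.
rewrite {2}(coord_vbasis (memvf x)) linear_sum mulr_sumr; apply: eq_bigr => i _.
by rewrite linearZ crdAE /= mulrCA.
Qed.

Lemma skewpP v x c y : skewp v x -> skewp v y -> skewp v (c *: x + y).
Proof.
move=> /skewp_hit hx /skewp_hit hy; apply/skewp_hit => f.
rewrite !linearP /= hx hy !scalerDr !scalerDl !scalerA [c * f 1]mulrC.
by rewrite -!addrA; congr (_ + _); rewrite addrCA.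
Qed.

Lemma skewp0 v : skewp v 0.
Proof. by apply/skewp_hit => f; rewrite !linear0 scale0r addr0. Qed.

Definition Ad u x := phi u * x * phi u^-1%g.

Lemma Ad_is_linear u : linear (Ad u).
Proof.
by move=> c x y; rewrite /Ad mulrDr mulrDl -scalerAr -scalerAl.
Qed.
HB.instance Definition _ u := GRing.isLinear.Build K A A *:%R (Ad u) (Ad_is_linear u).

Lemma AdM u v x : Ad (u * v)%g x = Ad u (Ad v x).
Proof. by rewrite /Ad invMg !phiM !mulrA. Qed.

Lemma Ad1 x : Ad 1%g x = x.
Proof. by rewrite /Ad invg1 phi1 mul1r mulr1. Qed.

Lemma phi_Ad u x : phi u * x = Ad u x * phi u.
Proof. by rewrite /Ad -!mulrA phi_invl mulr1. Qed.

Lemma Ad_phi u w : Ad u (phi w) = phi (u * w * u^-1)%g.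
Proof. by rewrite /Ad !phiM. Qed.

Lemma Ad_kG u a : a \in kG phi -> Ad u a \in kG phi.
Proof.
move=> /kG_sum->; rewrite linear_sum memv_suml // => w _.
by rewrite linearZ memvZ //= Ad_phi mem_kG.
Qed.

Lemma skewp_Ad u v x : skewp v x -> skewp (u * v * u^-1)%g (Ad u x).
Proof.
move=> /skewp_hit h; apply/skewp_hit => f; rewrite /Ad hit_Mgrouplike ?phi_grouplike //.
rewrite hit_grouplikeM ?phi_grouplike // h !lmulfE !rmulfE mulrDr mulrDl.
rewrite -!scalerAr -!scalerAl mulr1 phi_inv !phiM; congr (_ *: _ + _ *: _).
Qed.

Lemma kG1 : 1 \in kG phi.
Proof. by rewrite -(phi1 phi) mem_kG. Qed.

Lemma skewp_F2 v x : skewp v x -> x \in F 2.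
Proof.
move=> /skewp_hit h; apply/filP => f fJ; rewrite h -(phi1 phi) fJ scale0r add0r fil1.
by rewrite memvZ ?mem_kG.
Qed.

(** The Taft-Wilson theorem in the form of an induction principle: [kG] and the products [x * phi u]
    with [x] skew-primitive span [F 2]. The proof decomposes [a] first by right and then by left
    group-like degree. *)
Lemma taft_wilson (P : A -> Prop) : P 0 -> (forall a b, P a -> P b -> P (a + b)) ->
    (forall a, a \in kG phi -> P a) -> (forall u v x, skewp v x -> P (x * phi u)) ->
  forall a, a \in F 2 -> P a.
Proof.
move=> P0 PD PG Px a aF2.
pose r := eps A - \sum_u crd_phi phi u.
have rJ : J r.
  move=> v; rewrite add_lfunE opp_lfunE sum_lfunE (bigD1 v) //= crd_phiE eqxx.
  rewrite big1 ?addr0 ?eps_grouplike ?phi_grouplike ?subrr // => w /negPf wv.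
  by rewrite crd_phiE wv.
have -> : a = \sum_u hit (crd_phi phi u) a + hit r a.
  have := @hit_sum _ _ _ (index_enum gT) (fun=> 1) (crd_phi phi) a.
  under eq_bigr do rewrite scale1r; under [RHS]eq_bigr do rewrite scale1r.
  by move=> <-; rewrite hitB hit_eps addrCA subrr addr0.
apply: (PD); last by apply: PG; rewrite -fil1; apply: fil_hitJ.
elim/big_ind: _ => // u _.
(* [a'] is the component of right degree [u], up to [F 1]; [b] is its translate to right degree
   1. *)
set a' := hit _ a; pose b := a' * phi u^-1%g.
have a'E f : hit f a' - (f (phi u) : K) *: a' \in F 1.
  rewrite -hit_conv -hitZ -hitB; apply: fil_hitJ => // v.
  rewrite add_lfunE opp_lfunE scale_lfunE -dual_hit hit_grouplike ?phi_grouplike //.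
  rewrite linearZ /= crd_phiE; case: eqVneq => [->|_]; last by rewrite scale0r scaler0 subrr.
  by rewrite scale1r -[_ *: 1]/(_ * 1) mulr1 subrr.
have bE f : hit f b - (f 1 : K) *: b \in kG phi.
  rewrite hit_Mgrouplike ?phi_grouplike // scalerAl -mulrBl -fil1.
  have := a'E (rmulf f (phi u^-1%g)); rewrite rmulfE phi_inv => h.
  by apply: (@filM _ _ _ _ 0 0) => //; rewrite fil1 mem_kG.
(* Chosen so that Δ(b) = b ⊗ 1 + Σ_v phi v ⊗ bv v, which is [hb] evaluated on functionals; each
   [bv v] is then exactly skew-primitive, not only modulo [kG]. *)
pose bv v := hitl (crd_phi phi v) b - (crd_phi phi v b : K) *: 1.
have fbv f v : f (bv v) = crd_phi phi v (hit f b - (f 1 : K) *: b).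
  have e : crd_phi phi v (hit f b - (f 1 : K) *: b) =
      conv (crd_phi phi v) f b - f 1 * crd_phi phi v b.
    by rewrite raddfB /= linearZ /= dual_hit.
  by rewrite e mulrC raddfB /= linearZ /= dual_hitl.
have hb f : hit f b = (f 1 : K) *: b + \sum_v (f (bv v) : K) *: phi v.
  under eq_bigr do rewrite fbv; rewrite -kG_sum ?bE //.
  by rewrite addrCA subrr addr0.
have skb v : skewp v (bv v).
  apply/skewp_hit => f; rewrite linearB linearZ /= hit_hitl hb linearD linearZ /=.
  have -> : hit f 1 = (f 1 : K) *: 1.
    by rewrite -(phi1 phi) hit_grouplike ?phi_grouplike.
  rewrite linear_sum (bigD1 v) //= big1 ?addr0 => [|w /negPf wv]; last first.
    by rewrite linearZ /= hitl_grouplike ?phi_grouplike // crd_phiE eq_sym wv scale0r scaler0.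
  rewrite [hitl _ (_ *: phi v)]linearZ /= (hitl_grouplike _ (phi_grouplike phi v)).
  rewrite crd_phiE eqxx scale1r addrAC.
  by rewrite scalerBr !scalerA [in _ * f 1]mulrC.
have -> : a' = b * phi u by rewrite /b -mulrA phi_invl mulr1.
have -> : b = (eps A b : K) *: 1 + \sum_v bv v.
  apply: dual_sep => f; rewrite -[LHS]eps_hit hb [LHS]linearD [RHS]linearD /=.
  rewrite [eps A (_ *: _)]linearZ [f (_ *: 1)]linearZ /=; congr (_ + _).
    exact: mulrC.
  rewrite !linear_sum; apply: eq_bigr => v _.
  by rewrite linearZ /= eps_grouplike ?phi_grouplike //; apply: mulr1.
rewrite mulrDl mulr_suml; apply: (PD).
  by apply: PG; rewrite -scalerAl mul1r memvZ ?mem_kG.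
by apply: (big_ind P P0 PD) => v _; apply: Px (skb v).
Qed.

(* On [fil 2] this is x u |-> l x, for x skew-primitive and u group-like. *)
Definition indf l : dual K A :=
  \sum_v (rmulf l (phi v^-1%g) \o hit (crd_phi phi v))%VF.

Lemma indf_phi l u : J l -> indf l (phi u) = 0.
Proof.
move=> lJ; rewrite sum_lfunE big1 // => v _.
rewrite comp_lfunE hit_grouplike ?phi_grouplike // linearZ /= rmulfE -phiM lJ.
by rewrite scaler0.
Qed.

Lemma indf_inJ l : J l -> J (indf l).
Proof. by move=> lJ u; apply: indf_phi. Qed.

Lemma indf_skew l v x u : J l -> skewp v x -> indf l (x * phi u) = l x.
Proof.
move=> lJ /skewp_hit h; rewrite sum_lfunE (bigD1 u) //= big1 ?addr0 => [|w /negPf wu].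
  rewrite comp_lfunE hit_Mgrouplike ?phi_grouplike // h !rmulfE mul1r crd_phiE eqxx.
  rewrite scale1r !mulrDl -!mulrA phi_inv !mulr1 [LHS]linearD /=.
  by rewrite [l (_ *: phi _)]linearZ /= lJ scaler0 addr0.
rewrite comp_lfunE hit_Mgrouplike ?phi_grouplike // h !rmulfE mul1r crd_phiE wu.
by rewrite scale0r add0r -!scalerAl -!phiM [LHS]linearZ /= lJ scaler0.
Qed.
End SkewPrimitive.

(** * Symbols of filtered operators *)

(* The associated graded of a finite filtration is realized on the filtered   *)
(* space itself: [pj n] are nested projections onto the steps [Fl n], and an  *)
(* operator of degree d is replaced by its symbol, a genuine endomorphism.    *)
Section Symbol.
Variables (K : fieldType) (A : vectType K) (Fl : nat -> {vspace A}) (N : nat).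
Hypothesis Fl0 : Fl 0 = 0%VS.
Hypothesis FlS : forall n, (Fl n <= Fl n.+1)%VS.
Hypothesis FlN : Fl N = fullv.
Implicit Types (a b : A) (S T : 'End(A)) (n m d e : int).

(** Built from the top step downwards, each projection composed with the previous one. Projections
    chosen separately for each step need not satisfy [pj_comp]. *)
Fixpoint pjd (j : nat) : 'End(A) :=
  if j is j'.+1 then (projv (Fl (N - j'.+1)) \o pjd j')%VF else \1%VF.

Lemma Fl_le (i j : nat) : (i <= j)%N -> (Fl i <= Fl j)%VS.
Proof.
move=> /subnK <-; elim: (j - i)%N => [|k IH]; first exact: subvv.
by rewrite addSn; apply: subv_trans IH (FlS _).
Qed.

Lemma pjd_id j a : a \in Fl (N - j) -> pjd j a = a.
Proof.
elim: j a => [|j IH] a aF /=; first by rewrite id_lfunE.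
rewrite comp_lfunE IH ?projv_id //.
by apply: subvP aF; apply: Fl_le; apply: leq_sub2l.
Qed.

Lemma pjd_in j a : pjd j a \in Fl (N - j).
Proof.
case: j => [|j] /=; first by rewrite subn0 FlN memvf.
by rewrite comp_lfunE memv_proj.
Qed.

Lemma pjd_comp i j a : (j <= i)%N -> pjd i (pjd j a) = pjd i a.
Proof.
move=> /subnK <-; elim: (i - j)%N => [|k IH] /=; first by rewrite pjd_id ?pjd_in.
by rewrite !comp_lfunE IH.
Qed.

(** Integer degrees, with zero spaces below 0, let operators of negative degree shift without
    truncation. *)
Definition Flz n : {vspace A} := if n is Posz k then Fl k else 0%VS.
Definition pj n : 'End(A) := if n is Posz k then pjd (N - k) else 0.
Definition gp n : 'End(A) := pj n - pj (n - 1).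

Lemma Flz_le n m : n <= m -> (Flz n <= Flz m)%VS.
Proof. by case: n m => [i|i] [j|j] //= h; rewrite ?sub0v //; apply: Fl_le. Qed.

Lemma Flz_leP n m a : n <= m -> a \in Flz n -> a \in Flz m.
Proof. by move=> /Flz_le/subvP; apply. Qed.

Lemma pj_in n a : pj n a \in Flz n.
Proof.
case: n => [k|k] /=; last by rewrite lfunE /= mem0v.
have [kN|Nk] := leqP k N; first by rewrite -{2}(subKn kN) pjd_in.
by apply: (subvP (Fl_le (ltnW Nk))); rewrite FlN memvf.
Qed.

Lemma pj_id n a : a \in Flz n -> pj n a = a.
Proof.
case: n => [k|k] /=; last by rewrite memv0 => /eqP->; rewrite linear0.
move=> aF; apply: pjd_id; have [kN|Nk] := leqP k N; first by rewrite subKn.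
by rewrite (eqP (ltnW Nk : _ == _)) subn0 FlN memvf.
Qed.

Lemma pj_comp n m a : n <= m -> pj n (pj m a) = pj n a.
Proof.
case: n m => [i|i] [j|j] //= h; rewrite ?lfunE //=.
by apply: pjd_comp; apply: leq_sub2l.
Qed.

Lemma pj_compr n m a : n <= m -> pj m (pj n a) = pj n a.
Proof. by move=> nm; rewrite pj_id // (Flz_leP nm) ?pj_in. Qed.

Lemma gpE n a : gp n a = pj n a - pj (n - 1) a.
Proof. by rewrite add_lfunE opp_lfunE. Qed.

Lemma gp_in n a : gp n a \in Flz n.
Proof. by rewrite gpE memvB ?pj_in // (@Flz_leP (n - 1)) ?pj_in // gerBl. Qed.

Lemma gp_low n a : a \in Flz (n - 1) -> gp n a = 0.
Proof. by move=> h; rewrite gpE !pj_id ?subrr // (@Flz_leP (n - 1)) // gerBl. Qed.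

Lemma gp_sub n a : a \in Flz n -> a - gp n a \in Flz (n - 1).
Proof. by move=> h; rewrite gpE (pj_id h) opprB addrCA subrr addr0 pj_in. Qed.

Lemma gp_orth n m a : gp m (gp n a) = if m == n then gp n a else 0.
Proof.
case: eqVneq => [->|]; rewrite !gpE !raddfB /=.
  have n1 : n - 1 <= n by rewrite gerBl.
  rewrite (pj_comp _ (lexx n)) (pj_compr _ n1) (pj_comp _ n1).
  by rewrite (pj_comp _ (lexx (n - 1))) subrr addr0.
rewrite neq_lt => /orP[mn|nm].
  have m1 : m <= n - 1 by rewrite -ltzD1 subrK.
  have m1' : m - 1 <= n - 1 by apply: le_trans m1; rewrite gerBl.
  have mn' : m - 1 <= n by apply: le_trans (ltW mn); rewrite gerBl.
  by rewrite (pj_comp _ (ltW mn)) (pj_comp _ mn') (pj_comp _ m1) (pj_comp _ m1') !subrr addr0.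
have m1 : n <= m - 1 by rewrite -ltzD1 subrK.
have m1' : n - 1 <= m - 1 by apply: le_trans m1; rewrite gerBl.
have mn' : n - 1 <= m by apply: le_trans (ltW nm); rewrite gerBl.
by rewrite (pj_compr _ (ltW nm)) (pj_compr _ mn') (pj_compr _ m1) (pj_compr _ m1') -opprD subrr.
Qed.

Lemma gp_sum a : a = \sum_(n < N.+1) gp n a.
Proof.
have h (k : nat) : pj k a = \sum_(n < k.+1) gp n a.
  elim: k => [|k IH]; rewrite big_ord_recr /=.
    by rewrite big_ord0 add0r gpE sub0r /= lfunE /= subr0.
  rewrite -IH gpE; have -> : (Posz k.+1 - 1 = k :> int) by rewrite -addn1 PoszD addrK.
  by rewrite addrCA subrr addr0.
by rewrite -h pj_id //= FlN memvf.
Qed.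

Lemma gp_neg n a : n <= 0 -> gp n a = 0.
Proof.
move=> n0; apply/eqP; rewrite -memv0 -Fl0 -[Fl 0]/(Flz 0).
exact: Flz_leP (gp_in n a).
Qed.

Lemma gp_big n a : Posz N < n -> gp n a = 0.
Proof.
move=> Nn; apply: gp_low; apply: (@Flz_leP (Posz N)); first by rewrite -ltzD1 subrK.
by rewrite /= FlN memvf.
Qed.

Lemma gp_eq a b : (forall n, gp n a = gp n b) -> a = b.
Proof.
by move=> h; rewrite (gp_sum a) (gp_sum b); apply: eq_bigr => i _; apply: h.
Qed.

Definition symb d T : 'End(A) := \sum_(n < N.+1) (gp (Posz n + d) \o T \o gp n)%VF.

Lemma gp_symb d T m a : gp m (symb d T a) = gp m (T (gp (m - d) a)).
Proof.
rewrite sum_lfunE linear_sum /=.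
have e n : gp m ((gp (n + d) \o T \o gp n)%VF a) =
    if n == m - d then gp m (T (gp (m - d) a)) else 0.
  rewrite !comp_lfunE gp_orth -subr_eq eq_sym.
  by case: eqP => // ->; rewrite subrK.
under eq_bigr do rewrite e.
case h : (0 <= m - d) => /=; last first.
  rewrite big1 => [|i _].
    by rewrite (gp_neg (n := m - d)) ?linear0 // ltW // ltNge h.
  by case: eqP => // ei; move: h; rewrite -ei.
have [k ek] : exists k : nat, m - d = k by case: (m - d) h => // k _; exists k.
rewrite ek; have [kN|Nk] := ltnP k N.+1.
  rewrite (bigD1 (Ordinal kN)) //= eqxx big1 ?addr0 // => i ik.
  by case: eqP => // -[] ei; case/eqP: ik; apply: val_inj.
rewrite (gp_big (n := k)) ?ltz_nat // !linear0 big1 // => i _; by case: ifP.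
Qed.

Definition filt d T := forall n a, a \in Flz n -> T a \in Flz (n + d).

(** [T] followed by a projection to top degree differs from [T] by a lower term, which [S] sends
    below the degree that the outer [gp] reads. *)
Lemma symb_comp d e S T : filt d S -> filt e T ->
  forall a, symb d S (symb e T a) = symb (e + d) (S \o T)%VF a.
Proof.
move=> fS fT a; apply: gp_eq => m; rewrite !gp_symb comp_lfunE.
have -> : m - (e + d) = m - d - e by rewrite opprD addrA addrAC.
set y := gp _ a; have yF : T y \in Flz (m - d).
  by have := fT _ _ (gp_in (m - d - e) a); rewrite subrK.
apply/eqP; rewrite -subr_eq0 -!linearB /=; apply/eqP; apply: gp_low.
rewrite -opprB linearN memvN.
by have := fS _ _ (gp_sub yF); rewrite addrAC subrK.
Qed.

Lemma symb_low d T a : filt (d - 1) T -> symb d T a = 0.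
Proof.
move=> fT; apply: gp_eq => m; rewrite gp_symb linear0; apply: gp_low.
by have := fT _ _ (gp_in (m - d) a); rewrite addrA subrK.
Qed.

Lemma symb_id a : symb 0 \1%VF a = a.
Proof. by apply: gp_eq => m; rewrite gp_symb id_lfunE subr0 gp_orth eqxx. Qed.

Lemma symbP d c S T a : symb d (c *: S + T) a = c *: symb d S a + symb d T a.
Proof.
apply: gp_eq => m.
by rewrite gp_symb (add_lfunE (c *: S) T) (scale_lfunE c S) !linearP /= !gp_symb.
Qed.

Lemma symb_eq d S T a : filt (d - 1) (S - T) -> symb d S a = symb d T a.
Proof.
move=> h; have := symb_low a h; rewrite -scaleN1r addrC symbP scaleN1r.
by move/eqP; rewrite addrC subr_eq0 => /eqP.
Qed.

(** The descending filtration of the grading. Operators of positive degree climb it, and it is zero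
    from [N] on, which gives nilpotency. *)
Definition deg_gt k a := forall m, m <= k -> gp m a = 0.

Lemma deg_gt_symb d T k a : deg_gt k a -> deg_gt (k + d) (symb d T a).
Proof.
by move=> h m mk; rewrite gp_symb h ?linear0 // lerBlDr.
Qed.

Lemma deg_gtN a : deg_gt N a -> a = 0.
Proof.
by move=> h; rewrite (gp_sum a) big1 // => i _; apply: h; rewrite lez_nat -ltnS.
Qed.

Lemma deg_gt0 a : deg_gt 0 a.
Proof. by move=> m m0; apply: gp_neg. Qed.

Lemma deg_gtP k c a b : deg_gt k a -> deg_gt k b -> deg_gt k (c *: a + b).
Proof. by move=> ha hb m mk; rewrite linearP /= ha ?hb // scaler0 addr0. Qed.

Lemma deg_gt_le k m a : m <= k -> deg_gt k a -> deg_gt m a.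
Proof. by move=> mk h n nm; apply: h; apply: le_trans mk. Qed.

Lemma gp1 a : a \in Fl 1 -> forall m, gp m a = if m == 1 then a else 0.
Proof.
move=> aF m; have a1 : gp 1 a = a.
  have := @gp_sub 1 a aF; rewrite subrr /= Fl0 memv0 subr_eq0 => /eqP e.
  by rewrite -e.
by rewrite -{1}a1 gp_orth a1.
Qed.

Lemma symb1 d T a : a \in Fl 1 -> filt d T -> symb d T a = gp (1 + d) (T a).
Proof.
move=> aF fT; apply: gp_eq => m; rewrite gp_symb (gp1 aF (m - d)) gp_orth subr_eq.
by case: eqVneq => [->|_] //; rewrite !linear0.
Qed.
End Symbol.

(** * Raising, group-like and lowering operators on the symbols *)

Section Operators.
Variables (K : fieldType) (A : fhopfType K) (gT : finGroupType).
Variables (phi : grouplike_map A gT) (N : nat).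
Hypothesis FN : fil phi N = fullv.
Implicit Types (f g l : dual K A) (a b x y : A) (u v w : gT).
Local Notation F := (fil phi).
Local Notation J := (inJ phi).

Lemma fil0 : F 0 = 0%VS. Proof. by []. Qed.

Definition lmul x : 'End(A) := linfun (fun y => x * y).

Lemma lmulE x y : lmul x y = x * y.
Proof.
have l : linear (fun y => x * y) by move=> c u v; rewrite mulrDr -scalerAr.
pose G : {linear A -> A} := HB.pack (fun y => x * y) (GRing.isLinear.Build K _ _ _ _ l).
exact: (lfunE G y).
Qed.

Lemma filt_lmul i x : x \in F i.+1 -> filt F i (lmul x).
Proof.
move=> xF [[|k]|k] a; rewrite lmulE; do ?by rewrite /= memv0 => /eqP->; rewrite mulr0 mem0v.
move=> aF; rewrite (_ : Posz k.+1 + i = (i + k).+1); first exact: filM.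
by rewrite -PoszD addSn addnC.
Qed.

Lemma filt_hit d f : (forall b, b \in F d -> f b = 0) -> filt F (- Posz d) (hit f).
Proof.
move=> fd [k|k] a; last by rewrite /= memv0 => /eqP->; rewrite linear0 mem0v.
move=> aF; have := fil_lower fd aF; have [dk|kd] := leqP d k.
  by rewrite subzn.
have -> : (k - d = 0)%N by apply/eqP; rewrite subn_eq0 ltnW.
by rewrite /= memv0 => /eqP->; rewrite mem0v.
Qed.

Lemma inJ_fil1 f b : J f -> b \in F 1 -> f b = 0.
Proof. by move=> fJ; rewrite fil1; apply: kG_dual. Qed.

Lemma filt_hitJ f : J f -> filt F (- 1) (hit f).
Proof. by move=> fJ; apply: (@filt_hit 1) => b; apply: inJ_fil1. Qed.

Lemma filt_comp d e (S T : 'End(A)) : filt F d S -> filt F e T -> filt F (e + d) (S \o T)%VF.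
Proof. by move=> fS fT n a aF; rewrite comp_lfunE addrA; apply/fS/fT. Qed.

Local Notation sy := (symb F N).

Definition Xop x := sy 1 (lmul x).
Definition Gop u := sy 0 (lmul (phi u)).
Definition dop l := sy (- 1) (hit (indf phi l)).

Lemma phi_F1 u : phi u \in F 1. Proof. by rewrite fil1 mem_kG. Qed.

Lemma filt_phi u : filt F 0 (lmul (phi u)).
Proof. by apply: (@filt_lmul 0); apply: phi_F1. Qed.

Let sy_comp := symb_comp fil0 (filS phi) FN.
Let sy_eq := symb_eq fil0 (filS phi) FN.
Let syP := symbP fil0 (filS phi) FN.
Let sy_id := symb_id fil0 (filS phi) FN.
Let sy_low := symb_low fil0 (filS phi) FN.

Lemma Xop_comb c x y a : Xop (c *: x + y) a = c *: Xop x a + Xop y a.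
Proof.
rewrite /Xop -syP; congr (sy _ _ _); apply/lfunP => z.
by rewrite add_lfunE scale_lfunE !lmulE mulrDl scalerAl.
Qed.

Lemma Xop_kG x a : x \in kG phi -> Xop x a = 0.
Proof. by move=> xG; apply: sy_low; apply: (@filt_lmul 0); rewrite fil1. Qed.

Lemma Gop_mul u v a : Gop u (Gop v a) = Gop (u * v)%g a.
Proof.
rewrite /Gop sy_comp ?addr0; do ?exact: filt_phi.
by congr (sy _ _ _); apply/lfunP => z; rewrite comp_lfunE !lmulE mulrA phiM.
Qed.

Lemma Gop1 a : Gop 1%g a = a.
Proof.
rewrite -[RHS]sy_id; congr (sy _ _ _); apply/lfunP => z.
by rewrite lmulE id_lfunE phi1 mul1r.
Qed.

Lemma Gop_X u v x a : skewp phi v x -> Gop u (Xop x a) = Xop (Ad phi u x) (Gop u a).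
Proof.
move=> sx; rewrite /Gop /Xop !sy_comp; do ?exact: filt_phi.
- rewrite add0r; congr (sy _ _ _); apply/lfunP => z.
  by rewrite !comp_lfunE !lmulE !mulrA -phi_Ad.
- by apply: (@filt_lmul 1); apply: skewp_F2 (skewp_Ad u sx).
by apply: (@filt_lmul 1); apply: skewp_F2 sx.
Qed.

(** On all group-likes [lmulf (indf phi l) x] has the constant value [l x], so it differs from [l x]
    times the counit by an element of J, invisible in the symbol. This constancy is what [indf]
    provides and [l] alone does not. *)
Lemma dop_X l v x a : J l -> skewp phi v x ->
  dop l (Xop x a) = Xop x (dop l a) + (l x : K) *: Gop v a.
Proof.
move=> lJ sx; have fx : filt F 1 (lmul x) by apply: (@filt_lmul 1); apply: skewp_F2 sx.
have fl : filt F (- 1) (hit (indf phi l)) by apply: filt_hitJ; apply: indf_inJ.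
rewrite /dop /Xop !sy_comp // subrr addNr addrC -syP.
apply: sy_eq; rewrite sub0r.
set f := lmulf (indf phi l) x.
have -> : (hit (indf phi l) \o lmul x)%VF -
    ((l x : K) *: lmul (phi v) + (lmul x \o hit (indf phi l))%VF) =
   (lmul (phi v) \o hit (f - (l x : K) *: eps A))%VF.
  apply/lfunP => z; rewrite add_lfunE opp_lfunE add_lfunE scale_lfunE !comp_lfunE !lmulE.
  rewrite (hit_skewM _ _ sx) hitB hitZ hit_eps mulrBr -scalerAr.
  have e (p q r : A) : p + q - (r + p) = q - r.
    by rewrite opprD [- r - p]addrC addrA [p + q]addrC addrK.
  exact: e.
rewrite -[X in filt _ X _]addr0.
apply: filt_comp (filt_phi v) _; apply: filt_hitJ => w.
rewrite add_lfunE opp_lfunE scale_lfunE lmulfE (indf_skew _ lJ sx).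
rewrite eps_grouplike ?phi_grouplike //.
by apply/eqP; rewrite subr_eq0 eq_sym; apply/eqP; apply: mulr1.
Qed.

Lemma inJ_Ad l u : J l -> J (l \o linfun (Ad phi u))%VF.
Proof.
move=> lJ w; rewrite comp_lfunE lfunE /= Ad_phi; exact: lJ.
Qed.

(** The two functionals agree on [F 2] by the Taft-Wilson theorem, so their difference lowers the
    degree by two and has zero symbol in degree -1. *)
Lemma dop_G l u a : J l -> dop l (Gop u a) = Gop u (dop (l \o linfun (Ad phi u))%VF a).
Proof.
move=> lJ; have l'J := inJ_Ad u lJ.
rewrite /dop /Gop !sy_comp ?add0r ?addr0; do ?exact: filt_phi; do ?by apply/filt_hitJ/indf_inJ.
apply: sy_eq; set f := indf _ (_ \o _)%VF.
have -> : (hit (indf phi l) \o lmul (phi u))%VF - (lmul (phi u) \o hit f)%VF =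
   (lmul (phi u) \o hit (lmulf (indf phi l) (phi u) - f))%VF.
  apply/lfunP => z; rewrite add_lfunE opp_lfunE !comp_lfunE !lmulE hitB mulrBr.
  by rewrite hit_grouplikeM ?phi_grouplike.
have -> : - 1 - 1 = - 2%:Z + 0 by [].
apply: filt_comp (filt_phi u) _.
apply: filt_hit => b; move: b; apply: taft_wilson => [|x y hx hy|x xG|w v x sx].
- by rewrite linear0.
- by rewrite linearD /= hx hy addr0.
- rewrite (kG_dual _ xG) // => w; rewrite add_lfunE opp_lfunE lmulfE -phiM.
  by rewrite !indf_phi // subrr.
rewrite add_lfunE opp_lfunE lmulfE mulrA phi_Ad -mulrA -phiM.
rewrite (indf_skew _ lJ (skewp_Ad _ sx)) (indf_skew _ l'J sx) comp_lfunE lfunE.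
by rewrite subrr.
Qed.

Lemma Gop_phi u w : Gop u (phi w) = phi (u * w)%g.
Proof.
rewrite /Gop (symb1 fil0 (filS phi) FN (phi_F1 w)); last exact: filt_phi.
by rewrite lmulE -phiM (gp1 fil0 (filS phi) FN (phi_F1 _)).
Qed.

Lemma dop_phi l w : J l -> dop l (phi w) = 0.
Proof.
move=> lJ; rewrite /dop (symb1 fil0 (filS phi) FN (phi_F1 w)).
  by rewrite subrr; apply: gp_neg => //; apply: filS.
by apply/filt_hitJ/indf_inJ.
Qed.

Lemma deg_gt_X k x a : deg_gt F N k a -> deg_gt F N (k + 1) (Xop x a).
Proof. exact: (deg_gt_symb fil0 (filS phi) FN). Qed.

End Operators.

(** * Nilpotency obstructions *)

Lemma sum_shift (V : zmodType) n (P : nat -> V) :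
  P n = P 0%N -> \sum_(j < n) P j.+1 = \sum_(j < n) P j.
Proof.
move=> Pn; apply: (@addrI _ (P 0%N)); transitivity (\sum_(j < n.+1) P j).
  by rewrite big_ord_recl.
by rewrite big_ord_recr /= Pn addrC.
Qed.

Section NotNilpotent.
Variables (K : fieldType) (W : lmodType K).
Hypothesis char0 : [pchar K] =i pred0.

Lemma natS_neq0 n : n.+1%:R != 0 :> K.
Proof. by rewrite (pcharf0P K).1. Qed.

Lemma derivative_not_nilpotent (z D T : W -> W) (v : W) (c : K) :
    v != 0 -> c != 0 -> D 0 = 0 -> (forall y, T y = 0 -> y = 0) ->
    (forall n, D (iter n.+1 z v) = (n.+1%:R * c) *: T (iter n z v)) ->
  forall n, iter n z v != 0.
Proof.
move=> v0 c0 D0 T0 h; elim=> [|n IH] //; apply: contra IH => /eqP e.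
have := h n; rewrite e D0 => /esym/eqP.
by rewrite scaler_eq0 mulf_eq0 (negPf (natS_neq0 n)) (negPf c0) /= => /eqP/T0->.
Qed.

(* The imaginary root vector of an affine rank two configuration: a and b     *)
(* have opposite degrees and F1, F2 are the skew derivations dual to them.    *)
Section Affine.
Variables (a b F1 F2 g gi : {linear W -> W}) (M : W -> Prop) (q c1 c2 : K) (v : W).
Hypotheses (gK : cancel g gi) (giK : cancel gi g).
Hypothesis M_lin : forall c x y, M x -> M y -> M (c *: x + y).
Hypothesis M_a : forall y, M y -> M (a y).
Hypothesis M_b : forall y, M y -> M (b y).
Hypothesis M_g : forall y, M y -> M (g y).
Hypothesis M_v : M v.
Hypothesis ga : forall y, g (a y) = q^-1 *: a (g y).
Hypothesis gb : forall y, g (b y) = q *: b (g y).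
Hypothesis F1a : forall y, M y -> F1 (a y) = a (F1 y) + c1 *: g y.
Hypothesis F1b : forall y, M y -> F1 (b y) = b (F1 y).
Hypothesis F2a : forall y, M y -> F2 (a y) = a (F2 y).
Hypothesis F2b : forall y, M y -> F2 (b y) = b (F2 y) + c2 *: gi y.
Hypothesis F1v : F1 v = 0.
Hypothesis F2gv : F2 (g v) = 0.
Hypotheses (q0 : q != 0) (q21 : q ^+ 2 != 1) (c10 : c1 != 0) (c20 : c2 != 0).
Hypothesis v0 : v != 0.

Definition affz y := a (b y) - q^-1 *: b (a y).

Lemma affz_linear : linear affz.
Proof.
move=> c x y; rewrite /affz (linearP b) (linearP a) (linearP a) (linearP b).
rewrite scalerBr !scalerDr !scalerA.
by rewrite [c * _]mulrC opprD addrACA.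
Qed.

Lemma affz0 : affz 0 = 0.
Proof. by rewrite /affz !linear0 addr0. Qed.

Lemma M0 : M 0.
Proof. by have := M_lin (-1) M_v M_v; rewrite scaleN1r addNr. Qed.

Lemma M_z y : M y -> M (affz y).
Proof.
by move=> My; rewrite /affz addrC -scaleNr; apply: M_lin; [apply/M_b/M_a|apply/M_a/M_b].
Qed.

Lemma gz y : g (affz y) = affz (g y).
Proof.
have e1 : g (a (b y)) = a (b (g y)) by rewrite ga gb linearZ scalerA mulVf ?scale1r.
have e2 : g (b (a y)) = b (a (g y)) by rewrite gb ga linearZ scalerA mulfV ?scale1r.
by rewrite /affz linearB linearZ /= e1 e2.
Qed.

Lemma F1z y : M y -> F1 (affz y) = affz (F1 y) + (c1 * (q - q^-1)) *: b (g y).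
Proof.
move=> My; have Mb := M_b My; have Ma := M_a My.
rewrite /affz linearB linearZ /= (F1a Mb) (F1b Ma) (F1b My) (F1a My) gb.
rewrite linearD linearZ /= scalerDr !scalerA opprD addrACA; congr (_ + _).
by rewrite [b (_ *: _)]linearZ scalerA -scalerBl mulrBr [c1 * q^-1]mulrC [c1 * q]mulrC.
Qed.

Lemma agi y : a (gi y) = q^-1 *: gi (a y).
Proof. by apply: (can_inj gK); rewrite linearZ /= !giK ga giK. Qed.

Lemma F2z y : M y -> F2 (affz y) = affz (F2 y).
Proof.
move=> My; have Mb := M_b My; have Ma := M_a My.
rewrite /affz linearB linearZ /= (F2a Mb) (F2b Ma) (F2b My) (F2a My).
rewrite linearD linearZ /= agi scalerDr !scalerA opprD addrACA [q^-1 * c2]mulrC.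
by rewrite subrr addr0.
Qed.

Lemma M_iter n y : M y -> M (iter n affz y).
Proof. by move=> My; elim: n => //= n; apply: M_z. Qed.

(** [F1] passes [affz] up to a multiple of [b \o g], and [F2] turns this into gi g = 1. Hence F2 F1
    differentiates the powers of [affz] with constant c1 (q - q^-1) c2, non-zero because q^2 is not
    1. The lowering relations are restricted to [M] because composites of two lowering operators
    satisfy them only on vectors killed by suitable derivations. *)
Lemma affine_not_nilpotent n : iter n affz v != 0.
Proof.
have gi_iter j y : g (iter j affz y) = iter j affz (g y).
  by elim: j => //= j <-; rewrite gz.
have F2gz j : F2 (iter j affz (g v)) = 0.
  elim: j => //= j IH; rewrite F2z ?IH ?affz0 //; apply: M_iter; exact: M_g.
set c := c1 * (q - q^-1).
have h j : M (F1 (iter j affz v)) /\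
    F2 (F1 (iter j affz v)) = (j%:R * (c * c2)) *: iter j.-1 affz v.
  elim: j => [|j [IH1 IH2]]; first by rewrite /= F1v linear0 mul0r scale0r; split; first exact: M0.
  rewrite /= F1z; last exact: M_iter.
  have Mb : M (b (g (iter j affz v))) by apply/M_b/M_g/M_iter.
  split; first by rewrite addrC; apply: M_lin => //; apply: M_z.
  rewrite linearD linearZ /= F2z // IH2 F2b; last by apply/M_g/M_iter.
  rewrite gK gi_iter F2gz linear0 add0r scalerA.
  case: j {IH1 IH2 Mb} => [|j] /=; first by rewrite mul0r scale0r affz0 add0r mul1r.
  have -> y : affz ((j.+1%:R * (c * c2)) *: y) = (j.+1%:R * (c * c2)) *: affz y.
    by have := affz_linear (j.+1%:R * (c * c2)) y 0; rewrite !addr0 affz0 addr0.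
  by rewrite -scalerDl -[in RHS]natr1 mulrDl mul1r.
apply: (@derivative_not_nilpotent affz (fun y => F2 (F1 y)) id v (c * c2)) => //.
- rewrite !mulf_neq0 // subr_eq0; apply: contra q21 => /eqP e.
  by rewrite expr2 {1}e mulVf.
- by rewrite !linear0.
by move=> j; have [_ ->] := h j.+1.
Qed.
End Affine.
End NotNilpotent.

(** * Functionals separating types and eigenvalues *)

Section Weights.
Variables (K : fieldType) (A : fhopfType K) (gT : finGroupType).
Variables (phi : grouplike_map A gT) (N : nat).
Hypothesis char0 : [pchar K] =i pred0.
Hypothesis FN : fil phi N = fullv.
Implicit Types (f g l : dual K A) (a b x y : A) (u v w : gT).
Local Notation J := (inJ phi).
Local Notation X := (Xop phi N).
Local Notation G := (Gop phi N).
Local Notation D := (dop phi N).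

Lemma skewp_hitl v x f : skewp phi v x -> hitl f x = (f x : K) *: 1 + (f (phi v) : K) *: x.
Proof.
move=> h; have := @hitlE _ _ f x [:: (x, 1); (phi v, x)].
by rewrite !big_cons !big_nil !addr0 => ->.
Qed.

Lemma sep_kG x : x \notin kG phi -> exists l, J l /\ l x = 1.
Proof.
move=> xG; have [i hi] : exists i, crdA i (tau phi x) != 0.
  apply/existsP; apply: contraR xG; rewrite negb_exists => /forallP h.
  have : tau phi x = 0.
    rewrite (coord_vbasis (memvf (tau phi x))) big1 // => i _.
    by move: (h i); rewrite negbK crdAE => /eqP->; rewrite scale0r.
  rewrite tauE => /eqP; rewrite subr_eq0 => /eqP->.
  by apply: memv_suml => u _; rewrite memvZ ?mem_kG.
exists ((crdA i (tau phi x))^-1 *: (crdA i \o tau phi)%VF); split=> [u|].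
  by rewrite scale_lfunE tau_inJ scaler0.
by rewrite scale_lfunE comp_lfunE; apply: mulVf.
Qed.

(** Left convolution with [crd_phi phi v] annihilates skew-primitives of every other type. *)
Lemma left_functional v x : skewp phi v x -> x \notin kG phi ->
  exists l, [/\ J l, l x = 1
    & forall w y, skewp phi w y -> w != v -> l y = 0].
Proof.
move=> sx xG; have [l [lJ lx]] := sep_kG xG.
have l1 : l 1 = 0 by rewrite -(phi1 phi) lJ.
have lE w y : skewp phi w y -> conv (crd_phi phi v) l y = (v == w)%:R * l y.
  move=> sy; rewrite -dual_hitl (skewp_hitl _ sy) linearD !linearZ /= l1 scaler0 add0r.
  by rewrite crd_phiE.
exists (conv (crd_phi phi v) l); split.
- exact: inJ_convr.
- by rewrite (lE _ _ sx) eqxx mul1r.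
by move=> w y sy wv; rewrite (lE _ _ sy) eq_sym (negPf wv) mul0r.
Qed.

Lemma raising_nilpotent (z : A -> A) y :
    (forall k a, deg_gt (fil phi) N k a -> deg_gt (fil phi) N (k + 1) (z a)) ->
  exists n, iter n z y = 0.
Proof.
move=> hz; exists N; apply: (deg_gtN (filS phi) FN).
have h n : deg_gt (fil phi) N n%:Z (iter n z y).
  elim: n => [|n IH] /=; first exact: (deg_gt0 (fil0 phi) (filS phi) FN).
  by rewrite -addn1 PoszD; apply: hz.
exact: h.
Qed.

Lemma affz_nilpotent (a b : {linear A -> A}) q y :
    (forall (k : int) x, deg_gt (fil phi) N k x -> deg_gt (fil phi) N (k + 1) (a x)) ->
    (forall (k : int) x, deg_gt (fil phi) N k x -> deg_gt (fil phi) N (k + 1) (b x)) ->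
  exists n, iter n (affz a b q) y = 0.
Proof.
move=> ha hb; apply: raising_nilpotent => k x hx; rewrite /affz [X in deg_gt _ _ _ X]addrC -scaleNr.
have h1 : k + 1 <= k + 1 + 1 by rewrite lerDl.
by apply: deg_gtP; apply: (deg_gt_le h1); [apply/hb/ha|apply/ha/hb].
Qed.

Lemma one_neq0 : (1 : A) != 0. Proof. exact: oner_neq0. Qed.

Lemma dop_1 l : J l -> D l 1 = 0.
Proof. by move=> lJ; rewrite -(phi1 phi); apply: dop_phi. Qed.

(** Here [X x] commutes with [G v], so [D l] differentiates the powers of [X x] up to the invertible
    [G v], and [X x] could not be nilpotent. *)
Lemma skewp_trivial_action v x : skewp phi v x -> Ad phi v x = x -> x \in kG phi.
Proof.
move=> sx Ax; apply/negPn/negP => xG.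
have [l [lJ lx _]] := left_functional sx xG.
have GX y : G v (X x y) = X x (G v y) by rewrite (Gop_X FN _ _ sx) Ax.
have Giter n : G v (iter n (X x) 1) = iter n (X x) (G v 1).
  by elim: n => //= n <-; rewrite GX.
have [n nz] := @raising_nilpotent (X x) 1 (fun k a => @deg_gt_X _ _ _ phi N FN k x a).
have := @derivative_not_nilpotent _ _ char0 (X x) (D l) (G v) 1 1 one_neq0 (oner_neq0 _).
move=> /(_ (linear0 _)); case/(_ _ _ n)/negP; last by rewrite nz.
  by move=> y /(congr1 (G v^-1%g)); rewrite (Gop_mul FN) mulVg (Gop1 FN) linear0.
elim=> [|k IH].
  by rewrite /= (dop_X FN _ lJ sx) dop_1 // linear0 add0r lx scale1r mulr1 scale1r.
rewrite iterS (dop_X FN _ lJ sx) IH lx linearZ /= !mulr1 scale1r -GX -iterS.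
by rewrite -[in RHS]natr1 scalerDl scale1r.
Qed.

Variables (h : gT) (m : nat).
Hypotheses (hm : (h ^+ m)%g = 1%g) (m_gt0 : (0 < m)%N).

Definition eigp v c x := skewp phi v x /\ Ad phi h x = c *: x.

Lemma Ad_expg j c x : Ad phi h x = c *: x -> Ad phi (h ^+ j)%g x = c ^+ j *: x.
Proof.
move=> hx; elim: j => [|j IH]; first by rewrite expg0 Ad1 scale1r.
by rewrite expgS AdM IH linearZ /= hx scalerA -exprSr.
Qed.

Lemma eigp_root c x : Ad phi h x = c *: x -> x != 0 -> c ^+ m = 1.
Proof.
move=> hx x0; have := Ad_expg m hx; rewrite hm Ad1 => /eqP.
by rewrite -subr_eq0 -{1}[x]scale1r -scalerBl scaler_eq0 (negPf x0) orbF subr_eq0 => /eqP.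
Qed.

Lemma weight_functional v c x : eigp v c x -> x \notin kG phi ->
  exists l, [/\ J l, l x = 1
    & forall w d y, eigp w d y -> (w, d) != (v, c) -> l y = 0].
Proof.
move=> [sx hx] xG; have [l [lJ lx lw]] := left_functional sx xG.
have x0 : x != 0 by apply: contraNneq xG => ->; rewrite mem0v.
have cm := eigp_root hx x0.
have c0 : c != 0.
  by apply/eqP => c0; move: cm; rewrite c0 expr0n eqn0Ngt m_gt0 => /eqP; rewrite eq_sym oner_eq0.
have mK : m%:R != 0 :> K by rewrite -(prednK m_gt0) natS_neq0.
(* The average over the powers of [h] that projects to the eigenvalue [c]. *)
pose l' : dual K A := m%:R^-1 *: \sum_(j < m) c ^- j *: (l \o linfun (Ad phi (h ^+ j)%g))%VF.
have lE d y : Ad phi h y = d *: y -> l' y = m%:R^-1 * (\sum_(j < m) (d / c) ^+ j) * l y.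
  move=> hy; rewrite scale_lfunE sum_lfunE -mulrA mulr_suml.
  congr (_ * _); apply: eq_bigr => j _.
  rewrite scale_lfunE comp_lfunE lfunE /= (Ad_expg _ hy) linearZ /=.
  by rewrite expr_div_n [d ^+ j / _]mulrC -[RHS]mulrA.
exists l'; split.
- move=> u; rewrite scale_lfunE sum_lfunE big1 ?scaler0 // => j _.
  by rewrite scale_lfunE comp_lfunE lfunE /= Ad_phi lJ scaler0.
- rewrite (lE _ _ hx) lx divff // mulr1.
  under eq_bigr do rewrite expr1n.
  by rewrite sumr_const card_ord mulVf.
move=> w d y [sy hy] wd; rewrite (lE _ _ hy).
have [e|wv] := eqVneq w v; last by rewrite (lw _ _ sy wv) mulr0.
have [->|y0] := eqVneq y 0; first by rewrite linear0 mulr0.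
have dc : d / c != 1.
  by apply: contra wd => /eqP dc; rewrite e xpair_eqE eqxx -[d](divfK c0) dc mul1r eqxx.
have : (d / c - 1) * \sum_(j < m) (d / c) ^+ j = 0.
  by rewrite -subrX1 expr_div_n cm (eigp_root hy y0) divr1 subrr.
by move/eqP; rewrite mulf_eq0 subr_eq0 (negPf dc) /= => /eqP->; rewrite mulr0 mul0r.
Qed.
End Weights.

(** * Reflections *)

Section Reflections.
Variables (K : fieldType) (A : fhopfType K) (gT : finGroupType).
Variables (phi : grouplike_map A gT) (N : nat).
Hypothesis char0 : [pchar K] =i pred0.
Hypothesis FN : fil phi N = fullv.
Variables (h s : gT) (t : nat).
Hypothesis t_ge3 : (3 <= t)%N.
Hypothesis oh : #[h]%g = (4 * t)%N.
Hypothesis ss : (s * s)%g = 1%g.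
Hypothesis shs : (s * h * s)%g = (h^-1)%g.
Variable q : K.
Hypotheses (qt : q ^+ t = 1) (q2 : q ^+ 2 != 1).
Implicit Types (l : dual K A) (x y : A) (u v w : gT) (i j k : nat) (e c : K).
Local Notation J := (inJ phi).
Local Notation X := (Xop phi N).
Local Notation G := (Gop phi N).
Local Notation D := (dop phi N).

Let hm : (h ^+ (4 * t))%g = 1%g. Proof. by rewrite -oh expg_order. Qed.

Lemma s_expg k : (s * h ^+ k)%g = (h ^- k * s)%g.
Proof.
have sV : (s^-1 = s)%g by apply/eqP; rewrite eq_invg_mul ss.
have sh : (s * h)%g = (h^-1 * s)%g by rewrite -shs -!mulgA ss mulg1.
elim: k => [|k IH]; first by rewrite !expg0 invg1 mul1g mulg1.
by rewrite {1}expgSr mulgA IH -mulgA sh mulgA expgS invMg.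
Qed.

Definition rf k : gT := (h ^+ k * s * h ^- k)%g.

Lemma rfE k : rf k = (h ^+ (k + k) * s)%g.
Proof.
have e : (s * h ^- k = h ^+ k * s)%g.
  by apply: (mulgI (h ^- k)%g); rewrite mulgA mulKg -s_expg mulgK.
by rewrite /rf -mulgA e mulgA expgD.
Qed.

Lemma rf_act i j k : (k + j = i + i %[mod 4 * t])%N ->
  (rf i * h ^+ j = h ^+ k * s)%g.
Proof.
move=> e; rewrite rfE -mulgA s_expg mulgA; congr (_ * _)%g.
apply: (mulIg (h ^+ j)%g); rewrite mulgKV -expgD.
by rewrite -(expg_mod (i + i) hm) -e expg_mod ?hm.
Qed.

Lemma rf_eq i j : (rf i == rf j) = (i + i == j + j %[mod 4 * t]).
Proof. by rewrite !rfE (inj_eq (mulIg _)) eq_expg_mod_order oh. Qed.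

Variables (x0 : A) (e : K).
Hypothesis sk0 : skewp phi s x0.
Hypothesis x0G : x0 \notin kG phi.
Hypothesis Asx0 : Ad phi s x0 = - x0.
Hypothesis Azx0 : Ad phi (h ^+ (2 * t))%g x0 = e *: x0.
Hypothesis e2 : e ^+ 2 = 1.

(* x_k is skew-primitive for the reflection [rf k] = h^2k s. The sums [ra] and *)
(* [rb] below have h^2-weights q^-1 and q, where q is a t-th root of unity;    *)
(* q ^+ 2 != 1, the condition of Section Affine, needs t >= 3.                 *)
Definition xs k := Ad phi (h ^+ k)%g x0.
Definition XX k := X (xs k).

Lemma skewp_xs k : skewp phi (rf k) (xs k).
Proof. exact: skewp_Ad. Qed.

Lemma Ad_inv_kG u x : (Ad phi u x \in kG phi) = (x \in kG phi).
Proof.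
apply/idP/idP; last exact: Ad_kG.
by move=> /(Ad_kG u^-1%g); rewrite -AdM mulVg Ad1.
Qed.

Lemma xs_kG k : xs k \notin kG phi.
Proof. by rewrite Ad_inv_kG. Qed.

Lemma xs_period k : xs (k + 2 * t) = e *: xs k.
Proof. by rewrite /xs expgD AdM Azx0 linearZ. Qed.

Lemma Ad_rf i j k : (k + j = i + i %[mod 4 * t])%N -> Ad phi (rf i) (xs j) = - xs k.
Proof. by move=> eq; rewrite /xs -AdM (rf_act eq) AdM Asx0 linearN. Qed.

Lemma Xs_period k y : XX (k + 2 * t) y = e *: XX k y.
Proof.
by rewrite /XX xs_period -[_ *: xs k]addr0 (Xop_comb FN) (Xop_kG FN _ (mem0v _)) addr0.
Qed.

Lemma XN x y : X (- x) y = - X x y.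
Proof.
by rewrite -scaleN1r -[_ *: x]addr0 (Xop_comb FN) (Xop_kG FN _ (mem0v _)) scaleN1r addr0.
Qed.

Lemma g_X i j k y : (k + j = i + i %[mod 4 * t])%N ->
  G (rf i) (XX j y) = - XX k (G (rf i) y).
Proof. by move=> eq; rewrite (Gop_X FN _ _ (skewp_xs j)) (Ad_rf eq) XN. Qed.

Lemma rf_period : rf (2 * t) = rf 0.
Proof. by apply/eqP; rewrite rf_eq -mulnDl modnn addn0 mod0n. Qed.

Lemma h2_X k y : G (h ^+ 2)%g (XX k y) = XX k.+2 (G (h ^+ 2)%g y).
Proof. by rewrite (Gop_X FN _ _ (skewp_xs k)) /XX /xs -AdM -expgD. Qed.

Lemma dX l j y : J l -> D l (XX j y) = XX j (D l y) + (l (xs j) : K) *: G (rf j) y.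
Proof. by move=> lJ; apply: (dop_X FN _ lJ (skewp_xs j)). Qed.

Lemma dXX l i j y : J l -> D l (XX i (XX j y)) =
  XX i (XX j (D l y)) + (l (xs j) : K) *: XX i (G (rf j) y)
    + (l (xs i) : K) *: G (rf i) (XX j y).
Proof. by move=> lJ; rewrite !dX // linearD linearZ. Qed.

(** Since rf (k+1) rf k = h^2, every product in [pa] has type h^2 and every product in [pb] has type
    h^-2. Consecutive products are added in pairs so that the derivatives with respect to the
    odd-indexed vector cancel, as in [d_pa] and [d_pb]. *)
Definition pa j : 'End(A) := ((XX j.*2.+1 \o XX j.*2) + (XX j.*2.+2 \o XX j.*2.+1))%VF.
Definition pb j : 'End(A) := ((XX j.*2 \o XX j.*2.+1) + (XX j.*2.+1 \o XX j.*2.+2))%VF.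
Definition ra : 'End(A) := \sum_(j < t) q ^+ j *: pa j.
Definition rb : 'End(A) := \sum_(j < t) q ^- j *: pb j.

Lemma paE j y : pa j y = XX j.*2.+1 (XX j.*2 y) + XX j.*2.+2 (XX j.*2.+1 y).
Proof. by rewrite add_lfunE !comp_lfunE. Qed.

Lemma pbE j y : pb j y = XX j.*2 (XX j.*2.+1 y) + XX j.*2.+1 (XX j.*2.+2 y).
Proof. by rewrite add_lfunE !comp_lfunE. Qed.

Lemma raE y : ra y = \sum_(j < t) q ^+ j *: pa j y.
Proof. by rewrite sum_lfunE; apply: eq_bigr => j _; rewrite scale_lfunE. Qed.

Lemma rbE y : rb y = \sum_(j < t) q ^- j *: pb j y.
Proof. by rewrite sum_lfunE; apply: eq_bigr => j _; rewrite scale_lfunE. Qed.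

Lemma Xs_period2 i j y : XX (i + 2 * t) (XX (j + 2 * t) y) = XX i (XX j y).
Proof.
rewrite (Xs_period j) [XX _ (_ *: _)]linearZ /= (Xs_period i) scalerA -expr2 e2.
exact: scale1r.
Qed.

Lemma pa_period y : pa t y = pa 0 y.
Proof.
rewrite !paE double0 -mul2n.
by have := congr2 +%R (Xs_period2 1 0 y) (Xs_period2 2 1 y).
Qed.

Lemma pb_period y : pb t y = pb 0 y.
Proof.
rewrite !pbE double0 -mul2n.
by have := congr2 +%R (Xs_period2 0 1 y) (Xs_period2 1 2 y).
Qed.

Lemma q0 : q != 0.
Proof.
apply/eqP => q0; move: qt; rewrite q0 expr0n; case: (t) t_ge3 => // k _ /eqP.
by rewrite eq_sym oner_eq0.
Qed.

Lemma h2_ra y : G (h ^+ 2)%g (ra y) = q^-1 *: ra (G (h ^+ 2)%g y).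
Proof.
set y' := G _ y; rewrite !raE linear_sum scaler_sumr.
rewrite -(sum_shift (P := fun j => q^-1 *: (q ^+ j *: pa j y'))); last first.
  by rewrite qt pa_period.
by apply: eq_bigr => j _; rewrite linearZ /= !paE linearD /= !h2_X scalerA exprS mulKf ?q0.
Qed.

Lemma h2_rb y : G (h ^+ 2)%g (rb y) = q *: rb (G (h ^+ 2)%g y).
Proof.
set y' := G _ y; rewrite !rbE linear_sum scaler_sumr.
rewrite -(sum_shift (P := fun j => q *: (q ^- j *: pb j y'))); last first.
  by rewrite qt pb_period invr1.
apply: eq_bigr => j _; rewrite linearZ /= !pbE linearD /= !h2_X scalerA exprS.
by rewrite invfM mulVKf ?q0 // -!doubleS.
Qed.

Lemma xs_mod k : xs (k + 4 * t) = xs k.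
Proof. by rewrite /xs expgD hm mulg1. Qed.

Lemma d_pa l j y : J l -> D l (pa j y) = pa j (D l y) +
  ((l (xs j.*2) : K) *: XX j.*2.+1 (G (rf j.*2) y)
   - (l (xs j.+1.*2) : K) *: XX j.+1.*2.+1 (G (rf j.+1.*2) y)).
Proof.
move=> lJ; rewrite !paE linearD /= !dXX // (@g_X j.*2.+1 j.*2 j.*2.+2); last first.
  by rewrite addSnnS addSnnS.
rewrite (@g_X j.*2.+2 j.*2.+1 j.+1.*2.+1); last by rewrite doubleS addSnnS.
have e3 (a b c d f : A) : a + b - c + (d + c - f) = a + d + (b - f).
  rewrite addrACA [a + b + _]addrACA -addrA; congr (_ + _).
  by rewrite addrA addrK.
by rewrite !scalerN -doubleS; exact: e3.
Qed.

(** The summand [(4 * t).-1] in an index stands for -1 modulo the order of [h]. *)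
Lemma d_pb l j y : J l -> D l (pb j y) = pb j (D l y) +
  ((l (xs j.+1.*2) : K) *: XX (j.+1.*2 + (4 * t).-1) (G (rf j.+1.*2) y)
  - (l (xs j.*2) : K) *: XX (j.*2 + (4 * t).-1) (G (rf j.*2) y)).
Proof.
have t0 : (0 < 4 * t)%N by rewrite muln_gt0 /= (leq_trans _ t_ge3).
move=> lJ; rewrite !pbE linearD /= !dXX // (@g_X j.*2.+1 j.*2.+2 j.*2); last first.
  by rewrite !addnS addSn.
rewrite (@g_X j.*2 j.*2.+1 (j.*2 + (4 * t).-1)); last first.
  by rewrite addnAC -addnA addSnnS prednK // addnA modnDr.
have -> : XX (j.+1.*2 + (4 * t).-1) (G (rf j.+1.*2) y) = XX j.*2.+1 (G (rf j.+1.*2) y).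
  rewrite /XX -(xs_mod j.*2.+1) doubleS; congr (X (xs _) _).
  by rewrite addSnnS prednK.
have e3 (a b c d f : A) : a + b - c + (d + f - b) = a + d + (f - c).
  rewrite addrACA [a + b + _]addrACA -addrA; congr (_ + _).
  by rewrite [- c - b]addrC [b + f]addrC addrA addrK.
by rewrite !scalerN -doubleS; exact: e3.
Qed.

(** Cyclic summation by parts; it is the source of the constants 1 - q^-1 and q - 1 in [d_ra] and
    [d_rb]. *)
Lemma sum_diff (T : nat -> A) c : c ^+ t = 1 -> T t = T 0%N ->
  \sum_(j < t) c ^+ j *: (T j - T j.+1) = (1 - c^-1) *: \sum_(j < t) c ^+ j *: T j.
Proof.
move=> ct Tt; have c0 : c != 0.
  apply/eqP => c0; move: ct; rewrite c0 expr0n; case: (t) t_ge3 => // k _ /eqP.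
  by rewrite eq_sym oner_eq0.
under eq_bigr do rewrite scalerBr.
rewrite sumrB scalerBl scale1r; congr (_ - _).
rewrite scaler_sumr -(sum_shift (P := fun j => c^-1 *: (c ^+ j *: T j))); last first.
  by rewrite ct Tt.
by apply: eq_bigr => j _; rewrite scalerA exprS mulKf.
Qed.

Lemma d_ra l y : J l -> D l (ra y) = ra (D l y) +
  (1 - q^-1) *: \sum_(j < t) q ^+ j *: ((l (xs j.*2) : K) *: XX j.*2.+1 (G (rf j.*2) y)).
Proof.
move=> lJ.
rewrite -(sum_diff (T := fun j => (l (xs j.*2) : K) *: XX j.*2.+1 (G (rf j.*2) y)) qt).
  rewrite !raE linear_sum -big_split; apply: eq_bigr => j _ /=.
  by rewrite linearZ /= d_pa // scalerDr.
(* The term of index [t] equals that of index 0: the vector and the value of [l] each contribute a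
   factor [e], and [e ^+ 2 = 1]. *)
rewrite /= double0 -mul2n -[(2 * t)%N]add0n -addSn rf_period.
rewrite Xs_period xs_period.
have -> : l (e *: xs 0) = e * l (xs 0) by rewrite linearZ.
by rewrite scalerA mulrC mulrA -expr2 e2 mul1r.
Qed.

Lemma d_rb l y : J l -> D l (rb y) = rb (D l y) +
  (q - 1) *: \sum_(j < t) q ^- j *: ((l (xs j.*2) : K) *: XX (j.*2 + (4 * t).-1) (G (rf j.*2) y)).
Proof.
move=> lJ; have qVt : q^-1 ^+ t = 1 by rewrite exprVn qt invr1.
rewrite -opprB scaleNr -[in 1 - q](invrK q).
under [in RHS]eq_bigr do rewrite -exprVn.
rewrite -(sum_diff (T := fun j => (l (xs j.*2) : K) *: XX (j.*2 + (4 * t).-1) (G (rf j.*2) y)) qVt).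
  rewrite !rbE linear_sum -sumrB; apply: eq_bigr => j _ /=.
  by rewrite linearZ /= d_pb // scalerDr exprVn -[in RHS]scalerN opprB.
rewrite /= double0 -mul2n -[(2 * t)%N]add0n -addnA [(2 * t + _)%N]addnC addnA rf_period.
rewrite Xs_period xs_period.
have -> : l (e *: xs 0) = e * l (xs 0) by rewrite linearZ.
by rewrite scalerA mulrC mulrA -expr2 e2 mul1r.
Qed.

(** The subspace [M] of Section Affine. It is stable under [ra] and [rb] because their derivatives
    involve [l] only at even-indexed vectors. *)
Definition odd_killed y := forall l, J l -> (forall k, l (xs k.*2) = 0) -> D l y = 0.

Lemma odd_killed_ra y : odd_killed y -> odd_killed (ra y).
Proof.
move=> My l lJ lk; rewrite d_ra // My // linear0 add0r big1 ?scaler0 // => j _.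
by rewrite lk scale0r scaler0.
Qed.

Lemma odd_killed_rb y : odd_killed y -> odd_killed (rb y).
Proof.
move=> My l lJ lk; rewrite d_rb // My // linear0 add0r big1 ?scaler0 // => j _.
by rewrite lk scale0r scaler0.
Qed.

Lemma odd_killed_h2 y : odd_killed y -> odd_killed (G (h ^+ 2)%g y).
Proof.
move=> My l lJ lk; rewrite (dop_G FN) // My ?linear0 //; first exact: inJ_Ad.
move=> k; rewrite comp_lfunE lfunE /= /xs -AdM -expgD; exact: (lk k.+1).
Qed.

Lemma odd_killed_rf i y : odd_killed y -> odd_killed (G (rf i) y).
Proof.
move=> My l lJ lk; rewrite (dop_G FN) // My ?linear0 //; first exact: inJ_Ad.
move=> k; rewrite comp_lfunE lfunE /= (@Ad_rf i k.*2 (i + (4 * t).-1 * k).*2).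
  by rewrite linearN /= lk oppr0.
rewrite doubleD -addnA -doubleD -{2}[k]mul1n -mulnDl addn1 prednK.
  by rewrite addnC -mul2n [(4 * t * k)%N]mulnC mulnA modnMDl addnn.
by rewrite muln_gt0 /= (leq_trans _ t_ge3).
Qed.

Lemma rf_neq i j : (i + i < 4 * t)%N -> (j + j < 4 * t)%N -> i != j -> rf i != rf j.
Proof.
move=> it jt ij; rewrite rf_eq !modn_small //; apply: contra ij => /eqP eij.
by rewrite -(doubleK i) -addnn eij addnn doubleK.
Qed.

Lemma xs_functional i : exists l, [/\ J l, l (xs i) = 1
  & forall j, rf j != rf i -> l (xs j) = 0].
Proof.
have [l [lJ l1 l0]] := left_functional (skewp_xs i) (xs_kG i).
by exists l; split=> // j; apply: l0; apply: skewp_xs.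
Qed.

(** Section Affine with g = h^2, F1 = D l1 D l0 and F2 = D l1 D l2. Removing x_0 leaves x_1 from
    [ra] but x_(-1) from [rb]; removing x_2 leaves x_3 from [ra] but x_1 from [rb]. Then [l1] keeps
    only x_1, and rf 1 rf 0 = h^2, rf 1 rf 2 = h^-2 give [g] and [gi]. *)
Lemma reflection_absurd : False.
Proof.
have t0 : (0 < 4 * t)%N by rewrite muln_gt0 /= (leq_trans _ t_ge3).
have [l0 [J0 l00 l0j]] := xs_functional 0.
have [l1 [J1 l11 l1j]] := xs_functional 1.
have [l2 [J2 l22 l2j]] := xs_functional 2.
have l1e k : l1 (xs k.*2) = 0.
  apply: l1j; rewrite rf_eq; apply/eqP => /(congr1 (fun i => i %% 4)%N).
  by rewrite !modn_dvdm ?dvdn_mulr // addnn -!muln2 -mulnA modnMl.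
have l0e (j : 'I_t) : j != 0%N :> nat -> l0 (xs j.*2) = 0.
  move=> j0; apply: l0j; apply: rf_neq => //; last by rewrite double_eq0.
  by rewrite addnn -!muln2 -mulnA mulnC ltn_pmul2l.
have l2e (j : 'I_t) : j != 1%N :> nat -> l2 (xs j.*2) = 0.
  move=> j1; apply: l2j; apply: rf_neq.
  - by rewrite addnn -!muln2 -mulnA mulnC ltn_pmul2l.
  - by apply: leq_trans (leq_mul (leqnn 4) t_ge3).
  by rewrite -(inj_eq double_inj (j : nat) 1) in j1.
have t_gt0 : (0 < t)%N by apply: leq_trans t_ge3.
have t_gt1 : (1 < t)%N by apply: leq_trans t_ge3.
have d0a y : D l0 (ra y) = ra (D l0 y) + (1 - q^-1) *: XX 1 (G (rf 0) y).
  rewrite d_ra // (bigD1 (Ordinal t_gt0)) //= double0 l00 expr0 !scale1r big1 ?addr0 // => j j0.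
  by rewrite l0e // scale0r scaler0.
have d0b y : D l0 (rb y) = rb (D l0 y) + (q - 1) *: XX (4 * t).-1 (G (rf 0) y).
  rewrite d_rb // (bigD1 (Ordinal t_gt0)) //= double0 l00 expr0 invr1 !scale1r.
  rewrite big1 ?addr0 ?add0n // => j j0.
  by rewrite l0e // scale0r scaler0.
have d2a y : D l2 (ra y) = ra (D l2 y) + (1 - q^-1) *: (q *: XX 3 (G (rf 2) y)).
  rewrite d_ra // (bigD1 (Ordinal t_gt1)) //= l22 expr1 !scale1r big1 ?addr0 // => j j0.
  by rewrite l2e // scale0r scaler0.
have d2b y : D l2 (rb y) = rb (D l2 y) + (q - 1) *: (q^-1 *: XX 1 (G (rf 2) y)).
  have -> : XX 1 (G (rf 2) y) = XX (2 + (4 * t).-1) (G (rf 2) y).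
    by rewrite /XX -(xs_mod 1); congr (X (xs _) _); rewrite [RHS]addSnnS prednK.
  rewrite d_rb // (bigD1 (Ordinal t_gt1)) //= l22 expr1 !scale1r big1 ?addr0 // => j j0.
  by rewrite l2e // scale0r scaler0.
have d1a y : D l1 (ra y) = ra (D l1 y).
  by rewrite d_ra // big1 ?scaler0 ?addr0 // => j _; rewrite l1e scale0r scaler0.
have d1b y : D l1 (rb y) = rb (D l1 y).
  by rewrite d_rb // big1 ?scaler0 ?addr0 // => j _; rewrite l1e scale0r scaler0.
have d1X i k y : odd_killed y -> D l1 (XX k (G (rf i) y)) = (l1 (xs k) : K) *: G (rf k * rf i)%g y.
  move=> My; rewrite dX // (odd_killed_rf i My) // linear0 add0r.
  by rewrite (Gop_mul FN).
have e10 : (rf 1 * rf 0)%g = (h ^+ 2)%g.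
  by rewrite !rfE expg0 mul1g -mulgA ss mulg1.
have e12 : (rf 1 * rf 2)%g = (h ^- 2)%g.
  rewrite !rfE -mulgA (mulgA s) s_expg -!mulgA ss mulg1.
  by apply: (mulIg (h ^+ (2 + 2))%g); rewrite mulgA mulgKV expgD mulKg.
have t12 : (12 <= 4 * t)%N by apply: leq_mul (leqnn 4) t_ge3.
have l13 : l1 (xs 3) = 0.
  by apply: l1j; apply: rf_neq => //; apply: leq_trans t12.
have l1m : l1 (xs (4 * t).-1) = 0.
  apply: l1j; rewrite rf_eq -(eqn_modDr 2).
  have -> : ((4 * t).-1 + (4 * t).-1 + 2 = 4 * t + 4 * t)%N.
    by rewrite addn2 -addSn -addnS prednK.
  by rewrite modnDl modnn modn_small // (leq_trans _ t12).
have [n nz] : exists n, iter n (affz ra rb q) 1 = 0.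
  have raise2 i j (k : int) y : deg_gt (fil phi) N k y ->
      deg_gt (fil phi) N (k + 1) (XX i (XX j y)).
    move=> hy; have h1 : k + 1 <= k + 1 + 1 by rewrite lerDl.
    by apply: (deg_gt_le h1); do 2!apply: (deg_gt_X FN).
  have deg_sum (c : nat -> K) (P : nat -> A -> A) (k : int) y :
      (forall j, deg_gt (fil phi) N k (P j y)) -> deg_gt (fil phi) N k (\sum_(j < t) c j *: P j y).
    move=> hP i ik; rewrite linear_sum big1 // => j _.
    by rewrite linearZ /= hP // scaler0.
  have hadd (k : int) y y' : deg_gt (fil phi) N k y -> deg_gt (fil phi) N k y' ->
      deg_gt (fil phi) N k (y + y').
    by move=> h1 h2; rewrite -[y]scale1r; apply: deg_gtP.
  have ha (k : int) y : deg_gt (fil phi) N k y -> deg_gt (fil phi) N (k + 1) (ra y).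
    move=> hy; rewrite raE; apply: (deg_sum (fun j => q ^+ j) (fun j => pa j : A -> A)) => j.
    by rewrite paE; apply: (hadd); apply: raise2.
  have hb (k : int) y : deg_gt (fil phi) N k y -> deg_gt (fil phi) N (k + 1) (rb y).
    move=> hy; rewrite rbE; apply: (deg_sum (fun j => q ^- j) (fun j => pb j : A -> A)) => j.
    by rewrite pbE; apply: (hadd); apply: raise2.
  exact: (affz_nilpotent FN).
have q1 : 1 - q^-1 != 0.
  rewrite subr_eq0; apply: contra q2 => /eqP q1.
  by rewrite -[q]invrK -q1 invr1 expr1n.
have M1 : odd_killed 1 by move=> l lJ _; apply: dop_1.
have := @affine_not_nilpotent _ _ char0 ra rb (D l1 \o D l0)%VF (D l1 \o D l2)%VF
  (G (h ^+ 2)%g) (G (h ^- 2)%g) odd_killed q (1 - q^-1) (1 - q^-1) 1.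
move=> nn; suff /negP : iter n (affz ra rb q) 1 != 0 by apply; rewrite nz.
apply: nn => //; rewrite ?one_neq0 ?q0 //.
- by move=> y; rewrite /= (Gop_mul FN) mulVg (Gop1 FN).
- by move=> y; rewrite /= (Gop_mul FN) mulgV (Gop1 FN).
- by move=> c x y hx hy l lJ lk; rewrite linearP /= hx ?hy // scaler0 addr0.
- exact: odd_killed_ra.
- exact: odd_killed_rb.
- exact: odd_killed_h2.
- exact: h2_ra.
- exact: h2_rb.
- move=> y My; rewrite /= !comp_lfunE d0a linearD /= d1a linearZ /= d1X // l11 e10.
  by rewrite scale1r.
- move=> y My; rewrite /= !comp_lfunE d0b linearD /= d1b linearZ /= d1X // l1m.
  by rewrite scale0r scaler0 addr0.
- move=> y My; rewrite /= !comp_lfunE d2a linearD /= d1a !linearZ /= d1X // l13.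
  by rewrite scale0r !scaler0 addr0.
- move=> y My; rewrite /= !comp_lfunE d2b linearD /= d1b !linearZ /= d1X // l11 e12.
  by rewrite scale1r scalerA mulrBl mul1r mulfV ?q0.
- by rewrite /= comp_lfunE dop_1 // linear0.
by rewrite /= comp_lfunE -(phi1 phi) (Gop_phi FN) (dop_phi FN) // linear0.
Qed.
End Reflections.

(* 2-adic obstruction: aj and bi are the roots of an integral quadratic whose  *)
(* discriminant is (2t)^2 times ga^2 - 4 al be, which is 5 mod 8.              *)
Lemma odd_triple_absurd (t a b i j al be ga : nat) : (0 < t)%N ->
    odd al -> odd be -> odd ga ->
    (a * i = 2 * t * al)%N -> (b * j = 2 * t * be)%N ->
    (a * j + b * i = 2 * t * ga)%N -> False.
Proof.
move=> t0 oal obe oga e1 e2 e3.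
have e4 : ((a * j) * (b * i) = (2 * t) ^ 2 * (al * be))%N.
  by rewrite mulnACA [(j * i)%N]mulnC mulnACA e1 e2 mulnACA -mulnn.
move: (a * j)%N (b * i)%N e3 e4 => u v {e1 e2}.
wlog vu : u v / (v <= u)%N => [hw e3 e4|].
  have [vu|/ltnW uv] := leqP v u; first exact: (hw u v).
  by apply: (hw v u) => //; rewrite (addnC, mulnC).
have [x ->] : exists x, u = (v + x)%N by exists (u - v)%N; rewrite subnKC.
move=> e3 e4 {vu u}.
have e5 : (x ^ 2 + (2 * t) ^ 2 * (4 * (al * be)) = (2 * t) ^ 2 * ga ^ 2)%N.
  by rewrite -expnMn -e3 mulnCA -e4; move: x v {e3 e4} => x v; nia.
have /dvdnP[k xk] : (2 * t %| x)%N.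
  rewrite -(@dvdn_pexp2r _ _ 2) // -(dvdn_addl _ (dvdn_mulr (4 * (al * be)) (dvdnn ((2 * t) ^ 2)))).
  by rewrite e5 dvdn_mulr.
have {}e5 : (k ^ 2 + 4 * (al * be) = ga ^ 2)%N.
  apply/eqP; rewrite -(@eqn_pmul2l ((2 * t) ^ 2)) ?expn_gt0 ?muln_gt0 ?t0 //.
  by rewrite mulnDr -e5 xk [((k * _) ^ 2)%N]expnMn [(k ^ 2 * _)%N]mulnC.
have ok : odd k by move: (congr1 odd e5); rewrite oddD !oddX !oddM oga /= addbF => ->.
have e6 : (k./2 * k./2.+1 + al * be = ga./2 * ga./2.+1)%N; last first.
  by move: (congr1 odd e6); rewrite oddD !oddM /= oal obe !andbN.
move: e5; rewrite -{1}(odd_double_half k) -{1}(odd_double_half ga) ok oga.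
rewrite -!mul2n; move: (k./2) (ga./2) (al * be)%N; clear; move=> x y z.
by lia.
Qed.

Section Rotations.
Variables (K : fieldType) (A : fhopfType K) (gT : finGroupType).
Variables (phi : grouplike_map A gT) (N : nat).
Hypothesis char0 : [pchar K] =i pred0.
Hypothesis FN : fil phi N = fullv.
Variables (h s : gT) (t : nat).
Hypothesis t_ge3 : (3 <= t)%N.
Hypothesis oh : #[h]%g = (4 * t)%N.
Hypothesis ss : (s * s)%g = 1%g.
Hypothesis shs : (s * h * s)%g = (h^-1)%g.
Hypothesis gen : forall u, exists i, u = (h ^+ i)%g \/ u = (h ^+ i * s)%g.
Variable om : K.
Hypothesis om_prim : (4 * t).-primitive_root om.
Implicit Types (l : dual K A) (x y : A) (u v w : gT) (i j k : nat) (c d : K).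
Local Notation J := (inJ phi).
Local Notation X := (Xop phi N).
Local Notation G := (Gop phi N).
Local Notation D := (dop phi N).

Let m := (4 * t)%N.
Let hm' : (h ^+ m)%g = 1%g. Proof. by rewrite /m -oh expg_order. Qed.

(** The part of [x] fixed by r is excluded by [skewp_trivial_action]. On the rest r acts by -1, and
    it splits further under the involution z = h^(2t), which commutes with r; this gives the two
    signs of [e] in [reflection_absurd]. *)
Lemma no_reflection_gen (r : gT) x : (r * r)%g = 1%g -> (r * h * r)%g = (h^-1)%g ->
  skewp phi r x -> x \in kG phi.
Proof.
move=> rr rhr sx; apply/negPn/negP => xG.
have two0 : 2%:R != 0 :> K by apply: natS_neq0.
have half (a b : A) : a + b \in kG phi -> a - b \in kG phi -> a \in kG phi.
  move=> h1 h2; have := memvD h1 h2; rewrite addrACA subrr addr0 -mulr2n -scaler_nat.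
  by rewrite rpredZeq (negPf two0).
have rV : (r^-1 = r)%g by apply/eqP; rewrite eq_invg_mul rr.
have skr y : skewp phi r y -> skewp phi r (Ad phi r y).
  by move=> /(skewp_Ad r); rewrite mulgK.
have AdrK y : Ad phi r (Ad phi r y) = y by rewrite -AdM rr Ad1.
have skD c (y y' : A) : skewp phi r y -> skewp phi r y' -> skewp phi r (y + c *: y').
  by move=> h1 h2; rewrite addrC; apply: skewpP.
pose y := x - Ad phi r x.
have sy : skewp phi r y by rewrite /y -scaleN1r; apply: skD => //; apply: skr.
have yG : y \notin kG phi.
  apply: contra xG => yG; apply: (half x (Ad phi r x)) => //.
  apply: (skewp_trivial_action char0 FN (v := r)).
    by rewrite -[Ad _ _ _]scale1r; apply: skD => //; apply: skr.
  by rewrite linearD /= AdrK addrC.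
have Ay : Ad phi r y = - y by rewrite /y linearB /= AdrK opprB.
pose z := (h ^+ (2 * t))%g.
have zz : (z * z)%g = 1%g by rewrite -expgD -mulnDl hm'.
have rz : (r * z = z * r)%g.
  rewrite (s_expg rr rhr); congr (_ * _)%g.
  by apply/eqP; rewrite eq_invg_mul zz.
have skz y' : skewp phi r y' -> skewp phi r (Ad phi z y').
  by move=> /(skewp_Ad z); rewrite -rz mulgK.
have AdzK y' : Ad phi z (Ad phi z y') = y' by rewrite -AdM zz Ad1.
have Arz y' : Ad phi r (Ad phi z y') = Ad phi z (Ad phi r y') by rewrite -!AdM rz.
(* [om ^+ 4] is a primitive t-th root of unity, and [t_ge3] keeps its square away from 1. *)
have qp : om ^+ 4 ^+ t = 1 by rewrite -exprM (prim_expr_order om_prim).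
have q2 : om ^+ 4 ^+ 2 != 1.
  rewrite -exprM -(prim_order_dvd om_prim); apply/negP => dv.
  have := @dvdn_leq _ 8 isT dv.
  by rewrite -[8%N]/(4 * 2)%N leq_pmul2l // leqNgt t_ge3.
have absurd e x0 : skewp phi r x0 -> Ad phi r x0 = - x0 -> Ad phi z x0 = e *: x0 ->
    e ^+ 2 = 1 -> x0 \in kG phi.
  move=> s0 r0 z0 e2; apply/negPn/negP => x0G.
  exact: (reflection_absurd char0 FN t_ge3 oh rr rhr qp q2 s0 x0G r0 z0 e2).
clearbody y; case/negP: yG; apply: (half y (Ad phi z y)).
- apply: (absurd 1); last by rewrite expr1n.
  + by rewrite -[Ad _ z _]scale1r; apply: skD => //; apply: skz.
  + by rewrite linearD /= Arz Ay linearN opprD.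
  by rewrite linearD /= AdzK scale1r addrC.
apply: (absurd (-1)); last by rewrite sqrrN expr1n.
- by rewrite -scaleN1r; apply: skD => //; apply: skz.
- by rewrite linearB /= Arz Ay linearN opprB opprK addrC.
by rewrite linearB /= AdzK scaleN1r opprB.
Qed.

Lemma no_reflection v x : skewp phi v x -> x \notin kG phi -> exists i, v = (h ^+ i)%g.
Proof.
move=> sx xG; have [i [->|e]] := gen v; first by exists i.
case/negP: xG; apply: (no_reflection_gen (r := v)) => //; rewrite e.
  by rewrite -mulgA (mulgA s) (s_expg ss shs) -mulgA ss mulg1 mulgV.
have -> : (h ^+ i * s * h * (h ^+ i * s) = h ^+ i * (s * h ^+ i.+1) * s)%g.
  by rewrite expgS !mulgA.
by rewrite (s_expg ss shs) -!mulgA ss mulg1 expgS invMg mulgA mulgV mul1g.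
Qed.
End Rotations.

(** * Rotations *)

Section Braided.
Variables (K : fieldType) (A : fhopfType K) (gT : finGroupType).
Variables (phi : grouplike_map A gT) (N : nat).
Hypothesis FN : fil phi N = fullv.
Implicit Types (l : dual K A) (x y : A) (u v w : gT) (i j k : nat) (c d : K).
Local Notation J := (inJ phi).
Local Notation X := (Xop phi N).
Local Notation G := (Gop phi N).
Local Notation D := (dop phi N).

Lemma X_scale c x y : X (c *: x) y = c *: X x y.
Proof. by rewrite -[c *: x]addr0 (Xop_comb FN) (Xop_kG FN _ (mem0v _)) addr0. Qed.

Lemma G_X_eig u v c x y : skewp phi v x -> Ad phi u x = c *: x ->
  G u (X x y) = c *: X x (G u y).
Proof. by move=> sx ux; rewrite (Gop_X FN _ _ sx) ux X_scale. Qed.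

Definition br c x y : 'End(A) := ((X x \o X y) - c *: (X y \o X x))%VF.

Lemma brE c x y a : br c x y a = X x (X y a) - c *: X y (X x a).
Proof. by rewrite add_lfunE opp_lfunE scale_lfunE !comp_lfunE. Qed.

(** With c = q_xy the terms carrying [l x] cancel; those carrying [l y] keep the factor 1 - q_xy
    q_yx. *)
Lemma D_br l v w c d x y a : J l -> skewp phi v x -> skewp phi w y ->
    Ad phi v y = c *: y -> Ad phi w x = d *: x ->
  D l (br c x y a) = br c x y (D l a) + ((1 - c * d) * l y) *: X x (G w a).
Proof.
move=> lJ sx sy vy wx; have e1 : D l (X x (X y a)) =
    X x (X y (D l a)) + (l y : K) *: X x (G w a) + (l x * c) *: X y (G v a).
  by rewrite (dop_X FN _ lJ sx) (dop_X FN _ lJ sy) linearD linearZ /= (G_X_eig _ sy vy) scalerA.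
have e2 : D l (X y (X x a)) =
    X y (X x (D l a)) + (l x : K) *: X y (G v a) + (l y * d) *: X x (G w a).
  by rewrite (dop_X FN _ lJ sy) (dop_X FN _ lJ sx) linearD linearZ /= (G_X_eig _ sx wx) scalerA.
rewrite !brE linearB linearZ /= e1 e2 !scalerDr !scalerA.
set p := X x (X y _); set p' := X y (X x _); set b := X x (G w a); set b' := X y (G v a).
rewrite [l x * c]mulrC mulrBl mul1r scalerBl mulrCA [l y * _]mulrC.
have e (r1 r2 r3 r4 r5 : A) : r1 + r2 + r3 - (r4 + r3 + r5) = r1 - r4 + (r2 - r5).
  by rewrite [r4 + _ + _]addrAC opprD [X in _ + X = _]addrC addrA addrK opprD addrACA.
exact: e.
Qed.

Lemma deg_gt_br c x y (k : int) a : deg_gt (fil phi) N k a ->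
  deg_gt (fil phi) N (k + 1) (br c x y a).
Proof.
move=> ha; rewrite brE [X in deg_gt _ _ _ X]addrC -scaleNr.
have h1 : k + 1 <= k + 1 + 1 by rewrite lerDl.
by apply: deg_gtP; apply: (deg_gt_le h1); do 2!apply: (deg_gt_X FN).
Qed.

Lemma G_br u c d e x y v w a : skewp phi v x -> skewp phi w y ->
    Ad phi u x = d *: x -> Ad phi u y = e *: y ->
  G u (br c x y a) = (d * e) *: br c x y (G u a).
Proof.
move=> sx sy ux uy.
have e1 : G u (X x (X y a)) = (d * e) *: X x (X y (G u a)).
  by rewrite (G_X_eig _ sx ux) (G_X_eig _ sy uy) linearZ scalerA.
have e2 : G u (X y (X x a)) = (e * d) *: X y (X x (G u a)).
  by rewrite (G_X_eig _ sy uy) (G_X_eig _ sx ux) linearZ scalerA.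
by rewrite !brE linearB linearZ /= e1 e2 scalerBr !scalerA [e * d]mulrC [c * _]mulrC.
Qed.
End Braided.

Section RotationSquare.
Variables (K : fieldType) (A : fhopfType K) (gT : finGroupType).
Variables (phi : grouplike_map A gT) (N : nat).
Hypothesis char0 : [pchar K] =i pred0.
Hypothesis FN : fil phi N = fullv.
Variables (h s : gT) (m : nat).
Hypothesis m0 : (0 < m)%N.
Hypothesis oh : #[h]%g = m.
Hypothesis ss : (s * s)%g = 1%g.
Hypothesis shs : (s * h * s)%g = (h^-1)%g.
Implicit Types (l : dual K A) (x y : A) (u v w : gT) (i j k : nat) (c d : K).
Local Notation J := (inJ phi).
Local Notation X := (Xop phi N).
Local Notation G := (Gop phi N).
Local Notation D := (dop phi N).
Local Notation eig i := (eigp phi h (h ^+ i)%g).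

Let hm : (h ^+ m)%g = 1%g. Proof. by rewrite -oh expg_order. Qed.

Lemma eig_neq0 i c x : eig i c x -> x \notin kG phi -> c != 0.
Proof.
move=> [sx hx] xG; have x0 : x != 0 by apply: contraNneq xG => ->; rewrite mem0v.
apply/eqP => c0; have := eigp_root hm hx x0.
by rewrite c0 expr0n eqn0Ngt m0 => /eqP; rewrite eq_sym oner_eq0.
Qed.

Lemma Ad_expgV j c x : Ad phi h x = c *: x -> c != 0 -> Ad phi (h ^- j)%g x = c ^- j *: x.
Proof.
move=> hx c0; have cj : c ^+ j != 0 by apply: expf_neq0.
by rewrite -[x in LHS](scalerK cj) linearZ /= -(Ad_expg j hx) -AdM mulVg Ad1.
Qed.

Lemma Ad_s_eig i c x : eig i c x -> c != 0 ->
  skewp phi (h ^- i)%g (Ad phi s x) /\ Ad phi h (Ad phi s x) = c^-1 *: Ad phi s x.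
Proof.
move=> [sx hx] c0; have sV : (s^-1 = s)%g by apply/eqP; rewrite eq_invg_mul ss.
split; first by have := skewp_Ad s sx; rewrite (s_expg ss shs) sV -mulgA ss mulg1.
have hs : (h * s = s * h ^- 1)%g.
  by apply: (mulgI s); rewrite [RHS]mulgA ss mul1g mulgA shs expg1.
by rewrite -AdM hs AdM (Ad_expgV 1 hx c0) expr1 linearZ.
Qed.

(** The value 1 is excluded by [skewp_trivial_action]. If c^(2i) is not 1, then x and its conjugate
    by s, of inverse types, form an affine pair with parameter c^-i. *)
Lemma rot_eig i c x : eig i c x -> x \notin kG phi -> c ^+ i = -1.
Proof.
move=> ex xG; have [sx hx] := ex; have c0 := eig_neq0 ex xG.
have vx := Ad_expg i hx.
have ci1 : c ^+ i != 1.
  apply: contra xG => /eqP ci; apply: (skewp_trivial_action char0 FN sx).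
  by rewrite vx ci scale1r.
suff : (c ^+ i) ^+ 2 == 1 by rewrite sqrf_eq1 (negPf ci1) => /eqP.
apply/negPn/negP => c2.
have [sy hy] := Ad_s_eig ex c0; set y := Ad phi s x in sy hy.
have yG : y \notin kG phi by rewrite Ad_inv_kG.
(* The two weights must differ for the dual functionals to exist; c = c^-1 would give c^(2i) = 1. *)
have wne : ((h ^- i)%g, c^-1) != ((h ^+ i)%g, c).
  apply: contra c2 => /eqP[_ cV]; rewrite exprAC.
  by have -> : c ^+ 2 = 1; [rewrite expr2 -{2}cV mulfV | rewrite expr1n].
have [l1 [J1 l1x l1w]] := weight_functional char0 hm m0 ex xG.
have [l2 [J2 l2y l2w]] := weight_functional char0 hm m0 (conj sy hy) yG.
have l1y : l1 y = 0 by apply: (l1w (h ^- i)%g c^-1).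
have l2x : l2 x = 0 by apply: (l2w (h ^+ i)%g c) => //; rewrite eq_sym.
have vy : Ad phi (h ^+ i)%g y = c ^- i *: y by rewrite (Ad_expg _ hy) exprVn.
have [n nz] := affz_nilpotent FN (c ^- i) 1 (fun (k : int) z => @deg_gt_X _ _ _ phi N FN k x z)
   (fun (k : int) z => @deg_gt_X _ _ _ phi N FN k y z).
have nn := @affine_not_nilpotent _ _ char0 (X x) (X y) (D l1) (D l2)
  (G (h ^+ i)%g) (G (h ^- i)%g) (fun=> True) (c ^- i) 1 1 1.
suff /negP : iter n (affz (X x) (X y) (c ^- i)) 1 != 0 by apply; rewrite nz.
apply: nn => //; rewrite ?one_neq0 ?oner_eq0 ?invr_eq0 ?expf_neq0 ?invrK //.
- by move=> z; rewrite /= (Gop_mul FN) mulVg (Gop1 FN).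
- by move=> z; rewrite /= (Gop_mul FN) mulgV (Gop1 FN).
- by move=> z; rewrite /= (G_X_eig FN _ sx vx) ?invrK.
- by move=> z; rewrite /= (G_X_eig FN _ sy vy).
- by move=> z _; rewrite /= (dop_X FN _ J1 sx) l1x.
- by move=> z _; rewrite /= (dop_X FN _ J1 sy) l1y scale0r addr0.
- by move=> z _; rewrite /= (dop_X FN _ J2 sx) l2x scale0r addr0.
- by move=> z _; rewrite /= (dop_X FN _ J2 sy) l2y.
- exact: dop_1.
- by rewrite /= -(phi1 phi) (Gop_phi FN) (dop_phi FN).
- by rewrite exprVn invr_eq1.
Qed.
End RotationSquare.

Section RotationPair.
Variables (K : fieldType) (A : fhopfType K) (gT : finGroupType).
Variables (phi : grouplike_map A gT) (N : nat).
Hypothesis char0 : [pchar K] =i pred0.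
Hypothesis FN : fil phi N = fullv.
Variables (h s : gT) (t : nat).
Hypothesis t_gt0 : (0 < t)%N.
Hypothesis oh : #[h]%g = (4 * t)%N.
Hypothesis ss : (s * s)%g = 1%g.
Hypothesis shs : (s * h * s)%g = (h^-1)%g.
Variable om : K.
Hypothesis om_prim : (4 * t).-primitive_root om.
Implicit Types (l : dual K A) (x y : A) (u v w : gT) (i j k a b : nat) (c d : K).
Local Notation J := (inJ phi).
Local Notation X := (Xop phi N).
Local Notation G := (Gop phi N).
Local Notation D := (dop phi N).
Local Notation eig i := (eigp phi h (h ^+ i)%g).

Let m0 : (0 < 4 * t)%N. Proof. by rewrite muln_gt0. Qed.
Let hm : (h ^+ (4 * t))%g = 1%g. Proof. by rewrite -oh expg_order. Qed.

Lemma om_half : om ^+ (2 * t) = -1.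
Proof.
have : om ^+ (2 * t) != 1.
  rewrite -(prim_order_dvd om_prim); apply/negP => /dvdn_leq.
  by rewrite muln_gt0 t_gt0 leq_pmul2r // => /(_ isT).
have : (om ^+ (2 * t)) ^+ 2 == 1.
  by rewrite -exprM mulnAC (prim_expr_order om_prim).
by rewrite sqrf_eq1 => /orP[->|/eqP].
Qed.

Lemma om_neg n : om ^+ n = -1 -> exists2 al, odd al & n = (2 * t * al)%N.
Proof.
rewrite -om_half => /eqP; rewrite (eq_prim_root_expr om_prim) => /eqP e.
exists (n %/ (4 * t)).*2.+1; first by rewrite /= odd_double.
rewrite [LHS](divn_eq n (4 * t)) e modn_small ?ltn_pmul2r //.
by rewrite -mul2n; nia.
Qed.

Lemma neg1_neq1 : (-1 : K) != 1.
Proof.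
by rewrite eq_sym -addr_eq0; apply: (natS_neq0 char0 1).
Qed.

(** Equality would give c^2 = 1 and h^(2i) = 1. As 4 divides the order of h, the exponent i is then
    even and c^i = 1, against [rot_eig]. *)
Lemma rot_self i c x : eig i c x -> x \notin kG phi -> ((h ^- i)%g, c^-1) != ((h ^+ i)%g, c).
Proof.
move=> ex xG; apply/negP => /eqP[hi cV].
have c0 := eig_neq0 m0 oh ex xG.
have ci := rot_eig char0 FN m0 oh ss shs ex xG.
have c2 : c ^+ 2 = 1 by rewrite expr2 -{2}cV mulfV.
have : (h ^+ (i * 2))%g == 1%g by rewrite expgM expgS expg1 -{1}hi mulVg.
rewrite -order_dvdn oh => /dvdnP[k ik].
have ek : i = (2 * (k * t))%N by move: ik; lia.
by move/eqP: ci; rewrite ek exprM c2 expr1n eq_sym (negPf neg1_neq1).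
Qed.

(** Let S = c^j d^i. The brackets of x, y and of their conjugates x', y' have inverse types, v =
    h^(i+j) and v^-1, and v acts on the first by S because c^i = d^j = -1. If S^2 is not 1 they form
    an affine pair with parameter S^-1; each composite derivation removes first y or y', then x or
    x'. *)
Lemma rot_pair_square i j c d x y : eig i c x -> eig j d y ->
    x \notin kG phi -> y \notin kG phi -> d != c -> d != c^-1 ->
  (c ^+ j * d ^+ i) ^+ 2 = 1.
Proof.
move=> ex ey xG yG dc dcV; have [sx hx] := ex; have [sy hy] := ey.
have c0 := eig_neq0 m0 oh ex xG; have d0 := eig_neq0 m0 oh ey yG.
have ci := rot_eig char0 FN m0 oh ss shs ex xG.
have dj := rot_eig char0 FN m0 oh ss shs ey yG.
have [sx' hx'] := Ad_s_eig ss shs ex c0; set x' := Ad phi s x in sx' hx'.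
have [sy' hy'] := Ad_s_eig ss shs ey d0; set y' := Ad phi s y in sy' hy'.
have x'G : x' \notin kG phi by rewrite Ad_inv_kG.
have y'G : y' \notin kG phi by rewrite Ad_inv_kG.
have ex' : eigp phi h (h ^- i)%g c^-1 x' by [].
have ey' : eigp phi h (h ^- j)%g d^-1 y' by [].
have [l1 [J1 l11 l1w]] := weight_functional char0 hm m0 ex xG.
have [l2 [J2 l22 l2w]] := weight_functional char0 hm m0 ey yG.
have [l3 [J3 l33 l3w]] := weight_functional char0 hm m0 ex' x'G.
have [l4 [J4 l44 l4w]] := weight_functional char0 hm m0 ey' y'G.
have selfx := rot_self ex xG; have selfy := rot_self ey yG.
have ne2 (u v : gT) (e f : K) : e != f -> (u, e) != (v, f).
  by apply: contra => /eqP[_ ->].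
have dVc : d^-1 != c by apply: contra dcV => /eqP<-; rewrite invrK.
have dVcV : d^-1 != c^-1 by rewrite (inj_eq invr_inj).
have l12 : l1 y = 0 by apply: (l1w _ _ _ ey); apply: ne2.
have l13 : l1 x' = 0 by apply: (l1w _ _ _ ex').
have l14 : l1 y' = 0 by apply: (l1w _ _ _ ey'); apply: ne2.
have l21 : l2 x = 0 by apply: (l2w _ _ _ ex); apply: ne2; rewrite eq_sym.
have l23 : l2 x' = 0 by apply: (l2w _ _ _ ex'); apply: ne2; rewrite eq_sym.
have l24 : l2 y' = 0 by apply: (l2w _ _ _ ey').
have l31 : l3 x = 0 by apply: (l3w _ _ _ ex); rewrite eq_sym.
have l32 : l3 y = 0 by apply: (l3w _ _ _ ey); apply: ne2.
have l34 : l3 y' = 0 by apply: (l3w _ _ _ ey'); apply: ne2.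
have l41 : l4 x = 0 by apply: (l4w _ _ _ ex); apply: ne2; rewrite eq_sym.
have l42 : l4 y = 0 by apply: (l4w _ _ _ ey); rewrite eq_sym.
have l43 : l4 x' = 0 by apply: (l4w _ _ _ ex'); apply: ne2; rewrite eq_sym.
set S := c ^+ j * d ^+ i.
have vy : Ad phi (h ^+ i)%g y = d ^+ i *: y := Ad_expg i hy.
have wx : Ad phi (h ^+ j)%g x = c ^+ j *: x := Ad_expg j hx.
have vy' : Ad phi (h ^- i)%g y' = d ^+ i *: y'.
  by rewrite (Ad_expgV i hy') ?invr_eq0 // exprVn invrK.
have wx' : Ad phi (h ^- j)%g x' = c ^+ j *: x'.
  by rewrite (Ad_expgV j hx') ?invr_eq0 // exprVn invrK.
pose a := br phi N (d ^+ i) x y; pose b := br phi N (d ^+ i) x' y'.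
have Da l z : J l -> D l (a z) = a (D l z) + ((1 - S) * l y) *: X x (G (h ^+ j)%g z).
  by move=> lJ; rewrite (D_br FN _ lJ sx sy vy wx) [d ^+ i * _]mulrC.
have Db l z : J l -> D l (b z) = b (D l z) + ((1 - S) * l y') *: X x' (G (h ^- j)%g z).
  by move=> lJ; rewrite (D_br FN _ lJ sx' sy' vy' wx') [d ^+ i * _]mulrC.
pose M z := forall l, J l -> l y = 0 -> l y' = 0 -> D l z = 0.
have M1 : M 1 by move=> l lJ _ _; apply: dop_1.
have MG u e e' z : Ad phi u y = e *: y -> Ad phi u y' = e' *: y' -> M z -> M (G u z).
  move=> uy uy' Mz l lJ ly ly'; rewrite (dop_G FN) // Mz ?linear0 //; first exact: inJ_Ad.
    by rewrite comp_lfunE lfunE /= uy linearZ /= ly scaler0.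
  by rewrite comp_lfunE lfunE /= uy' linearZ /= ly' scaler0.
have Mj z : M z -> M (G (h ^+ j)%g z) by apply: MG (Ad_expg j hy) (Ad_expg j hy').
have MjV z : M z -> M (G (h ^- j)%g z).
  apply: MG; first exact: (Ad_expgV j hy).
  by apply: (Ad_expgV j hy'); rewrite invr_eq0.
set v := (h ^+ i * h ^+ j)%g.
have vE : v = (h ^+ (i + j))%g by rewrite expgD.
have Mv z : M z -> M (G v z) by rewrite vE; apply: MG (Ad_expg _ hy) (Ad_expg _ hy').
have vV : (h ^- i * h ^- j)%g = (v^-1)%g by rewrite -invMg -expgD addnC expgD.
have Sv : c ^+ (i + j) * d ^+ (i + j) = S.
  by rewrite !exprD ci dj mulN1r mulrN1 mulrNN.
apply/eqP/negPn/negP => S2.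
have S0 : S != 0 by rewrite mulf_neq0 ?expf_neq0.
have S1 : 1 - S != 0.
  by rewrite subr_eq0; apply: contra S2 => /eqP<-; rewrite expr1n.
have [n nz] := affz_nilpotent FN (S^-1) 1
   (fun (k : int) z => @deg_gt_br _ _ _ phi N FN (d ^+ i) x y k z)
   (fun (k : int) z => @deg_gt_br _ _ _ phi N FN (d ^+ i) x' y' k z).
have nn := @affine_not_nilpotent _ _ char0 a b (D l1 \o D l2)%VF (D l3 \o D l4)%VF
  (G v) (G v^-1%g) M S^-1 (1 - S) (1 - S) 1.
suff /negP : iter n (affz a b S^-1) 1 != 0 by apply; rewrite nz.
apply: nn => //; rewrite ?one_neq0 ?invr_eq0 ?invrK //.
- by move=> z; rewrite /= (Gop_mul FN) mulVg (Gop1 FN).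
- by move=> z; rewrite /= (Gop_mul FN) mulgV (Gop1 FN).
- by move=> e z z' Mz Mz' l lJ ly ly'; rewrite linearP /= Mz ?Mz' // scaler0 addr0.
- by move=> z Mz l lJ ly ly'; rewrite Da // Mz // ly mulr0 scale0r linear0 addr0.
- by move=> z Mz l lJ ly ly'; rewrite Db // Mz // ly' mulr0 scale0r linear0 addr0.
- move=> z; rewrite /= (G_br FN (d ^+ i) z sx sy (_ : _ = c ^+ (i + j) *: _)
    (_ : _ = d ^+ (i + j) *: _)).
  + by rewrite Sv.
  + by rewrite vE (Ad_expg _ hx).
  by rewrite vE (Ad_expg _ hy).
- move=> z; rewrite /= (G_br FN (d ^+ i) z sx' sy' (_ : _ = c ^- (i + j) *: _)
    (_ : _ = d ^- (i + j) *: _)).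
  + by rewrite -invfM Sv.
  + by rewrite vE (Ad_expg _ hx') exprVn.
  by rewrite vE (Ad_expg _ hy') exprVn.
- move=> z Mz; rewrite /= !comp_lfunE Da // l22 mulr1 linearD linearZ /= Da // l12.
  rewrite mulr0 scale0r addr0 (dop_X FN _ J1 sx) l11 (Mj z Mz l1 J1 l12 l14).
  by rewrite linear0 add0r scale1r (Gop_mul FN).
- move=> z Mz; rewrite /= !comp_lfunE Db // l24 mulr0 scale0r addr0 Db // l14.
  by rewrite mulr0 scale0r addr0.
- move=> z Mz; rewrite /= !comp_lfunE Da // l42 mulr0 scale0r addr0 Da // l32.
  by rewrite mulr0 scale0r addr0.
- move=> z Mz; rewrite /= !comp_lfunE Db // l44 mulr1 linearD linearZ /= Db // l34.
  rewrite mulr0 scale0r addr0 (dop_X FN _ J3 sx') l33 (MjV z Mz l3 J3 l32 l34).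
  by rewrite linear0 add0r scale1r (Gop_mul FN) vV.
- by rewrite /= comp_lfunE dop_1 // linear0.
- by rewrite /= comp_lfunE -(phi1 phi) (Gop_phi FN) (dop_phi FN) // linear0.
by rewrite exprVn invr_eq1.
Qed.

(** When d is c or c^-1 the value follows from [rot_eig]. Otherwise only -1 has to be excluded: with
    c and d written as powers of [om], the three equations with value -1 say that three exponents
    are odd multiples of 2t. *)
Lemma rot_pair i j c d x y : eig i c x -> eig j d y ->
  x \notin kG phi -> y \notin kG phi -> c ^+ j * d ^+ i = 1.
Proof.
move=> ex ey xG yG.
have c0 := eig_neq0 m0 oh ex xG; have d0 := eig_neq0 m0 oh ey yG.
have ci := rot_eig char0 FN m0 oh ss shs ex xG.
have dj := rot_eig char0 FN m0 oh ss shs ey yG.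
have [dc|dc] := eqVneq d c; first by rewrite -{1}dc dj dc ci mulrNN mulr1.
have [dcV|dcV] := eqVneq d c^-1.
  have e : c = d^-1 by rewrite dcV invrK.
  have -> : c ^+ j = -1 by rewrite e exprVn dj invrN1.
  by rewrite dcV exprVn ci invrN1 mulrNN mulr1.
have : (c ^+ j * d ^+ i) ^+ 2 == 1.
  by apply/eqP; apply: (rot_pair_square ex ey xG yG dc dcV).
rewrite sqrf_eq1 => /orP[/eqP//|/eqP e].
have [sx hx] := ex; have [sy hy] := ey.
have x0 : x != 0 by apply: contraNneq xG => ->; rewrite mem0v.
have y0 : y != 0 by apply: contraNneq yG => ->; rewrite mem0v.
have [a ca] := prim_rootP om_prim (eigp_root hm hx x0).
have [b db] := prim_rootP om_prim (eigp_root hm hy y0).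
move: ci dj e; rewrite ca db -!exprM -exprD.
move=> /om_neg[al oal e1] /om_neg[be obe e2] /om_neg[ga oga e3].
by case: (odd_triple_absurd t_gt0 oal obe oga e1 e2 e3).
Qed.
End RotationPair.

(** * A basis of skew-primitive eigenvectors *)

Section SkewBasis.
Variables (K : fieldType) (A : fhopfType K) (gT : finGroupType).
Variables (phi : grouplike_map A gT).
Hypothesis char0 : [pchar K] =i pred0.
Variables (h : gT) (m : nat).
Hypothesis m0 : (0 < m)%N.
Hypothesis hm : (h ^+ m)%g = 1%g.
Hypothesis rot : forall v x, skewp phi v x -> x \notin kG phi -> exists i, v = (h ^+ i)%g.
Variable om : K.
Hypothesis om_prim : m.-primitive_root om.
Implicit Types (l : dual K A) (x y : A) (u v w : gT) (i j k : nat) (c d : K).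
Local Notation J := (inJ phi).
Local Notation F := (fil phi).

Lemma geometric_root j : (j < m)%N -> \sum_(k < m) om ^- (k * j) = (j == 0%N)%:R * m%:R.
Proof.
move=> jm; have [->|j0] := eqVneq j 0%N.
  under eq_bigr do rewrite muln0 expr0 invr1.
  by rewrite sumr_const card_ord mul1r.
have oj : om ^+ j != 1.
  by rewrite -(prim_order_dvd om_prim); apply/negP => /dvdn_leq; rewrite lt0n leqNgt jm => /(_ j0).
have : (om ^- j - 1) * \sum_(k < m) om ^- (k * j) = 0.
  transitivity (om ^- j ^+ m - 1).
    rewrite subrX1; congr (_ * _); apply: eq_bigr => k _.
    by rewrite mulnC exprM -exprVn.
  by rewrite exprVn -exprM mulnC exprM (prim_expr_order om_prim) expr1n invr1 subrr.
by move/eqP; rewrite mulf_eq0 subr_eq0 invr_eq1 (negPf oj) /= => /eqP->; rewrite mul0r.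
Qed.

Definition eig_part k x : A := m%:R^-1 *: \sum_(j < m) om ^- (k * j) *: Ad phi (h ^+ j)%g x.

Lemma eig_part_sum x : x = \sum_(k < m) eig_part k x.
Proof.
have mK : m%:R != 0 :> K by rewrite -(prednK m0) natS_neq0.
rewrite -scaler_sumr exchange_big /=.
have -> : \sum_(j < m) \sum_(k < m) om ^- (k * j) *: Ad phi (h ^+ j)%g x = m%:R *: x.
  rewrite (bigD1 (Ordinal m0)) //= -scaler_suml geometric_root // mul1r expg0 Ad1.
  rewrite big1 ?addr0 // => j j0; rewrite -scaler_suml geometric_root //.
  by rewrite (_ : (j == 0%N :> nat) = false) ?mul0r ?scale0r //; apply/negbTE.
by rewrite scalerA mulVf // scale1r.
Qed.

Lemma eig_partP i k x : skewp phi (h ^+ i)%g x -> eigp phi h (h ^+ i)%g (om ^+ k) (eig_part k x).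
Proof.
move=> sx; split.
  rewrite -[eig_part k x]addr0; apply: skewpP (skewp0 _ _).
  elim/big_ind: _ => [|y z sy sz|j _].
  - exact: skewp0.
  - by rewrite -[y]scale1r; apply: skewpP.
  rewrite -[_ *: _]addr0; apply: skewpP (skewp0 _ _).
  by have := skewp_Ad (h ^+ j)%g sx; rewrite -expgD addnC expgD mulgK.
have om0 : om != 0.
  apply/eqP => o0; have := prim_expr_order om_prim.
  by rewrite o0 expr0n eqn0Ngt m0 => /eqP; rewrite eq_sym oner_eq0.
rewrite linearZ /= scalerA mulrC -scalerA; congr (_ *: _).
rewrite linear_sum scaler_sumr.
rewrite -(sum_shift (P := fun j => om ^+ k *: (om ^- (k * j) *: Ad phi (h ^+ j)%g x))); last first.
  by rewrite muln0 expr0 expg0 hm mulnC exprM (prim_expr_order om_prim) expr1n.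
apply: eq_bigr => j _; rewrite linearZ /= -AdM -expgS scalerA; congr (_ *: _).
by rewrite mulnS exprD invfM mulVKf ?expf_neq0.
Qed.

Lemma taft_wilson_eig (P : A -> Prop) : P 0 -> (forall a b, P a -> P b -> P (a + b)) ->
    (forall a, a \in kG phi -> P a) ->
    (forall i c u x, eigp phi h (h ^+ i)%g c x -> P (x * phi u)) ->
  forall a, a \in F 2 -> P a.
Proof.
move=> P0 PD PG Px; apply: taft_wilson => // u v x sx.
have [xG|xG] := boolP (x \in kG phi).
  apply: PG; have := @filM _ _ _ phi 0 0 x (phi u).
  by rewrite fil1 mem_kG; apply.
have [i vi] := rot sx xG; rewrite vi in sx.
rewrite {1}(eig_part_sum x) mulr_suml.
apply: (big_ind P P0 PD) => k _; apply: (Px i (om ^+ k)); exact: eig_partP.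
Qed.

Definition eig_data (p : nat * K * A) := eigp phi h (h ^+ p.1.1)%g p.1.2 p.2.

Lemma mulkG a u : a \in kG phi -> a * phi u \in kG phi.
Proof.
by have := @filM _ _ _ phi 0 0 a (phi u); rewrite fil1 mem_kG => h1 h2; apply: h1.
Qed.

Definition gens (L : seq (nat * K * A)) : seq A :=
  phis phi ++ [seq p.2 * phi u | p : nat * K * A <- L, u : gT <- enum gT].

Lemma eig_span : exists2 L : seq (nat * K * A), forall p, p \in L -> eig_data p
  & forall a, a \in F 2 -> a \in <<gens L>>%VS.
Proof.
pose U (L : seq (nat * K * A)) : {vspace A} :=
  <<gens L>>%VS.
have UC L L' : (U L <= U (L ++ L') /\ U L' <= U (L ++ L'))%VS.
  rewrite /U /gens; split; apply: sub_span => x; rewrite !mem_cat => /orP[->//|].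
    by move=> /allpairsP[p [h1 h2 ->]]; rewrite (allpairs_f _ _ h2) ?orbT // mem_cat h1.
  by move=> /allpairsP[p [h1 h2 ->]]; rewrite (allpairs_f _ _ h2) ?orbT // mem_cat h1 orbT.
pose ok (L : seq (nat * K * A)) := forall p, p \in L -> eig_data p.
have okC L L' : ok L -> ok L' -> ok (L ++ L').
  by move=> h1 h2 p; rewrite mem_cat => /orP[/h1|/h2].
have one a : a \in F 2 -> exists2 L, ok L & a \in U L.
  move: a; apply: taft_wilson_eig => [|a b [L okL aL] [L' okL' bL']|a aG|i c u x ex].
  - by exists [::]; rewrite ?mem0v.
  - exists (L ++ L'); first exact: okC.
    by have [/subvP h1 /subvP h2] := UC L L'; apply: memvD; [apply: h1 | apply: h2].
  - exists [::] => //; rewrite /U /gens /= cats0; exact: aG.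
  exists [:: (i, c, x)]; first by move=> p; rewrite inE => /eqP->.
  apply: memv_span; rewrite /gens mem_cat; apply/orP; right; apply/allpairsP.
  by exists ((i, c, x), u); rewrite inE eqxx mem_enum.
suff [L okL hL] : exists2 L, ok L & forall a, a \in (vbasis (F 2) : seq A) -> a \in U L.
  exists L => // a; apply: subvP; rewrite -(span_basis (vbasisP (F 2))).
  by apply/span_subvP.
have : forall a, a \in (vbasis (F 2) : seq A) -> a \in F 2 by move=> a; apply: vbasis_mem.
elim: (vbasis _ : seq A) => [|a s IH] h2; first by exists [::].
have [L okL hL] := IH (fun b bs => h2 b (mem_behead (s := a :: s) bs)).
have [L' okL' aL'] := one a (h2 a (mem_head _ _)).
exists (L ++ L'); first exact: okC.
have [/subvP h3 /subvP h4] := UC L L'.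
by move=> b; rewrite inE => /predU1P[->|/hL/h3//]; apply: h4.
Qed.

Lemma free_extract (s L : seq A) : free s ->
  exists2 B : seq A, {subset B <= L} & free (B ++ s) /\ {subset L <= <<B ++ s>>%VS}.
Proof.
move=> fs; elim: L => [|a L [B BL [fB LB]]]; first by exists [::].
have [aB|aB] := boolP (a \in <<B ++ s>>%VS).
  exists B; first by move=> b /BL; rewrite inE orbC => ->.
  by split=> // b; rewrite inE => /predU1P[->|/LB].
exists (a :: B); first by move=> b; rewrite !inE => /predU1P[->|/BL->]; rewrite ?eqxx ?orbT.
split; first by rewrite /= free_cons aB.
move=> b; rewrite inE => /predU1P[->|/LB]; first by apply: memv_span; rewrite mem_head.
apply: subvP; apply: sub_span => c cB; rewrite inE; apply/orP; right; exact: cB.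
Qed.

(** The [xv] are thinned out of a finite list of eigenvectors so as to be free together with the
    group-likes; the coordinates [lv] on this joint family therefore vanish on [kG]. *)
Lemma skew_basis : exists (n : nat) (xv : 'I_n -> A) (iv : 'I_n -> nat) (cv : 'I_n -> K)
    (lv : 'I_n -> dual K A),
  [/\ forall k : 'I_n, eigp phi h (h ^+ iv k)%g (cv k) (xv k),
      forall k : 'I_n, xv k \notin kG phi,
      forall k : 'I_n, J (lv k),
      forall k j : 'I_n, lv k (xv j) = (k == j)%:R
    & forall P : A -> Prop, P 0 -> (forall a b, P a -> P b -> P (a + b)) ->
       (forall a, a \in kG phi -> P a) ->
       (forall (k : 'I_n) u c, P (c *: (xv k * phi u))) -> forall a, a \in F 2 -> P a].
Proof.
have [L okL spL] := eig_span.
have [B BL [fB LB]] := free_extract [seq p.2 | p <- L] (phis_free phi).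
pose n := size B; pose X := in_tuple (B ++ phis phi).
have szX : size (B ++ phis phi) = (n + size (phis phi))%N by rewrite size_cat.
have lt1 (k : 'I_n) : (k < size (B ++ phis phi))%N by rewrite szX ltn_addr.
pose kk (k : 'I_n) : 'I_(size (B ++ phis phi)) := Ordinal (lt1 k).
have xE (k : 'I_n) : X`_(kk k) = B`_k by rewrite /= nth_cat ltn_ord.
(* Recovers the exponent and the eigenvalue recorded with the vector in [L]; by [ix] the default
   value is never taken. *)
pose dat (k : 'I_n) := nth (0%N, 0, 0) L (index B`_k [seq p.2 | p <- L]).
have BkL (k : 'I_n) : B`_k \in [seq p.2 | p <- L] by apply/BL/mem_nth.
have ix (k : 'I_n) : (index (B`_k)%R [seq p.2 | p <- L] < size L)%N.
  by rewrite -(size_map (fun p => p.2)) index_mem.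
have dat2 (k : 'I_n) : (dat k).2 = B`_k.
  by rewrite /dat -(nth_map _ 0 (fun p : nat * K * A => p.2)) ?ix // nth_index.
pose lv (k : 'I_n) : dual K A := linfun (coord X (kk k) : A -> K^o).
exists n, (fun k : 'I_n => B`_k), (fun k : 'I_n => (dat k).1.1).
exists (fun k : 'I_n => (dat k).1.2), lv; split.
- move=> k; rewrite -dat2; apply: okL; apply: mem_nth; exact: ix.
- move=> k; apply/negP => kG_.
  have /and3P[fB1 _ dv] : [&& free B, free (phis phi) & directv (<<B>> + <<phis phi>>)].
    by rewrite -cat_free.
  have : B`_k \in (<<B>> :&: kG phi)%VS by rewrite memv_cap kG_ memv_span ?mem_nth.
  rewrite /kG (directv_addP dv) memv0 => /eqP B0.
  by have := free_not0 (v := B`_k) fB1 (mem_nth 0 (ltn_ord k)); rewrite B0 eqxx.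
- move=> k u; rewrite lfunE /=; have : phi u \in phis phi by apply: map_f; rewrite mem_enum.
  move=> /(nthP 0)[j jlt <-].
  have ltj : (n + j < size (B ++ phis phi))%N by rewrite szX ltn_add2l.
  have -> : (phis phi)`_j = X`_(Ordinal ltj).
    by rewrite /= nth_cat ltnNge leq_addr /= addKn.
  rewrite coord_free // -val_eqE /= (_ : (_ == _) = false) //.
  by apply/eqP => e; have := ltn_ord k; rewrite -e ltnNge leq_addr.
- by move=> k j; rewrite lfunE /= -xE coord_free // -val_eqE /= eq_sym.
move=> P P0 PD PG Px a /spL aS.
have PZ (s : seq A) : (forall x c, x \in s -> P (c *: x)) -> forall y, y \in <<s>>%VS -> P y.
  move=> hs y /(coord_span (X := in_tuple s)) ->.
  apply: (big_ind P P0 PD) => j _; apply: hs; exact: mem_nth.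
apply: (PZ _ _ _ aS) => x c; rewrite mem_cat => /orP[/mapP[u _ ->]|].
  by apply: PG; rewrite memvZ ?mem_kG.
rewrite /gens; move=> /allpairsP[[p u] /= [pL _ ->]].
have : p.2 \in <<B ++ phis phi>>%VS by apply: LB; apply: map_f.
move: p.2 => x' /(coord_span (X := X)) ->; rewrite mulr_suml scaler_sumr.
apply: (big_ind P P0 PD) => j _.
rewrite -scalerAl scalerA; have [jn|nj] := ltnP j n.
  by have := Px (Ordinal jn) u (c * coord X j x'); rewrite /= nth_cat jn.
apply: PG; rewrite memvZ // mulkG // /= nth_cat ltnNge nj /=.
apply: memv_span; apply: mem_nth; rewrite ltn_subLR //.
by rewrite -szX.
Qed.
End SkewBasis.

(** * Commutation of the dual functionals *)

Section CommutatorFunctional.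
Variables (K : fieldType) (A : fhopfType K) (gT : finGroupType).
Variables (phi : grouplike_map A gT) (N : nat).
Hypothesis char0 : [pchar K] =i pred0.
Hypothesis FN : fil phi N = fullv.
Variables (e : dual K A) (v : gT) (m : nat).
Implicit Types (f g : dual K A) (a b w x y : A) (u : gT) (i j : nat).
Local Notation J := (inJ phi).
Local Notation F := (fil phi).
Lemma phi_filM u i a : a \in F i.+1 -> phi u * a \in F i.+1.
Proof. by apply: (@filM _ _ _ phi 0 i); apply: phi_F1. Qed.

Lemma fil_Mphi u i a : a \in F i.+1 -> a * phi u \in F i.+1.
Proof. by move=> aF; rewrite -[i]addn0; apply: filM => //; apply: phi_F1. Qed.

Hypothesis m0 : (0 < m)%N.
Hypothesis vm : (v ^+ m)%g = 1%g.
(** The hypotheses describe a q-commutator of type v = v_k v_l: it has degree two and vanishes on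
    products from [F 2], so [hit e] is a skew-derivation of degree -2 on elements of right degree 1.
    [e_lmul] expresses that v acts trivially on it. *)
Hypothesis e_F2 : forall a, a \in F 2 -> e a = 0.
Hypothesis e_F2M : forall a b, a \in F 2 -> b \in F 2 -> e (a * b) = 0.
Hypothesis e_rmul : forall u a, a \in F 3 -> e (a * phi u) = e a.
Hypothesis e_lmul : forall a, a \in F 3 -> e (phi v * a) = e a.
Hypothesis e_crd : forall u a, a \in F 3 ->
  crd_phi phi u (hit e a) = e (hit (crd_phi phi (v^-1 * u)%g) a).

(* The component of right degree 1 in [fil 3], modulo [fil 2]. *)
Definition rdeg1 b : Prop := forall f, hit f b - (f 1 : K) *: b \in F 2.

Lemma rdeg1_crd w u : w \in F 3 -> rdeg1 (hit (crd_phi phi u) w * phi u^-1%g).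
Proof.
move=> wF f; rewrite hit_Mgrouplike ?phi_grouplike // scalerAl -mulrBl; apply: fil_Mphi.
rewrite -hit_conv -hitZ -hitB; apply: fil_hitJ => // u'.
rewrite add_lfunE opp_lfunE scale_lfunE -dual_hit hit_grouplike ?phi_grouplike //.
rewrite linearZ /= crd_phiE rmulfE; case: eqVneq => [<-|_].
  by rewrite phi_inv scale1r [X in _ - X]mulr1 subrr.
by rewrite scale0r scaler0 subrr.
Qed.

Lemma rdeg1_Ad u b : rdeg1 b -> rdeg1 (Ad phi u b).
Proof.
move=> hb f; rewrite /Ad hit_Mgrouplike ?phi_grouplike // hit_grouplikeM ?phi_grouplike //.
rewrite scalerAl scalerAr -mulrBl -mulrBr; apply/fil_Mphi/phi_filM.
by have := hb (lmulf (rmulf f (phi u^-1)%g) (phi u)); rewrite lmulfE rmulfE mulr1 phi_inv.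
Qed.

Lemma rdeg1_sum I (r : seq I) (B : I -> A) :
  (forall s, rdeg1 (B s)) -> rdeg1 (\sum_(s <- r) B s).
Proof.
move=> hB f; rewrite linear_sum scaler_sumr -sumrB; apply: memv_suml => s _; exact: hB.
Qed.

Lemma hit_rdeg1 b : rdeg1 b -> b \in F 3 -> hit e b = (e b : K) *: phi v.
Proof.
move=> hb bF; have hG : hit e b \in kG phi by rewrite -fil1; apply: (fil_lower (d := 2) _ bF).
rewrite (kG_sum hG) (bigD1 v) //= big1 ?addr0 => [|u uv].
  rewrite e_crd // mulVg; congr (_ *: _); have := e_F2 (hb (crd_phi phi 1%g)).
  by rewrite -(phi1 phi) crd_phiE eqxx scale1r linearB /= => /eqP; rewrite subr_eq0 => /eqP.
rewrite e_crd //; have := e_F2 (hb (crd_phi phi (v^-1 * u)%g)).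
rewrite -(phi1 phi) crd_phiE [_ == 1%g](_ : _ = false); last first.
  by apply: contraNF uv => /eqP E; rewrite -[u](mulKVg v) E mulg1.
by rewrite scale0r subr0 => ->; rewrite scale0r.
Qed.

Lemma lmulf_split (S T : 'End(A)) x y : (forall z, S (T z) = T z) ->
  e (T x * y) = \sum_(p < \dim {:A}) (crdA p \o T)%VF x * lmulf e (S (vbasis {:A})`_p) y.
Proof.
move=> ST; rewrite -ST {1}(coord_vbasis (memvf (T x))) linear_sum mulr_suml linear_sum.
apply: eq_bigr => p _; rewrite linearZ -scalerAl linearZ comp_lfunE crdAE lmulfE.
by [].
Qed.

Lemma fil_F2M i y z : y \in F 2 -> z \in F (i - 1)%N -> y * z \in F i.
Proof.
move=> yF; case: i => [|[|i]]; do ?by rewrite memv0 => /eqP->; rewrite mulr0 mem0v.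
by rewrite subn1 => zF; apply: (@filM _ _ _ _ 1 i).
Qed.

Lemma hit_lmulf_F2 i z a : z \in F 2 -> a \in F i.+1 -> hit (lmulf e z) a \in F (i - 1)%N.
Proof.
move=> zF aF; rewrite -subSS; apply: (fil_lower _ aF) => y yF.
by rewrite lmulfE e_F2M.
Qed.

Lemma hit_lmulf_F3 i z a : z \in F 3 -> a \in F i.+1 ->
  hit (lmulf e z) a - (e z : K) *: a \in F i.
Proof.
move=> zF aF; rewrite -{2}[a]hit_eps -hitZ -hitB; apply: (fil_hitJ _ aF) => u.
rewrite add_lfunE opp_lfunE scale_lfunE lmulfE e_rmul // eps_grouplike ?phi_grouplike //.
by apply/eqP; rewrite subr_eq0 eq_sym; apply/eqP/mulr1.
Qed.

(** The Leibniz rule up to [F i]. The comultiplication of [e] has outer terms at group-likes and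
    middle terms; the middle ones only reach lower degree because [e] vanishes on products from
    [F 2]. *)
Lemma hit_rdeg1M i a b : rdeg1 b -> b \in F 3 -> a \in F i.+1 ->
  hit e (b * a) - (b * hit e a + (e b : K) *: (phi v * a)) \in F i.
Proof.
move=> hb bF aF.
pose P := projv (F 2); pose Q := projv (F 3).
(* The identity is P + R + S, where P projects to [F 2], R kills [F 2] and is 1 - P on [F 3], and S
   kills [F 3]. *)
pose R := (Q \o (\1 - P))%VF; pose S := (\1 - P - R)%VF.
pose T := (\1%VF : 'End(A)).
have PE x : x \in F 2 -> P x = x := @projv_id _ _ _ _.
have QE x : x \in F 3 -> Q x = x := @projv_id _ _ _ _.
have PF x : P x \in F 2 := memv_proj _ _.
have QF x : Q x \in F 3 := memv_proj _ _.
have RE x : R x = Q (x - P x) by rewrite comp_lfunE add_lfunE opp_lfunE id_lfunE.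
have SE x : S x = x - P x - R x by rewrite !(add_lfunE, opp_lfunE) id_lfunE.
have tF x : x \in F 2 -> tau phi x \in F 2.
  move=> xF; rewrite tauE memvB // memv_suml // => u _.
  by rewrite memvZ // (@fil_leP _ _ _ phi 1) // phi_F1.
pose I := (gT + ('I_(\dim {:A}) + ('I_(\dim {:A}) + 'I_(\dim {:A}))))%type.
pose lf (s : I) : dual K A := match s with
  | inl u => (crd_phi phi u \o P)%VF
  | inr (inl p) => (crdA p \o (tau phi \o P))%VF
  | inr (inr (inl p)) => (crdA p \o R)%VF
  | inr (inr (inr p)) => (crdA p \o S)%VF end.
pose rf (s : I) : dual K A := match s with
  | inl u => lmulf e (phi u)
  | inr (inl p) => lmulf e (P (vbasis {:A})`_p)
  | inr (inr (inl p)) => lmulf e (Q (vbasis {:A})`_p)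
  | inr (inr (inr p)) => lmulf e (T (vbasis {:A})`_p) end.
rewrite (@hitM2 _ _ e b a I (index_enum _) lf rf); last first.
  move=> x y; rewrite !big_sumType /=.
  rewrite -(lmulf_split (S := P) x y); last by move=> z; rewrite PE // comp_lfunE; apply/tF/PF.
  rewrite -(lmulf_split (S := Q) x y); last by move=> z; rewrite RE (QE _ (QF _)).
  rewrite -(lmulf_split (S := T) x y); last by move=> z; rewrite id_lfunE.
  transitivity (\sum_u e ((crd_phi phi u (P x) : K) *: phi u * y) +
      (e ((tau phi \o P)%VF x * y) + (e (R x * y) + e (S x * y)))).
    rewrite -linear_sum -!linearD -mulr_suml -!mulrDl; congr (e (_ * y)).
    rewrite comp_lfunE tauE addrA [X in X + _](addrC (\sum_u _)) subrK SE.
    by rewrite [R x + _]addrC subrK addrC subrK.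
  by congr (_ + _); apply: eq_bigr => u _; rewrite -scalerAl linearZ lmulfE comp_lfunE.
rewrite !big_sumType /= opprD addrACA; apply: memvD.
  (* As b has right degree 1, only the group-like 1 contributes modulo [F i], giving
     [b * hit e a]. *)
  rewrite [X in X - _](bigD1 1%g) //= phi1 -addrA [X in _ + X]addrC addrA.
  apply: memvD; last first.
    apply: memv_suml => u u1; apply: fil_F2M; last first.
      by apply: hit_lmulf_F2 aF; rewrite (@fil_leP _ _ _ phi 1) // phi_F1.
    have := hb (crd_phi phi u \o P)%VF; rewrite comp_lfunE PE; last first.
      by rewrite (@fil_leP _ _ _ phi 1) // fil1 kG1.
    by rewrite -(phi1 phi) crd_phiE (negPf u1) scale0r subr0.
  have -> : lmulf e 1 = e by apply/lfunP => y; rewrite lmulfE mul1r.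
  rewrite -mulrBl; apply: fil_F2M; last first.
    have := @hit_lmulf_F2 i 1 a; have -> : lmulf e 1 = e by apply/lfunP => y; rewrite lmulfE mul1r.
    by apply=> //; rewrite (@fil_leP _ _ _ phi 1) // fil1 kG1.
  have := hb (crd_phi phi 1%g \o P)%VF; rewrite comp_lfunE PE; last first.
    by rewrite (@fil_leP _ _ _ phi 1) // fil1 kG1.
  by rewrite -(phi1 phi) crd_phiE eqxx scale1r.
rewrite -addrA; apply: memvD.
  apply: memv_suml => p _; apply: fil_F2M; last exact: hit_lmulf_F2 aF.
  apply: fil_hitJ bF => u; rewrite !comp_lfunE PE; last by rewrite (@fil_leP _ _ _ phi 1) // phi_F1.
  by rewrite tau_kG ?mem_kG // linear0.
have -> : \sum_(p < \dim {:A}) hit (crdA p \o S)%VF b * hit (lmulf e (T (vbasis {:A})`_p)) a = 0.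
  rewrite big1 // => p _; have : hit (crdA p \o S)%VF b \in F 0.
    apply: (fil_lower (d := 3) _ bF) => y yF.
    by rewrite comp_lfunE SE RE QE ?subrr ?linear0 // memvB // (fil_leP _ (PF y)).
  by rewrite memv0 => /eqP->; rewrite mul0r.
(* The R-terms give [hit e b * a]: by [hit_lmulf_F3], [lmulf e z] acts on a as the scalar [e z] up
   to a lower term. *)
rewrite addr0 scalerAl -hit_rdeg1 //.
have -> : hit e b = \sum_(p < \dim {:A}) (e (Q (vbasis {:A})`_p) : K) *: hit (crdA p \o R)%VF b.
  rewrite -hit_sum; apply/eqP; rewrite -subr_eq0 -hitB -memv0.
  apply: (fil_lower (d := 3) _ bF) => y yF.
  rewrite add_lfunE opp_lfunE sum_lfunE.
  rewrite (_ : \sum_(p < _) _ = e (R y)); last first.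
    rewrite -[R y]mulr1 (lmulf_split (S := Q)) => [|z]; last by rewrite RE (QE _ (QF _)).
    by apply: eq_bigr => p _; rewrite scale_lfunE lmulfE mulr1; apply: mulrC.
  by rewrite RE QE ?memvB // ?(fil_leP _ (PF y)) // linearB /= (e_F2 (PF y)) subr0 subrr.
rewrite mulr_suml -sumrB; apply: memv_suml => p _; rewrite -scalerAl scalerAr -mulrBr.
case: i aF => [|i] aF.
  by have := hit_lmulf_F3 (QF (vbasis {:A})`_p) aF; rewrite memv0 => /eqP->; rewrite mulr0 mem0v.
apply: (@filM _ _ _ _ 0 i); last exact: hit_lmulf_F3.
apply: (fil_lower (d := 2) _ bF) => y yF.
by rewrite comp_lfunE RE PE // subrr !linear0.
Qed.

Local Notation sy := (symb F N).
Local Notation Z b := (sy 2 (lmul b)).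
Local Notation G := (Gop phi N).
Local Notation E := (sy (- 2%:Z) (hit e)).

Let filt_e : filt F (- 2%:Z) (hit e).
Proof. exact: (@filt_hit _ _ _ _ 2). Qed.

Let filt_b b : b \in F 3 -> filt F 2 (lmul b).
Proof. exact: (@filt_lmul _ _ _ _ 2). Qed.

Lemma E_Z b a : rdeg1 b -> b \in F 3 -> E (Z b a) = Z b (E a) + (e b : K) *: G v a.
Proof.
move=> hb bF; have fb := filt_b bF.
rewrite !(symb_comp (fil0 phi) (filS phi) FN) //.
rewrite addNr subrr [RHS]addrC -(symbP (fil0 phi) (filS phi) FN).
apply: (symb_eq (fil0 phi) (filS phi) FN) => [[[|i]|i] c cF]; rewrite ?sub0r.
- by move: cF; rewrite memv0 => /eqP->; rewrite linear0 mem0v.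
- have -> : Posz i.+1 + (- 1) = i by rewrite -addn1 PoszD addrK.
  have := hit_rdeg1M hb bF cF.
  by rewrite add_lfunE opp_lfunE add_lfunE scale_lfunE !comp_lfunE !lmulE [_ *: _ + _]addrC.
by move: cF; rewrite memv0 => /eqP->; rewrite linear0 mem0v.
Qed.

Lemma G_Z b a : b \in F 3 -> phi v * b = b * phi v -> G v (Z b a) = Z b (G v a).
Proof.
move=> bF vb; rewrite /Gop !(symb_comp (fil0 phi) (filS phi) FN) //;
  do ?exact: filt_phi; do ?exact: filt_b.
rewrite addr0 add0r; congr (sy _ _ _); apply/lfunP => z.
by rewrite !comp_lfunE !lmulE !mulrA vb.
Qed.

(** The argument of [skewp_trivial_action] in degree two, with b as raising element and [hit e] as
    derivation. *)
Lemma e_rdeg1 b : rdeg1 b -> b \in F 3 -> phi v * b = b * phi v -> e b = 0.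
Proof.
move=> hb bF vb; apply/eqP/negPn/negP => eb.
have Giter i : G v (iter i (Z b) 1) = iter i (Z b) (G v 1).
  by elim: i => //= i <-; rewrite G_Z.
have hZ (k : int) y : deg_gt F N k y -> deg_gt F N (k + 1) (Z b y).
  move=> hy; apply: (deg_gt_le (m := k + 1) (k := k + 2)); first by rewrite lerD2l.
  exact: (deg_gt_symb (fil0 phi) (filS phi) FN).
have E1 : E 1 = 0.
  rewrite (symb1 (fil0 phi) (filS phi) FN) ?fil1 ?kG1 //.
  by apply: gp_neg => //; apply: filS.
have [i nz] := raising_nilpotent FN 1 hZ.
have := @derivative_not_nilpotent _ _ char0 (Z b) E (G v) 1 (e b) (one_neq0 A) eb (linear0 _).
case/(_ _ _ i)/negP; last by rewrite nz.
  by move=> y /(congr1 (G v^-1%g)); rewrite (Gop_mul FN) mulVg (Gop1 FN) linear0.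
elim=> [|j IH].
  by rewrite [iter 1 _ _]/= E_Z // E1 linear0 add0r mul1r.
rewrite iterS E_Z // IH linearZ /= -G_Z // -iterS -scalerDl.
by rewrite -[in RHS]natr1 mulrDl mul1r.
Qed.

Lemma e_F3 a : a \in F 3 -> e a = 0.
Proof.
move=> aF; apply/eqP/negPn/negP => ea.
(* The components of right degree u exhaust a modulo [F 2], where [e] vanishes. *)
have [u eu] : exists u, e (hit (crd_phi phi u) a) != 0.
  apply/existsP; apply: contraR ea; rewrite negb_exists => /forallP eu.
  pose r := eps A - \sum_u crd_phi phi u.
  have rJ : J r.
    move=> w; rewrite add_lfunE opp_lfunE sum_lfunE (bigD1 w) //= crd_phiE eqxx.
    rewrite big1 ?addr0 ?eps_grouplike ?phi_grouplike ?subrr // => u /negPf uw.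
    by rewrite crd_phiE uw.
  have := @hit_sum _ _ _ (index_enum gT) (fun=> 1) (crd_phi phi) a.
  under eq_bigr do rewrite scale1r; under [RHS]eq_bigr do rewrite scale1r.
  move=> s.
  have -> : a = \sum_u hit (crd_phi phi u) a + hit r a.
    by rewrite hitB hit_eps s addrCA subrr addr0.
  rewrite linearD linear_sum /= big1 => [|u _]; last by apply/eqP; have := eu u; rewrite negbK.
  by rewrite add0r e_F2 // fil_hitJ.
pose b := hit (crd_phi phi u) a * phi u^-1%g.
have hb : rdeg1 b := rdeg1_crd _ aF.
have bF : b \in F 3 by apply/fil_Mphi/fil_hit.
have eb : e b != 0 by rewrite e_rmul // fil_hit.
have eAd w : w \in F 3 -> e (Ad phi v w) = e w.
  by move=> wF; rewrite e_rmul ?e_lmul //; apply: phi_filM.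
(* Averaging over the conjugates by v makes [G v] commute with the raising      *)
(* operator, as required by [e_rdeg1].                                          *)
pose c j := Ad phi (v ^+ j)%g b.
have cF j : c j \in F 3 by apply/fil_Mphi/phi_filM.
have cS j : Ad phi v (c j) = c j.+1 by rewrite -AdM -expgS.
have ec j : e (c j) = e b.
  by elim: j => [|j IH]; rewrite /c ?expg0 ?Ad1 // -/(c _) -cS eAd.
pose B := \sum_(j < m) c j.
have BF : B \in F 3 by apply: memv_suml.
have vB : phi v * B = B * phi v.
  rewrite phi_Ad; congr (_ * _); rewrite /B linear_sum /= -[RHS](sum_shift (P := c)).
    by apply: eq_bigr => j _; rewrite cS.
  by rewrite /c vm expg0.
have : e B = 0 by apply: e_rdeg1 => //; apply: rdeg1_sum => j; apply: rdeg1_Ad.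
rewrite linear_sum /=; under eq_bigr do rewrite ec.
rewrite sumr_const card_ord -(prednK m0) -mulr_natr => /eqP.
by rewrite mulf_eq0 (negPf eb) (negPf (natS_neq0 char0 _)).
Qed.
End CommutatorFunctional.

Section QuantumCommutator.
Variables (K : fieldType) (A : fhopfType K) (gT : finGroupType).
Variables (phi : grouplike_map A gT) (N : nat).
Hypothesis char0 : [pchar K] =i pred0.
Hypothesis FN : fil phi N = fullv.
Variables (h : gT) (m : nat).
Hypothesis m0 : (0 < m)%N.
Hypothesis hm : (h ^+ m)%g = 1%g.
Variables (n : nat) (xv : 'I_n -> A) (iv : 'I_n -> nat) (cv : 'I_n -> K) (lv : 'I_n -> dual K A).
Hypothesis xvP : forall k, eigp phi h (h ^+ iv k)%g (cv k) (xv k).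
Hypothesis lvJ : forall k, inJ phi (lv k).
Hypothesis lv_xv : forall k j, lv k (xv j) = (k == j)%:R.
Hypothesis F2_ind : forall P : A -> Prop, P 0 -> (forall a b, P a -> P b -> P (a + b)) ->
  (forall a, a \in kG phi -> P a) -> (forall k u c, P (c *: (xv k * phi u))) ->
  forall a, a \in fil phi 2 -> P a.
Hypothesis cv_self : forall k, cv k ^+ iv k = -1.
Hypothesis cv_pair : forall k j, cv k ^+ iv j * cv j ^+ iv k = 1.
Implicit Types (f g : dual K A) (a b w x y : A) (u v : gT) (j k l : 'I_n) (i : nat).
Local Notation J := (inJ phi).
Local Notation F := (fil phi).

(** The functional f_k of the overview, made insensitive to group-like right factors. *)
Definition dualx k : dual K A := indf phi (lv k).

Lemma dualx_J k : J (dualx k).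
Proof. exact: indf_inJ. Qed.

Lemma dualx_kG k a : a \in kG phi -> dualx k a = 0.
Proof. by apply: kG_dual; apply: dualx_J. Qed.

Lemma dualx_x k j u : dualx k (xv j * phi u) = (k == j)%:R.
Proof. by rewrite (indf_skew _ (lvJ k) (xvP j).1) lv_xv. Qed.

Lemma F2_dual f : J f -> (forall k u, f (xv k * phi u) = 0) -> forall a, a \in F 2 -> f a = 0.
Proof.
move=> fJ fx a; move: a; apply: F2_ind => [|a b ha hb|a aG|k u c].
- by rewrite linear0.
- by rewrite linearD /= ha hb addr0.
- exact: (kG_dual fJ).
by rewrite linearZ /= fx scaler0.
Qed.

Lemma F2_dual_eq f g : J f -> J g -> (forall k u, f (xv k * phi u) = g (xv k * phi u)) ->
  forall a, a \in F 2 -> f a = g a.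
Proof.
move=> fJ gJ e a aF; apply/eqP; rewrite -subr_eq0; apply/eqP.
rewrite -[LHS](_ : (f - g) a = _); last by rewrite add_lfunE opp_lfunE.
move: a aF; apply: F2_dual => [u|k u]; rewrite add_lfunE opp_lfunE.
  by rewrite fJ gJ subrr.
by rewrite e subrr.
Qed.

Lemma phi_x i k u : phi (h ^+ i)%g * (xv k * phi u) = cv k ^+ i *: (xv k * phi (h ^+ i * u)%g).
Proof. by rewrite mulrA phi_Ad (Ad_expg i (xvP k).2) -mulrA -phiM scalerAl. Qed.

Lemma dualx_lmul k i a : a \in F 2 -> dualx k (phi (h ^+ i)%g * a) = cv k ^+ i * dualx k a.
Proof.
move=> aF; rewrite -lmulfE.
have -> : cv k ^+ i * dualx k a = (cv k ^+ i *: dualx k) a by rewrite scale_lfunE.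
move: a aF; apply: F2_dual_eq => [u|u|j u].
- by rewrite lmulfE -phiM dualx_J.
- by rewrite scale_lfunE dualx_J scaler0.
rewrite lmulfE phi_x linearZ scale_lfunE /= !dualx_x.
by case: eqVneq => [->|] //; rewrite !scaler0.
Qed.

Lemma dualx_rmul k u a : a \in F 2 -> dualx k (a * phi u) = dualx k a.
Proof.
move=> aF; rewrite -rmulfE; move: a aF; apply: F2_dual_eq => [v|v|j v].
- by rewrite rmulfE -phiM dualx_J.
- exact: dualx_J.
by rewrite rmulfE -mulrA -phiM !dualx_x.
Qed.

Lemma eps_kG f (c : K) a : (forall u, f (phi u) = c) -> a \in kG phi -> f a = c * eps A a.
Proof.
move=> fc aG; apply/eqP; rewrite -subr_eq0; apply/eqP.
rewrite -[LHS](_ : (f - c *: eps A) a = _); last by rewrite add_lfunE opp_lfunE scale_lfunE.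
apply: kG_dual aG => u; rewrite add_lfunE opp_lfunE scale_lfunE fc.
by rewrite eps_grouplike ?phi_grouplike //; apply/eqP; rewrite subr_eq0 eq_sym; apply/eqP/mulr1.
Qed.

Lemma dualx_hit_eq k f g a : (forall b, b \in F 2 -> f b = g b) -> a \in F 3 ->
  dualx k (hit f a) = dualx k (hit g a).
Proof.
move=> fg aF; apply/eqP; rewrite -subr_eq0 -linearB -hitB /=; apply/eqP/dualx_kG.
rewrite -fil1; apply: (fil_lower (d := 2) _ aF) => b bF.
by rewrite add_lfunE opp_lfunE fg ?subrr.
Qed.

Lemma dualx_hit_kG k f g a : (forall u, f (phi u) = g (phi u)) -> a \in F 2 ->
  hit f a - hit g a \in kG phi.
Proof.
move=> fg aF; rewrite -hitB -fil1; apply: fil_hitJ => // u.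
by rewrite add_lfunE opp_lfunE fg subrr.
Qed.

Lemma hit_dualx_kG k a : a \in F 2 -> hit (dualx k) a \in kG phi.
Proof. by move=> aF; rewrite -fil1; apply: fil_hitJ => //; apply: dualx_J. Qed.

Lemma conv_dualx_x k l j a : a \in F 2 -> conv (dualx k) (dualx l) (xv j * a) =
  (k == j)%:R * dualx l a + (l == j)%:R * (cv k ^+ iv j * dualx k a).
Proof.
move=> aF; rewrite -dual_hit (hit_skewM _ _ (xvP j).1) linearD /=; congr (_ + _).
  rewrite -lmulfE (@eps_kG _ (k == j)%:R) ?hit_dualx_kG ?eps_hit // => u.
  by rewrite lmulfE dualx_x.
rewrite -dualx_lmul //.
have e : hit (lmulf (dualx l) (xv j)) a - hit ((l == j)%:R *: eps A) a \in kG phi.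
  apply: dualx_hit_kG => // u; rewrite lmulfE dualx_x scale_lfunE.
  by rewrite eps_grouplike ?phi_grouplike //; apply/esym/mulr1.
rewrite -[hit (lmulf _ _) a](subrK (hit ((l == j)%:R *: eps A) a)) mulrDr linearD /=.
rewrite [X in X + _]dualx_kG ?add0r; last first.
  by rewrite -fil1 phi_filM // fil1.
by rewrite hitZ hit_eps -scalerAr linearZ.
Qed.

Definition qcomm k l : dual K A :=
  conv (dualx k) (dualx l) - (cv k ^+ iv l) *: conv (dualx l) (dualx k).

Lemma qcommE k l a : qcomm k l a =
  dualx k (hit (dualx l) a) - cv k ^+ iv l * dualx l (hit (dualx k) a).
Proof. by rewrite add_lfunE opp_lfunE scale_lfunE -!dual_hit. Qed.

Lemma qcomm_F2 k l a : a \in F 2 -> qcomm k l a = 0.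
Proof. by move=> aF; rewrite qcommE !dualx_kG ?hit_dualx_kG // mulr0 subrr. Qed.

Lemma qcomm_xF2 k l j a : a \in F 2 -> qcomm k l (xv j * a) = 0.
Proof.
move=> aF; rewrite qcommE !dual_hit !conv_dualx_x // mulrDr opprD.
(* [c] and [c'] stand for the Kronecker symbols of j = k and j = l. In the first case q p' = 1 by
   [cv_pair], in the second p = q, and the two orders cancel. *)
have e (c c' p p' q d d' : K) : (c = 1 -> q * p' = 1) -> (c' = 1 -> p = q) ->
    (c = 0 \/ c = 1) -> (c' = 0 \/ c' = 1) ->
    c * d' + c' * (p * d) + (- (q * (c' * d)) - q * (c * (p' * d'))) = 0.
  move=> h1 h2 [e1|e1] [e2|e2]; move: h1 h2; rewrite e1 e2 => h1 h2; rewrite ?(mul0r, mulr0, mul1r).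
  - by rewrite !(addr0, oppr0).
  - by rewrite h2 // oppr0 addr0 add0r subrr.
  - by rewrite !mulrA h1 // mul1r oppr0 add0r addr0 subrr.
  by rewrite mulrA h1 // h2 // mul1r -opprD [X in _ - X]addrC subrr.
apply: e.
- by case: eqVneq => [->|_ /eqP] // ; rewrite eq_sym oner_eq0.
- by case: eqVneq => [->|_ /eqP] // ; rewrite eq_sym oner_eq0.
- by case: eqP; [right | left].
by case: eqP; [right | left].
Qed.

Lemma qcomm_F2M k l a b : a \in F 2 -> b \in F 2 -> qcomm k l (a * b) = 0.
Proof.
move=> + bF; move: a; apply: F2_ind => [|a a' h1 h2|a aG|j u c].
- by rewrite mul0r linear0.
- by rewrite mulrDl linearD /= h1 h2 addr0.
- by apply: qcomm_F2; have := @filM _ _ _ phi 0 1 a b; rewrite fil1; apply.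
rewrite -scalerAl linearZ /= -mulrA qcomm_xF2 ?scaler0 //.
exact: phi_filM.
Qed.

Lemma conv_dualx_rmul k l u a : a \in F 3 ->
  dualx k (hit (dualx l) (a * phi u)) = dualx k (hit (dualx l) a).
Proof.
move=> aF; rewrite hit_Mgrouplike ?phi_grouplike //.
have e : dualx k (hit (rmulf (dualx l) (phi u)) a) = dualx k (hit (dualx l) a).
  by apply: dualx_hit_eq => // b bF; rewrite rmulfE dualx_rmul.
rewrite dualx_rmul //; apply: fil_hitJ => // v.
by rewrite rmulfE -phiM dualx_J.
Qed.

Lemma qcomm_rmul k l u a : a \in F 3 -> qcomm k l (a * phi u) = qcomm k l a.
Proof. by move=> aF; rewrite !qcommE !conv_dualx_rmul. Qed.

Lemma conv_dualx_lmul k l i a : a \in F 3 ->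
  dualx k (hit (dualx l) (phi (h ^+ i)%g * a)) =
  cv k ^+ i * (cv l ^+ i * dualx k (hit (dualx l) a)).
Proof.
move=> aF; rewrite hit_grouplikeM ?phi_grouplike // dualx_lmul; last first.
  by apply: fil_hitJ => // v; rewrite lmulfE -phiM dualx_J.
have -> : dualx k (hit (lmulf (dualx l) (phi (h ^+ i)%g)) a) =
    dualx k (hit (cv l ^+ i *: dualx l) a).
  by apply: dualx_hit_eq => // b bF; rewrite lmulfE dualx_lmul // scale_lfunE.
by rewrite hitZ [dualx k (_ *: _)]linearZ.
Qed.

(** The scalar is the product of [cv k] and [cv l] raised to iv k + iv l, that is (-1)(-1) q_kl q_lk
    = 1. *)
Lemma qcomm_lmul k l a : a \in F 3 ->
  qcomm k l (phi (h ^+ (iv k + iv l))%g * a) = qcomm k l a.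
Proof.
move=> aF; rewrite !qcommE !conv_dualx_lmul //.
have e : cv k ^+ (iv k + iv l) * cv l ^+ (iv k + iv l) = 1.
  by rewrite !exprD !cv_self mulN1r mulrN1 mulrNN cv_pair.
by rewrite mulrA e [cv l ^+ _ * (_ * _)]mulrA [cv l ^+ _ * _]mulrC e !mul1r.
Qed.

Lemma crd_hit_dualx k u a : a \in F 2 ->
  crd_phi phi u (hit (dualx k) a) = dualx k (hit (crd_phi phi ((h ^+ iv k)^-1 * u)%g) a).
Proof.
rewrite !dual_hit; move: a; apply: F2_dual_eq => [w|w|j w].
- exact: (inJ_convr _ (dualx_J k)).
- exact: (inJ_convl _ (dualx_J k)).
rewrite -!dual_hit !(hit_skewM _ _ (xvP j).1) !hit_grouplike ?phi_grouplike //.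
rewrite !lmulfE dualx_J dualx_x scale0r mulr0 add0r crd_phiE.
rewrite -scalerAr -phiM !linearD /= linearZ /= crd_phiE -scalerAr linearZ /= dualx_x.
rewrite -scalerAr -phiM [dualx k (_ *: phi _)]linearZ /= dualx_J scaler0 addr0.
have [->|_] := eqVneq k j; last by rewrite scale0r scaler0.
by rewrite scale1r [RHS]mulr1 -[in RHS](inj_eq (mulgI (h ^+ iv j)%g)) mulKVg.
Qed.

Lemma crd_conv_dualx k l u a : a \in F 3 ->
  crd_phi phi u (hit (dualx k) (hit (dualx l) a)) =
  dualx k (hit (dualx l) (hit (crd_phi phi ((h ^+ (iv k + iv l))^-1 * u)%g) a)).
Proof.
move=> aF; rewrite crd_hit_dualx; last by apply: fil_hitJ aF; apply: dualx_J.
rewrite -!hit_conv; apply: (dualx_hit_eq _ _ aF) => b bF.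
by rewrite -!dual_hit crd_hit_dualx // expgD invMg mulgA.
Qed.

Lemma qcomm_crd k l u a : a \in F 3 ->
  crd_phi phi u (hit (qcomm k l) a) =
  qcomm k l (hit (crd_phi phi ((h ^+ (iv k + iv l))^-1 * u)%g) a).
Proof.
move=> aF; rewrite hitB hitZ !hit_conv linearB linearZ /= !crd_conv_dualx // qcommE.
by rewrite [(iv l + _)%N]addnC.
Qed.

Lemma qcomm_F3 k l a : a \in F 3 -> qcomm k l a = 0.
Proof.
apply: (@e_F3 _ _ _ phi N char0 FN _ (h ^+ (iv k + iv l))%g m m0).
- by rewrite -expgM mulnC expgM hm expg1n.
- exact: qcomm_F2.
- exact: qcomm_F2M.
- by move=> u b; apply: qcomm_rmul.
- by move=> b; apply: qcomm_lmul.
by move=> u b; apply: qcomm_crd.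
Qed.

(** * Generation *)

Lemma hit_dualx_comm k l i a : a \in F i.+3 ->
  hit (dualx k) (hit (dualx l) a) - cv k ^+ iv l *: hit (dualx l) (hit (dualx k) a) \in F i.
Proof.
move=> aF; rewrite -!hit_conv -hitZ -hitB.
have -> : i = (i.+3 - 3)%N by rewrite -addn3 addnK.
by apply: (fil_lower _ aF); apply: qcomm_F3.
Qed.

Lemma hit_dualx_twice k l i a : a \in F i.+3 -> hit (dualx l) a \in F i.+1 ->
  hit (dualx l) (hit (dualx k) a) \in F i.
Proof.
move=> aF laF; have := hit_dualx_comm l k aF.
have kl : hit (dualx k) (hit (dualx l) a) \in F i by apply: fil_hitJ laF; apply: dualx_J.
by move=> h1; have := memvD h1 (memvZ (cv l ^+ iv k) kl); rewrite subrK.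
Qed.

(** For l = k the q-commutator is twice the square of f_k, because q_kk = -1. *)
Lemma hit_dualx_square k i a : a \in F i.+3 -> hit (dualx k) (hit (dualx k) a) \in F i.
Proof.
move=> aF; have := hit_dualx_comm k k aF; rewrite cv_self scaleN1r opprK -mulr2n -scaler_nat.
have two : 2%:R != 0 :> K := natS_neq0 char0 1.
by move=> /(memvZ 2%:R^-1); rewrite scalerA mulVf // scale1r.
Qed.

Lemma hit_dualx_phi k i (j : nat) a : a \in F i.+2 ->
  hit (dualx k) (phi (h ^+ j)%g * a) - cv k ^+ j *: (phi (h ^+ j)%g * hit (dualx k) a) \in F i.
Proof.
move=> aF; rewrite hit_grouplikeM ?phi_grouplike // scalerAr -mulrBr -hitZ -hitB.
have hF : hit (lmulf (dualx k) (phi (h ^+ j)%g) - (cv k ^+ j : K) *: dualx k) a \in F i.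
  have -> : i = (i.+2 - 2)%N by rewrite subn2.
  apply: (fil_lower _ aF) => b bF.
  by rewrite add_lfunE opp_lfunE scale_lfunE lmulfE dualx_lmul // subrr.
by case: (i) hF => [|i']; [rewrite memv0 => /eqP->; rewrite mulr0 mem0v | apply: phi_filM].
Qed.

(** Modulo functionals killing [F 2], which lower the degree by two, J is spanned by the products
    [conv (crd_phi _) (dualx k)]; testing the f_k therefore suffices. *)
Lemma fil_dualx i a : a \in F i.+3 -> (forall k, hit (dualx k) a \in F i.+1) -> a \in F i.+2.
Proof.
move=> aF ha; apply/filP => f fJ.
(* [hit (dualx k)] sends [xv k * phi u] to [phi (h ^+ iv k * u)], and [crd_phi] at that element
   reads off u. *)
pose g := \sum_k \sum_u (f (xv k * phi u) : K) *: conv (crd_phi phi (h ^+ iv k * u)%g) (dualx k).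
have gJ : J g.
  move=> w; rewrite sum_lfunE big1 // => k _; rewrite sum_lfunE big1 // => u _.
  by rewrite scale_lfunE (inJ_convr _ (dualx_J k)) scaler0.
have fg b : b \in F 2 -> f b = g b.
  move: b; apply: F2_dual_eq => // j w.
  rewrite sum_lfunE (bigD1 j) //= [X in _ + X]big1 ?addr0 => [|k kj].
    rewrite sum_lfunE (bigD1 w) //= [X in _ + X]big1 ?addr0 => [|u uw].
      rewrite scale_lfunE -dual_hit (hit_skewM _ _ (xvP j).1) !hit_grouplike ?phi_grouplike //.
      rewrite !lmulfE dualx_J dualx_x scale0r mulr0 add0r eqxx scale1r -phiM crd_phiE eqxx.
      exact/esym/mulr1.
    rewrite scale_lfunE -dual_hit (hit_skewM _ _ (xvP j).1) !hit_grouplike ?phi_grouplike //.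
    rewrite !lmulfE dualx_J dualx_x scale0r mulr0 add0r eqxx scale1r -phiM crd_phiE.
    by rewrite (inj_eq (mulgI _)) (negPf uw) scaler0.
  rewrite sum_lfunE big1 // => u _.
  rewrite scale_lfunE -dual_hit (hit_skewM _ _ (xvP j).1) !hit_grouplike ?phi_grouplike //.
  rewrite !lmulfE dualx_J dualx_x (negPf kj) !scale0r !mulr0 addr0 linear0.
  exact: scaler0.
rewrite -[f](subrK g) hitD; apply: memvD.
  have -> : i.+1 = (i.+3 - 2)%N by rewrite subn2.
  by apply: (fil_lower _ aF) => b bF; rewrite add_lfunE opp_lfunE fg // subrr.
have hit0f : hit 0 a = 0 by rewrite -(scale0r (0 : dual K A)) hitZ scale0r.
rewrite /g (big_morph (fun f => hit f a) (fun f g => hitD f g a) hit0f).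
apply: memv_suml => k _; rewrite hit_sum; apply: memv_suml => u _.
by rewrite memvZ // hit_conv fil_hit.
Qed.

(** The indices are treated one at a time. Subtracting x_k0 u lowers the degree of f_k0 r because
    f_k0 squared is low; it does not spoil an earlier f_k, since f_k f_k0 r is q times f_k0 f_k r up
    to a low term and f_k r is already low. *)
Lemma fil_step i a : a \in F i.+3 ->
  exists b : 'I_n -> A, (forall k, b k \in F i.+2) /\ a - \sum_k xv k * b k \in F i.+2.
Proof.
move=> aF; have xF k : xv k \in F 2 := skewp_F2 (xvP k).1.
have : forall d, (d <= n)%N -> exists b : 'I_n -> A, (forall k, b k \in F i.+2) /\
    forall k : 'I_n, (k < d)%N -> hit (dualx k) (a - \sum_k xv k * b k) \in F i.+1.
  elim=> [|d IH] dn; first by exists (fun=> 0); split=> // k; rewrite mem0v.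
  have [b [bF hb]] := IH (ltnW dn); set r := a - _ in hb.
  have rF : r \in F i.+3.
    by rewrite memvB // memv_suml // => k _; apply: (@filM _ _ _ phi 1 i.+1).
  pose k0 := Ordinal dn.
  (* The inverse type is rewritten as a non-negative power of h, the form in which [hit_dualx_phi]
     applies. *)
  have [j vV] : exists j : nat, (h ^- iv k0 = h ^+ j)%g.
    exists (m.-1 * iv k0)%N; rewrite expgM -expgVn; congr (_ ^+ _)%g.
    by apply/eqP; rewrite eq_invg_mul -expgS prednK // hm.
  pose u := phi (h ^+ j)%g * hit (dualx k0) r.
  have uF : u \in F i.+2 by apply/phi_filM/fil_hitJ => //; apply: dualx_J.
  exists (fun k => b k + (k == k0)%:R *: u); split=> [k|k kd].
    by rewrite memvD ?memvZ.
  have -> : a - \sum_k xv k * (b k + (k == k0)%:R *: u) = r - xv k0 * u.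
    rewrite /r -addrA -opprD; congr (_ - _).
    rewrite [X in _ = _ + X](_ : _ = \sum_k xv k * ((k == k0)%:R *: u)).
      by rewrite -big_split; apply: eq_bigr => k' _; rewrite mulrDr.
    rewrite (bigD1 k0) //= eqxx scale1r big1 ?addr0 // => k' /negPf->.
    by rewrite scale0r mulr0.
  have ku : hit (dualx k) u \in F i.
    have kF : hit (dualx k) (hit (dualx k0) r) \in F i.
      have [->|kk0] := eqVneq k k0; first exact: hit_dualx_square.
      apply: hit_dualx_twice => //; apply: hb; rewrite ltn_neqAle -ltnS kd andbT.
      by apply: contra kk0 => /eqP e; apply/eqP/val_inj.
    have := @hit_dualx_phi k i j (hit (dualx k0) r) (fil_hitJ (dualx_J k0) rF).
    rewrite -/u => uD; rewrite -[hit _ u](subrK (cv k ^+ j *: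
      (phi (h ^+ j)%g * hit (dualx k) (hit (dualx k0) r)))).
    rewrite memvD // memvZ //.
    by case: (i) kF => [|i']; [rewrite memv0 => /eqP->; rewrite mulr0 mem0v | apply: phi_filM].
  rewrite linearB /= (hit_skewM _ _ (xvP k0).1) opprD addrA addrAC; apply: memvB; last first.
    case: (i) ku => [|i']; first by rewrite memv0 => /eqP->; rewrite mulr0 mem0v.
    exact: (@filM _ _ _ phi 1 i').
  have kl : hit (lmulf (dualx k) (xv k0)) u - (k == k0)%:R *: u \in F i.+1.
    rewrite -{2}[u]hit_eps -hitZ -hitB; apply: fil_hitJ uF => w.
    rewrite add_lfunE opp_lfunE scale_lfunE lmulfE dualx_x eps_grouplike ?phi_grouplike //.
    by apply/eqP; rewrite subr_eq0 eq_sym; apply/eqP/mulr1.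
  have [e|kk0] := eqVneq k k0; last first.
    apply: memvB.
      apply: hb; rewrite ltn_neqAle -ltnS kd andbT.
      by apply: contra kk0 => /eqP e; apply/eqP/val_inj.
    by apply: phi_filM; move: kl; rewrite (negPf kk0) scale0r subr0.
  move: kl; rewrite e eqxx scale1r => /(phi_filM (h ^+ iv k0)%g).
  by rewrite mulrBr /u mulrA -phiM -vV mulgV phi1 mul1r -memvN opprB.
move=> /(_ n (leqnn n))[b [bF hb]]; exists b; split=> //.
apply: fil_dualx => [|k]; last exact: hb.
by rewrite memvB // memv_suml // => k _; apply: (@filM _ _ _ phi 1 i.+1).
Qed.

Lemma fil_agenv i a : a \in F i -> a \in agenv <<phis phi ++ codom xv>>%VS.
Proof.
set U := agenv _; have sub b : b \in phis phi ++ codom xv -> b \in U.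
  by move=> bs; apply: (subvP (sub_agenv _)); apply: memv_span.
have UG b : b \in kG phi -> b \in U.
  move: b; apply/subvP/span_subvP => b bs; apply: sub; by rewrite mem_cat bs.
have Ux k : xv k \in U by apply: sub; rewrite mem_cat codom_f orbT.
have UF2 b : b \in F 2 -> b \in U.
  move: b; apply: F2_ind => [|b c|//|k u c]; [exact: mem0v | exact: memvD |].
  by rewrite memvZ // memvM // UG // mem_kG.
elim: i a => [|[|[|i]] IH] a; first by rewrite memv0 => /eqP->; rewrite mem0v.
- by rewrite fil1; apply: UG.
- exact: UF2.
move=> /fil_step[b [bF /IH ab]]; rewrite -[a](subrK (\sum_k xv k * b k)) memvD //.
by rewrite memv_suml // => k _; rewrite memvM //; apply: IH.
Qed.
End QuantumCommutator.

(** * Roots of unity, the dihedral presentation and the conclusion *)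

Lemma closed_prim_root (K : closedFieldType) n : [pchar K] =i pred0 -> (0 < n)%N ->
  exists z : K, n.-primitive_root z.
Proof.
move=> char0 n0; pose p : {poly K} := 'X^n - 1.
have [r rp] := closed_field_poly_normal p.
have mp : p \is monic by apply: monicXnsubC.
rewrite (monicP mp) scale1r in rp.
have rn1 : all n.-unity_root r by apply/allP=> z; rewrite -root_prod_XsubC -rp.
have szr : size r = n.
  by apply: succn_inj; rewrite -(size_prod_XsubC _ id) -rp size_XnsubC.
have Ur : uniq r.
  by rewrite -separable_prod_XsubC -rp separable_Xn_sub_1 // -(prednK n0) natS_neq0.
have /hasP[z _ zp] := has_prim_root n0 rn1 Ur (eq_leq (esym szr)).
by exists z.
Qed.

(** The relations only bound the order of h above by q. Equality is a count: the 2q elements are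
    products of powers of h and of s, and s has order at most 2. *)
Lemma dihedral_gens q : (1 < q)%N -> exists h s : 'D_(q.*2),
  [/\ #[h]%g = q, (s * s)%g = 1%g, (s * h * s)%g = (h^-1)%g
    & forall u, exists i, u = (h ^+ i)%g \/ u = (h ^+ i * s)%g].
Proof.
move=> q1; have := Grp_dihedral q1 [set: 'D_(q.*2)]%G.
rewrite homg_refl => /esym/existsP[[h s] /=].
case/eqP=> hs hq s2 hsV; exists h, s.
have ss : (s * s)%g = 1%g by rewrite -expg2.
have sV : (s^-1 = s)%g by apply/eqP; rewrite eq_invg_mul ss.
have G_hs : (<[h]> * <[s]>)%g = [set: 'D_(q.*2)].
  rewrite -hs norm_joinEr // cycle_subG; apply/normP.
  by rewrite -cycleJ hsV cycleV.
have os : (#[s]%g <= 2)%N by apply: dvdn_leq => //; rewrite order_dvdn s2.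
have hE : #[h]%g = q.
  apply/eqP; rewrite eqn_leq; apply/andP; split.
    by apply: dvdn_leq; [apply: ltnW | rewrite order_dvdn hq].
  have := leq_mul (leqnn #[h]%g) os.
  have : (#|[set: 'D_(q.*2)]| <= #[h]%g * #[s]%g)%N.
    by rewrite -G_hs !orderE mul_cardG leq_pmulr ?cardG_gt0.
  rewrite card_dihedral //; lia.
split=> // [|u].
  by rewrite -[X in (X * _ * _)%g]sV -hsV conjgE mulgA.
have : u \in (<[h]> * <[s]>)%g by rewrite G_hs inE.
case/mulsgP=> a b /cycleP[i ->] /cycleP[j ->] ->; exists i.
have [->|->] : (s ^+ j = 1 \/ s ^+ j = s)%g; [|by left; rewrite mulg1|by right].
by elim: j => [|j [e|e]]; [left | right; rewrite expgSr e mul1g | left; rewrite expgSr e ss].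
Qed.

Theorem theorem3p2 (k : closedFieldType) (char_k : [pchar k] =i pred0)
    (t m : nat) (t_ge3 : (3 <= t)%N) (def_m : m = (4 * t)%N)
    (A : fhopfType k) (A_pointed : pointed A)
    (GA : grouplikes_isog A 'D_(2 * m)) :
  generated_by (fun a : A => grouplike a \/ skew_primitive a).
Proof.
have [phi0 [inj0 one0 mul0 glP]] := GA.
pose phi := GrouplikeMap inj0 one0 mul0 glP.
have [N FN] := fil_full phi A_pointed.
have t0 : (0 < t)%N by apply: leq_trans t_ge3.
have m0 : (0 < 4 * t)%N by rewrite muln_gt0.
have q1 : (1 < 4 * t)%N by lia.
have [h [s [oh ss shs gen]]] : exists h s : 'D_(2 * m),
    [/\ #[h]%g = (4 * t)%N, (s * s)%g = 1%g, (s * h * s)%g = (h^-1)%g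
    & forall u, exists i, u = (h ^+ i)%g \/ u = (h ^+ i * s)%g].
  by rewrite def_m mul2n; apply: dihedral_gens.
have hm : (h ^+ (4 * t))%g = 1%g by rewrite -oh expg_order.
have [om om_prim] := closed_prim_root char_k m0.
have rot := no_reflection char_k FN t_ge3 oh ss shs gen om_prim.
have [n [xv [iv [cv [lv [xvP xG lvJ lvx F2P]]]]]] := skew_basis char_k m0 hm rot om_prim.
have cv_self j : cv j ^+ iv j = -1 by apply: (rot_eig char_k FN m0 oh ss shs (xvP j) (xG j)).
have cv_pair i j : cv i ^+ iv j * cv j ^+ iv i = 1.
  exact: (rot_pair char_k FN t0 oh ss shs om_prim (xvP i) (xvP j) (xG i) (xG j)).
move=> a; exists (phis phi ++ codom xv); split=> [x|].
  rewrite mem_cat => /orP[/mapP[u _ ->]|/codomP[j ->]].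
    by left; apply: phi_grouplike.
  by right; apply: (skewp_skew_primitive (xvP j).1).
apply: (fil_agenv char_k FN m0 hm xvP lvJ lvx F2P cv_self cv_pair (i := N)).
by rewrite FN memvf.
Qed.
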